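(* Let $-n<q<0$. Then ${\rm Pos}(T_q)$ consists exactly of those functions $h\in C_e^\infty(S^{n-1})$ such that the distribution $h\cdot r^q$ is positive definite.
   Context: $C_e^\infty(S^{n-1})$ is the space of even real-valued infinitely differentiable functions on $S^{n-1}$, ordered pointwise. For $h$ on $S^{n-1}$ and real $s$, $h\cdot r^s(x)=|x|_2^s h(x/|x|_2)$ on $\mathbb{R}^n\setminus\{0\}$, viewed as a Schwartz distribution. Fourier transform: $\hat\phi(x)=\int_{\mathbb{R}^n}\phi(\xi)e^{-i(x,\xi)}d\xi$, extended to distributions by $\langle\hat h,\phi\rangle=\langle h,\hat\phi\rangle$. An even distribution is positive definite if its Fourier transform is nonnegative on every nonnegative even Schwartz test function. For $-n<q<0$ and $f\in C_e^\infty(S^{n-1})$, the Fourier transform of the distribution $f\cdot r^{-n-q}$ is of the form $g\cdot r^q$ with $g\in C_e^\infty(S^{n-1})$ (a known fact); the operator $T_q:C_e^\infty(S^{n-1})\to C_e^\infty(S^{n-1})$ is defined by $T_qf=g$, i.e. $T_qf(\xi)=(f\cdot r^{-n-q})^\wedge(\xi)$ for $\xi\in S^{n-1}$. For a linear operator $T:C_e^\infty(S^{n-1})\to C_e^\infty(S^{n-1})$, ${\rm Pos}(T)$ is the set of $h\in C_e^\infty(S^{n-1})$ such that $\int_{S^{n-1}}f(x)h(x)\,dx\ge0$ for every $f\in C_e^\infty(S^{n-1})$ with $Tf(x)\ge 0$ for all $x\in S^{n-1}$. *)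

(* Defs.v *)
From HB Require Import structures.
From mathcomp Require Import all_boot all_order all_algebra.
From mathcomp Require Import all_classical all_reals all_analysis.
From Stdlib Require Import ClassicalEpsilon.
Set Implicit Arguments. Unset Strict Implicit. Unset Printing Implicit Defensive.
Import Order.TTheory GRing.Theory Num.Theory.
Import numFieldNormedType.Exports.
Local Open Scope classical_set_scope.
Local Open Scope ring_scope.

Section Defs.
Variables (R : realType) (n : nat).
Implicit Types (x y : 'rV[R]_n) (F f g h phi : 'rV[R]_n -> R).

Definition dotR x y : R := \sum_(i < n) x ord0 i * y ord0 i.
Definition enorm x : R := Num.sqrt (dotR x x).

Definition sphere : set 'rV[R]_n := [set x | enorm x = 1].
Definition radproj x : 'rV[R]_n := (enorm x)^-1 *: x.

(** Lebesgue integral over R^n, written as the iterated integral over R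
    (all integrands used below are absolutely integrable, so by Fubini this
    is the n-dimensional Lebesgue integral). *)
Fixpoint iter_int (m : nat) (G : seq R -> R) : R :=
  match m with
  | 0%N => G [::]
  | m'.+1 => Rintegral lebesgue_measure setT
               (fun t => iter_int m' (fun s => G (t :: s)))
  end.
Definition integral_Rn F : R := iter_int n (fun s => F (\row_(i < n) nth 0 s i)).

(** Integral over S^{n-1} w.r.t. surface measure, via the polar-coordinate
    identity  int_{S^{n-1}} G dsigma = n * int_{|x|_2 <= 1} G(x/|x|_2) dx. *)
Definition sphere_int F : R :=
  n%:R * integral_Rn (fun x => if enorm x <= 1 then F (radproj x) else 0).

Definition ei (i : 'I_n) : 'rV[R]_n := delta_mx ord0 i.
Fixpoint pderiv (l : seq 'I_n) F : 'rV[R]_n -> R :=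
  match l with
  | [::] => F
  | i :: l' => fun x => derive (pderiv l' F) x (ei i)
  end.
Definition smooth_on (U : set 'rV[R]_n) F : Prop :=
  forall l : seq 'I_n, forall x, U x ->
    (forall i, derivable (pderiv l F) x (ei i)) /\
    {for x, continuous (pderiv l F)}.

(** C_e^infty(S^{n-1}): even functions on the sphere whose 0-homogeneous
    extension x |-> h(x/|x|_2) is C^infty on R^n \ {0}.  Only the values of
    h on the sphere are relevant. *)
Definition Ce h : Prop :=
  (forall x, sphere x -> h (- x) = h x) /\
  smooth_on [set x | x != 0] (fun x => h (radproj x)).

Definition schwartz phi : Prop :=
  smooth_on setT phi /\
  forall (l : seq 'I_n) (k : nat), exists C : R,
    forall x, enorm x ^+ k * `|pderiv l phi x| <= C.

(** Fourier transform phi^(x) = int phi(xi) e^{-i(x,xi)} dxi, split as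
    ft_cos phi x - i * ft_sin phi x. *)
Definition ft_cos phi x : R := integral_Rn (fun xi => phi xi * cos (dotR x xi)).
Definition ft_sin phi x : R := integral_Rn (fun xi => phi xi * sin (dotR x xi)).

Definition hr h (s : R) x : R := (enorm x) `^ s * h (radproj x).

(** Real and imaginary parts of <F^, phi> = <F, phi^> for the (locally
    integrable) distribution F and a real Schwartz function phi. *)
Definition FT_re F phi : R := integral_Rn (fun x => F x * ft_cos phi x).
Definition FT_im F phi : R := - integral_Rn (fun x => F x * ft_sin phi x).
Definition pair_re F phi : R := integral_Rn (fun x => F x * phi x).

(** Positive definiteness of an even distribution F. *)
Definition posdef F : Prop :=
  forall phi, schwartz phi -> (forall x, phi (- x) = phi x) ->
    (forall x, 0 <= phi x) -> FT_im F phi = 0 /\ 0 <= FT_re F phi.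

(** (f . r^{-n-q})^ = g . r^q  as distributions (tested on real Schwartz
    functions, which suffices by complex linearity). *)
Definition Tq_rel (q : R) f g : Prop :=
  forall phi, schwartz phi ->
    FT_re (hr f (- n%:R - q)) phi = pair_re (hr g q) phi /\
    FT_im (hr f (- n%:R - q)) phi = 0.

Definition Tq (q : R) (f : 'rV[R]_n -> R) : 'rV[R]_n -> R :=
  epsilon (inhabits (fun _ : 'rV[R]_n => 0)) (fun g => Ce g /\ Tq_rel q f g).

Definition Pos (T : ('rV[R]_n -> R) -> ('rV[R]_n -> R)) h : Prop :=
  Ce h /\
  forall f, Ce f -> (forall x, sphere x -> 0 <= T f x) ->
    0 <= sphere_int (fun x => f x * h x).

End Defs.

(* Main.v *)
(** Put [a = n + q], so that [0 < a < n], and let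
    [A_a G (x) = int_0^oo s^(a-1) G (s x) ds], which is homogeneous of degree [-a].
    By Fubini and dilations, [int A_a G . H = int G . A_(n-a) H], and by the
    multiplication formula [int A_a G . H^ = int A_(n-a) G^ . H].  If
    [G x = f (x/|x|) chi (|x|^2)] with [chi] a bump function on [[1, 4]], then
    [A_a G = c_a f . r^(-a)].  Hence [T_q f] is [A_(n-a) G^ / c_a] on the sphere.

    If [h . r^q] is positive definite and [g = T_q f >= 0], both identities turn
    [int f h] over the sphere into a positive multiple of the pairing of
    [(h . r^q)^] with the nonnegative test function [g (x/|x|) chi (|x|^2)].
    Conversely, for an even test function [phi >= 0], the function
    [f = A_a phi^] satisfies [T_q f = const . A_(n-a) phi >= 0] by Fourier
    inversion, and [int f h] is a positive multiple of the pairing of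
    [(h . r^q)^] with [phi]. *)

Require Import Defs.
From HB Require Import structures.
From mathcomp Require Import all_boot all_order all_algebra.
From mathcomp Require Import all_classical all_reals all_analysis.
From mathcomp Require Import measurable_realfun ring lra.
From Stdlib Require Import ClassicalEpsilon.
Set Implicit Arguments. Unset Strict Implicit. Unset Printing Implicit Defensive.
Import Order.TTheory GRing.Theory Num.Theory.
Import numFieldNormedType.Exports.
Local Open Scope classical_set_scope.
Local Open Scope ring_scope.

(** * Lebesgue measure on row vectors *)

(** The distributions [h . r^q] and [f . r^(-n-q)] are singular at the origin, out of reach of a
    calculus of Schwartz functions. Writing them as averages of cut-offs supported in an annulus
    removes this obstacle: each pairing becomes an integral over a scale and a point in which only
    Schwartz functions occur. In the variable [t = ln s] its absolute convergence is a bound by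
    [e^(-b |t|)] with [b = min(a, n - a)], and this is where [0 < a < n] enters. The integrals of
    the statement are iterated and take conventional values when they diverge, so each is first
    identified with an integral over a measure [mu n], which requires integrability. Only signs
    matter in the theorem: the constant of Fourier inversion, which is [(2 pi)^n], the factors [c_a]
    and the factor between surface and volume integrals are never evaluated, only shown to be
    positive. Finally, [Tq] is a choice made by [epsilon], so existence of [T_q f] and its
    uniqueness on the sphere have to be proved before its values can be used. *)

Definition rV_display : measure_display.
Proof. exact. Qed.

Section rV_measurable.
Variables (R : realType) (n : nat).

(** These maps generate the product sigma-algebra; [measurableTypeR R] gives their values the
    structure on which [lebesgue_measure] lives. *)
Let coord (i : 'I_n) (x : 'rV[R]_n) : measurableTypeR R := x ord0 i.

Let rV_set0 : g_sigma_preimage coord set0.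
Proof. exact: sigma_algebra0. Qed.

Let rV_setC A : g_sigma_preimage coord A -> g_sigma_preimage coord (~` A).
Proof. exact: sigma_algebraC. Qed.

Let rV_bigcup (F : _^nat) : (forall i, g_sigma_preimage coord (F i)) ->
  g_sigma_preimage coord (\bigcup_i (F i)).
Proof. exact: sigma_algebra_bigcup. Qed.

HB.instance Definition _ := @isMeasurable.Build rV_display
  'rV[R]_n (g_sigma_preimage coord) rV_set0 rV_setC rV_bigcup.

Lemma measurable_coord (i : 'I_n) :
  measurable_fun [set: 'rV[R]_n] (fun x : 'rV[R]_n => x ord0 i).
Proof.
move=> _ Y mY; rewrite setTI; apply: sub_sigma_algebra => /=.
rewrite -bigcup_seq/=; exists i => /=; first by rewrite mem_index_enum.
by exists Y => //; rewrite setTI.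
Qed.

Lemma measurable_fun_coordP d (T : measurableType d) (f : T -> 'rV[R]_n) :
  (forall i, measurable_fun [set: T] (fun t => f t ord0 i)) ->
  measurable_fun [set: T] f.
Proof.
move=> mf.
suff prefS : g_sigma_preimage (fun i => coord i \o f) `<=` measurable.
  move=> _ A mA; apply: prefS; rewrite g_sigma_preimage_comp.
  by exists A.
apply: smallest_sub; first exact: sigma_algebra_measurable.
apply: (big_ind (fun S => S `<=` measurable)) => [//|S1 S2 h1 h2 A [/h1|/h2]//|].
by move=> i _ A [B mB <-]; exact: mf.
Qed.

End rV_measurable.

Section mu.
Variable R : realType.
Local Notation leb := (@lebesgue_measure R).

Definition consv n (p : measurableTypeR R * 'rV[R]_n) : 'rV[R]_n.+1 :=
  \row_i (if unlift ord0 i is Some j then p.2 ord0 j else p.1).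

Lemma measurable_consv n : measurable_fun setT (@consv n).
Proof.
apply: measurable_fun_coordP => i; rewrite /consv.
under eq_fun do rewrite mxE.
case: unliftP => [j _|_]; last exact: measurable_fst.
apply: (measurableT_comp (measurable_coord j)); exact: measurable_snd.
Qed.

Definition splitv n (x : 'rV[R]_n.+1) : measurableTypeR R * 'rV[R]_n :=
  (x ord0 ord0, \row_i x ord0 (lift ord0 i)).

Lemma measurable_splitv n : measurable_fun setT (@splitv n).
Proof.
apply: measurable_fun_pair; first exact: measurable_coord.
apply: measurable_fun_coordP => i.
by under eq_fun do rewrite mxE; exact: measurable_coord.
Qed.

Lemma consvK n : cancel (@consv n) (@splitv n).
Proof.
move=> [t x]; congr (_, _); first by rewrite mxE unlift_none.
by apply/rowP => i; rewrite !mxE liftK.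
Qed.

Lemma splitvK n : cancel (@splitv n) (@consv n).
Proof.
move=> x; apply/rowP => i; rewrite mxE.
by case: unliftP => [j ->|->]; rewrite ?mxE.
Qed.

Section cons_measure.
Variables (n : nat) (m : {sigma_finite_measure set 'rV[R]_n -> \bar R}).

Definition cons_measure : set 'rV[R]_n.+1 -> \bar R :=
  pushforward (leb \x m)%E (@consv n).

Let M : {measure set 'rV[R]_n.+1 -> \bar R} :=
  measure_function_pushforward__canonical__measure_function_Measure
    (leb \x m)%E (@measurable_consv n).

Let cons_measure0 : cons_measure set0 = 0%E.
Proof. exact: (measure0 M). Qed.

Let cons_measure_ge0 A : (0 <= cons_measure A)%E.
Proof. exact: (measure_ge0 M). Qed.

Let cons_measure_sigma_additive : semi_sigma_additive cons_measure.
Proof. exact: (@measure_semi_sigma_additive _ _ _ M). Qed.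

HB.instance Definition _ := isMeasure.Build _ _ _ cons_measure
  cons_measure0 cons_measure_ge0 cons_measure_sigma_additive.

Let cons_measure_sigma_finite : sigma_finite setT cons_measure.
Proof.
have /sigma_finiteP[F [TF ndF Foo]] := sigma_finiteT leb.
have /sigma_finiteP[G [TG ndG Goo]] := sigma_finiteT m.
have mFG k : measurable (F k `*` G k).
  by have [? ?] := Foo k; have [? ?] := Goo k; exact: measurableX.
exists (fun k => @splitv n @^-1` (F k `*` G k)).
  rewrite -preimage_bigcup [X in _ @^-1` X](_ : _ = setT) ?preimage_setT//.
  apply/seteqP; split=> // -[t x] _.
  have [a _ Fa] : (\bigcup_k F k) t by rewrite -TF.
  have [b _ Gb] : (\bigcup_k G k) x by rewrite -TG.
  exists (maxn a b) => //; split => /=.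
  - by move: t Fa; exact/subsetPset/ndF/leq_maxl.
  - by move: x Gb; exact/subsetPset/ndG/leq_maxr.
move=> k; have [mF Fk] := Foo k; have [mG Gk] := Goo k; split.
  by rewrite -[X in measurable X]setTI; exact: measurable_splitv.
rewrite /cons_measure /pushforward -comp_preimage.
rewrite (_ : _ \o _ = id) ?preimage_id ?product_measure1E ?lte_mul_pinfty ?ge0_fin_numE//.
exact/funext/consvK.
Qed.

HB.instance Definition _ := Measure_isSigmaFinite.Build _ _ _ cons_measure
  cons_measure_sigma_finite.

End cons_measure.

(** Lebesgue measure on row vectors, built by splitting off the first coordinate so that its
    integral unfolds in the same order as [iter_int]. The type ['rV[R]_0] has a single point, to
    which the Dirac measure gives mass [1]. *)
Fixpoint mu n : {sigma_finite_measure set 'rV[R]_n -> \bar R} :=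
  if n is n'.+1 then cons_measure (mu n') else dirac (0 : 'rV[R]_0).

End mu.
Arguments mu {R} n.

Lemma measurable_fun_compT d1 d2 d3 (T1 : measurableType d1)
    (T2 : measurableType d2) (T3 : measurableType d3)
    (f : T2 -> T3) (g : T1 -> T2) :
  measurable_fun setT f -> measurable_fun setT g ->
  measurable_fun setT (fun x => f (g x)).
Proof. exact: measurableT_comp. Qed.

(** * Real-valued integrals, parameters and Fubini's theorem *)

Section Rintegral_facts.
Context d (T : measurableType d) (R : realType).
Variable m : {measure set T -> \bar R}.

(* The real-valued integral is [fine] of the extended one, and [fine] sends
   [+oo] and [-oo] to [0]; hence linearity in the scalar needs no integrability. *)
Lemma Rintegral_nonintegrable (f : T -> R) : measurable_fun setT f ->
  ~ m.-integrable setT (EFin \o f) -> \int[m]_x f x = 0.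
Proof.
move=> mf nf; have mf' := (measurable_EFinP _ _).2 mf.
have p0 : (0 <= \int[m]_x ((EFin \o f)^\+ x))%E by exact: integral_ge0.
have n0 : (0 <= \int[m]_x ((EFin \o f)^\- x))%E by exact: integral_ge0.
rewrite /Rintegral integralE.
have : ~ (\int[m]_x ((EFin \o f)^\+ x) < +oo /\ \int[m]_x ((EFin \o f)^\- x) < +oo)%E.
  move=> [hp hn]; apply: nf; apply/integrableP; split => //.
  under eq_integral do rewrite -/((abse \o (EFin \o f)) _) fune_abse.
  rewrite ge0_integralD//.
  - exact: lte_add_pinfty.
  - exact: measurable_funepos.
  - exact: measurable_funeneg.
move: p0 n0.
case: (\int[m]_x ((EFin \o f)^\+ x))%E => [a||]//; case: (\int[m]_x ((EFin \o f)^\-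
  x))%E => [b||]//.
by move=> _ _ []; split; exact: ltry.
Qed.

Lemma RintegralZ (f : T -> R) k : measurable_fun setT f ->
  \int[m]_x (k * f x) = k * \int[m]_x f x.
Proof.
move=> mf; have [->|k0] := eqVneq k 0.
  rewrite mul0r; under eq_Rintegral do rewrite mul0r.
  by rewrite Rintegral_cst// mul0r.
have [fi|fni] := pselect (m.-integrable setT (EFin \o f)); first exact: RintegralZl.
rewrite [in RHS]Rintegral_nonintegrable// mulr0 Rintegral_nonintegrable//.
  exact: measurable_funM.
move=> kf; apply: fni.
have := integrableZl measurableT k^-1 kf.
by apply: eq_integrable => // x _; rewrite /= -EFinM mulrA mulVf// mul1r.
Qed.

End Rintegral_facts.

Section param.
Context d (Y : measurableType d) d' (T : measurableType d') (R : realType).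
Variable m : {sigma_finite_measure set T -> \bar R}.

(** Tonelli applies to the positive and the negative part separately; their difference and [fine]
    stay measurable even where a part is infinite. *)
Lemma measurable_fun_Rintegral (f : Y * T -> R) : measurable_fun setT f ->
  measurable_fun setT (fun y => \int[m]_t f (y, t)).
Proof.
move=> mf; apply: measurableT_comp => //.
under eq_fun do rewrite integralE.
have mf' := (measurable_EFinP _ _).2 mf.
apply: emeasurable_funB.
- under eq_fun do under eq_integral do rewrite (funepos_comp (EFin \o f) (pair _)).
  exact: (measurable_fun_fubini_tonelli_F (m2 := m) _ (measurable_funepos mf')).
- under eq_fun do under eq_integral do rewrite (funeneg_comp (EFin \o f) (pair _)).
  exact: (measurable_fun_fubini_tonelli_F (m2 := m) _ (measurable_funeneg mf')).
Qed.

End param.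

Section fubini_R.
Context d1 (T1 : measurableType d1) d2 (T2 : measurableType d2) (R : realType).
Variable m1 : {sigma_finite_measure set T1 -> \bar R}.
Variable m2 : {sigma_finite_measure set T2 -> \bar R}.
Variable f : T1 * T2 -> R.
Hypothesis fi : (m1 \x m2)%E.-integrable setT (EFin \o f).
Let mf : measurable_fun setT f.
Proof. by apply/measurable_EFinP; exact: measurable_int fi. Qed.

Let msw : measurable_fun setT (f \o @unstable.swap T2 T1).
Proof. by apply: measurableT_comp => //; exact: measurable_swap. Qed.

(** Almost every section is integrable, and there [fine] loses nothing. On the exceptional null set
    the extended integral may be infinite while the real one is [0]. *)
Let ae1 : ae_eq m1 setT (EFin \o (fun x => \int[m2]_y f (x, y)))
                        (fubini_F m2 (EFin \o f)).
Proof.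
have := ae_integrable1 fi; apply: filterS => x ix _ /=.
rewrite /Rintegral fineK//; exact: integrable_fin_num.
Qed.

Let ae2 : ae_eq m2 setT (EFin \o (fun y => \int[m1]_x f (x, y)))
                        (fubini_G m1 (EFin \o f)).
Proof.
have := ae_integrable2 fi; apply: filterS => x ix _ /=.
rewrite /Rintegral fineK//; exact: integrable_fin_num.
Qed.

Lemma RFubini1 :
  \int[m1]_x \int[m2]_y f (x, y) = fine (\int[(m1 \x m2)%E]_z (f z)%:E)%E.
Proof.
rewrite -(integral12_prod_meas1 fi) /Rintegral; congr fine.
apply: ae_eq_integral => //.
- by apply/measurable_EFinP; exact: measurable_fun_Rintegral.
- exact: (measurable_fubini_F fi).
Qed.

Lemma RFubini2 :
  \int[m2]_y \int[m1]_x f (x, y) = fine (\int[(m1 \x m2)%E]_z (f z)%:E)%E.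
Proof.
rewrite -(integral21_prod_meas1 fi) /Rintegral; congr fine.
apply: ae_eq_integral => //.
- by apply/measurable_EFinP; exact: (measurable_fun_Rintegral m1 msw).
- exact: (measurable_fubini_G fi).
Qed.

Lemma RFubini :
  \int[m1]_x \int[m2]_y f (x, y) = \int[m2]_y \int[m1]_x f (x, y).
Proof. by rewrite RFubini1 RFubini2. Qed.

Lemma RFubini_integrable1 :
  m1.-integrable setT (EFin \o (fun x => \int[m2]_y f (x, y))).
Proof.
apply/integrableP; split.
  by apply/measurable_EFinP; exact: measurable_fun_Rintegral.
have /integrableP[mF] := integrable_fubini_F fi.
apply: le_lt_trans; rewrite le_eqVlt; apply/orP; left; apply/eqP.
apply: ae_eq_integral => //.
- apply: measurableT_comp => //.
  by apply/measurable_EFinP; exact: measurable_fun_Rintegral.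
- exact: measurableT_comp.
- by move: ae1; apply: filterS => x /= h Dx; rewrite -h.
Qed.

End fubini_R.

Section fubini_swap.
Context d1 (T1 : measurableType d1) d2 (T2 : measurableType d2) (R : realType).
Variable m1 : {sigma_finite_measure set T1 -> \bar R}.
Variable m2 : {sigma_finite_measure set T2 -> \bar R}.
Variable f : T1 * T2 -> R.
Hypothesis fi : (m1 \x m2)%E.-integrable setT (EFin \o f).

Lemma integrable_swap :
  (m2 \x m1)%E.-integrable setT (EFin \o (f \o @unstable.swap T2 T1)).
Proof.
have mf := measurable_int _ fi.
apply/integrable12ltyP; last exact/(integrable21ltyP m1 m2 mf).
apply: (measurableT_comp mf); exact: measurable_swap.
Qed.

Lemma RFubini_integrable2 :
  m2.-integrable setT (EFin \o (fun y => \int[m1]_x f (x, y))).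
Proof. exact: (RFubini_integrable1 integrable_swap). Qed.

End fubini_swap.

(** * Iterated integrals as integrals over [mu n] *)

Section mu_integral.
Variable R : realType.
Local Notation leb := (@lebesgue_measure R).

Lemma ge0_integral_cons n (F : 'rV[R]_n.+1 -> \bar R) :
  measurable_fun setT F -> (forall x, 0 <= F x)%E ->
  (\int[mu n.+1]_x F x = \int[leb]_t \int[mu n]_x F (consv (t, x)))%E.
Proof.
move=> mF F0.
have mF' : measurable_fun setT (F \o @consv R n).
  by apply: measurableT_comp => //; exact: measurable_consv.
rewrite -(fubini_tonelli1 (F \o @consv R n) mF' (fun=> F0 _)).
have := ge0_integral_pushforward (@measurable_consv R n) (leb \x mu n)%E measurableT mF.
by rewrite preimage_setT; apply => x _; exact: F0.
Qed.

Lemma integrable_cons n (F : 'rV[R]_n.+1 -> \bar R) :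
  (mu n.+1).-integrable setT F ->
  (leb \x mu n)%E.-integrable setT (F \o @consv R n).
Proof.
move=> /integrableP[mF iF]; apply/integrableP; split.
  by apply: measurableT_comp => //; exact: measurable_consv.
have maF : measurable_fun setT (abse \o F) by exact: measurableT_comp.
have maFc : measurable_fun setT ((abse \o F) \o @consv R n).
  by apply: measurableT_comp => //; exact: measurable_consv.
rewrite ge0_integral_cons// in iF.
by rewrite (fubini_tonelli1 _ maFc) => // x; rewrite /= abse_ge0.
Qed.

Lemma Rintegral_cons n (F : 'rV[R]_n.+1 -> R) :
  (mu n.+1).-integrable setT (EFin \o F) ->
  \int[mu n.+1]_x F x = \int[leb]_t \int[mu n]_x F (consv (t, x)).
Proof.
move=> Fi; have Fi' := integrable_cons Fi.
rewrite (RFubini1 (f := F \o @consv R n))//.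
rewrite -[RHS]/(fine (\int[(leb \x mu n)%E]_z ((EFin \o F) \o @consv R n) z)).
have := integral_pushforward (@measurable_consv R n) (mu := (leb \x mu n)%E)
  (D := setT) (f := EFin \o F) (measurable_int _ Fi).
by rewrite preimage_setT => <-.
Qed.

(** The parameter space [Y] is arbitrary so that the induction can absorb each integration variable
    into it: the step uses the hypothesis for [Y * R]. *)
Lemma measurable_iter_int n d (Y : measurableType d) (G : Y -> 'rV[R]_n -> R) :
  measurable_fun setT (fun p : Y * 'rV[R]_n => G p.1 p.2) ->
  measurable_fun setT (fun y => iter_int n (fun s => G y (\row_(i < n) nth 0 s i))).
Proof.
elim: n d Y G => [|n IH] d Y G mG /=.
  refine (measurable_fun_compT (g := fun y => (y, \row_(i < 0) nth 0 [::] i)) mG _).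
  exact: measurable_fun_pair.
pose H (p : Y * measurableTypeR R) := iter_int n (fun s => G p.1 (\row_(i < n.+1) nth 0
  (p.2 :: s) i)).
apply: (@measurable_fun_Rintegral _ _ _ _ _ leb H).
rewrite /H.
have E (p : Y * measurableTypeR R) s : \row_(i < n.+1) nth 0 (p.2 :: s) i =
   consv (p.2, \row_(i < n) nth 0 s i).
  apply/rowP => i; rewrite !mxE; case: unliftP => [j ->|->] //=.
  by rewrite mxE.
under eq_fun do under eq_fun do rewrite E.
apply: (IH _ _ (fun p x => G p.1 (consv (p.2, x)))).
refine (measurable_fun_compT (g := fun p : (Y * measurableTypeR R) * 'rV[R]_n =>
  (p.1.1, consv (p.1.2, p.2))) mG _).
apply: measurable_fun_pair.
  by apply: measurableT_comp => //; exact: measurableT_comp.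
apply: measurableT_comp; first exact: measurable_consv.
apply: measurable_fun_pair => //.
by apply: measurableT_comp => //; exact: measurableT_comp.
Qed.

(** Induction on the dimension. Only almost every section of [F] is integrable, so the inner
    integrals agree only almost everywhere; comparing the outer ones then takes the measurability of
    both, which for the iterated one is [measurable_iter_int]. *)
Lemma integral_RnE n (F : 'rV[R]_n -> R) :
  (mu n).-integrable setT (EFin \o F) -> integral_Rn F = \int[mu n]_x F x.
Proof.
rewrite /integral_Rn; elim: n F => [|n IH] F Fi.
  rewrite /= /Rintegral /= integral_dirac//= ?diracT ?mul1e /=; last exact:
    measurable_int Fi.
  by rewrite indicT mul1r; congr F; apply/rowP => -[].
rewrite Rintegral_cons//=.
have Fi' := integrable_cons Fi.
have mF : measurable_fun setT F by apply/measurable_EFinP; exact: measurable_int Fi.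
have E t s : \row_(i < n.+1) nth 0 (t :: s) i =
   consv (t, \row_(i < n) nth 0 s i).
  apply/rowP => i; rewrite !mxE; case: unliftP => [j ->|->] //=.
  by rewrite mxE.
have mFc : measurable_fun setT (F \o @consv R n).
  by apply: measurableT_comp => //; exact: measurable_consv.
rewrite /Rintegral; congr fine; apply: ae_eq_integral => //.
- apply/measurable_EFinP.
  under eq_fun do under eq_fun do rewrite E.
  apply: (@measurable_iter_int n _ _ (fun t x => F (consv (t, x)))).
  by rewrite (_ : (fun p => _) = F \o @consv R n)//; apply/funext => -[].
- by apply/measurable_EFinP; exact: (@measurable_fun_Rintegral _ _ _ _ _ (mu n) (F \o
  @consv R n)).
- have := ae_integrable1 Fi'; apply: filterS => t it _ /=; congr EFin.
  by rewrite -[RHS](IH (fun x => F (consv (t, x))))//; congr iter_int; apply/funext =>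
    s; rewrite E.
Qed.

End mu_integral.

(** * Affine changes of variables *)

Section transfer.
Context (R : realType) d (T : measurableType d) (m : {measure set T -> \bar R}).

Let fine_scale (k : R) (x y : \bar R) : 0 < k -> (0 <= x)%E -> (0 <= y)%E ->
  fine (k%:E * x - k%:E * y) = k * fine (x - y).
Proof.
move=> k0; have ky : (k%:E * +oo = +oo)%E by rewrite gt0_muley ?lte_fin.
case: x => [a| |]; case: y => [b| |]; rewrite ?leeNy_eq// => _ _.
- by rewrite -!EFinM -!EFinB [LHS]/= [fine _]/= mulrBr.
- by rewrite ky -EFinM [LHS]/= [fine _]/= mulr0.
- by rewrite ky -EFinM [LHS]/= [fine _]/= mulr0.
- by rewrite ky [LHS]/= [fine _]/= mulr0.
Qed.

(** Positive and negative parts are transported separately. By [fine_scale] the real value of their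
    difference scales by [k] even when a part is infinite, both sides being [0] then, so divergent
    integrals are covered too. *)
Lemma Rintegral_transfer (g : T -> T) (k : R) : 0 < k ->
  (forall F : T -> \bar R, measurable_fun setT F -> (forall x, 0 <= F x)%E ->
    (\int[m]_x F (g x) = k%:E * \int[m]_x F x)%E) ->
  forall F : T -> R, measurable_fun setT F ->
  \int[m]_x F (g x) = k * \int[m]_x F x.
Proof.
move=> k0 H F mF; rewrite /Rintegral.
have mF' := (measurable_EFinP _ _).2 mF.
rewrite integralE [in RHS]integralE.
under eq_integral do rewrite (funepos_comp (EFin \o F) g) /=.
under [X in (_ - X)%E]eq_integral do rewrite (funeneg_comp (EFin \o F) g) /=.
rewrite (H _ (measurable_funepos mF') (funepos_ge0 _)).
rewrite (H _ (measurable_funeneg mF') (funeneg_ge0 _)).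
by apply: fine_scale => //; exact: integral_ge0.
Qed.

End transfer.

Section affine_line.
Variable R : realType.
Local Notation leb := (@lebesgue_measure R).

Variables (c v : R).
Hypothesis c0 : c != 0.

Definition affine1 (t : measurableTypeR R) : measurableTypeR R := c * t + v.

Lemma measurable_affine1 : measurable_fun setT affine1.
Proof. exact: measurable_funD. Qed.

Let M := measure_function_pushforward__canonical__measure_function_Measure
    leb measurable_affine1.

Let M' : {measure set (measurableTypeR R) -> \bar R} := mscale (NngNum (normr_ge0 c)) M.

(** Lebesgue measure is determined by its values on the intervals []a, b]], so the scaled
    pushforward has to be computed on these only. *)
Lemma lebesgue_affine1 A : measurable A ->
  leb A = (`|c|%:E * leb (affine1 @^-1` A))%E.
Proof.
move=> mA; rewrite (@lebesgue_measure_unique R M')// => _ [[a b]] _ <-.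
change (leb `]a, b] = `|c|%:E * leb (affine1 @^-1` `]a, b]))%E.
have [ab|ab] := leP b a.
  by rewrite set_itv_ge ?bnd_simp -?leNgt// preimage_set0 !measure0 mule0.
have := c0; rewrite neq_lt => /orP[cn|cp].
(* A negative factor reverses the order, so the preimage is closed on the left and open on the
   right. *)
- have -> : affine1 @^-1` `]a, b] = `[(b - v) / c, (a - v) / c[%classic.
    by apply/seteqP; split => t /=; rewrite !in_itv /= /affine1 ler_ndivrMr//
      ltr_ndivlMr// ltrBlDr lerBrDr (mulrC t) => /andP[-> ->].
  rewrite !lebesgue_measure_itv/= !lte_fin ab ltr_ndivlMr// divfK ?lt_eqF// ltrD2r ab.
  by rewrite -!EFinB -EFinM ltr0_norm//; congr EFin; field.
- have -> : affine1 @^-1` `]a, b] = `](a - v) / c, (b - v) / c]%classic.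
    by apply/seteqP; split => t /=; rewrite !in_itv /= /affine1 ltr_pdivrMr//
      ler_pdivlMr// ltrBlDr lerBrDr (mulrC t) => /andP[-> ->].
  rewrite !lebesgue_measure_itv/= !lte_fin ab ltr_pdivrMr// divfK ?gt_eqF// ltrD2r ab.
  by rewrite -!EFinB -EFinM gtr0_norm//; congr EFin; field.
Qed.

Lemma ge0_integral_affine1 (f : R -> \bar R) : measurable_fun setT f ->
  (forall t, 0 <= f t)%E ->
  (\int[leb]_t f (c * t + v)%R = (`|c|^-1)%:E * \int[leb]_t f t)%E.
Proof.
move=> mf f0.
have -> : (\int[leb]_t f t = \int[M']_t f t)%E.
  by apply: eq_measure_integral => A mA _; rewrite /= lebesgue_affine1.
rewrite ge0_integral_mscale//= muleA -EFinM mulVf ?normr_eq0// mul1e.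
have := ge0_integral_pushforward measurable_affine1 leb measurableT mf.
by rewrite preimage_setT => ->.
Qed.

End affine_line.

Section affine.
Variable R : realType.
Local Notation leb := (@lebesgue_measure R).

Lemma measurable_affine n (c : R) (v : 'rV[R]_n) :
  measurable_fun setT (fun x : 'rV[R]_n => c *: x + v).
Proof.
apply: measurable_fun_coordP => i.
have -> : (fun x : 'rV[R]_n => (c *: x + v) ord0 i) = (fun x => c * x ord0 i + v ord0 i).
  by apply/funext => x; rewrite !mxE.
apply: measurable_funD => //; apply: measurable_funM => //.
exact: measurable_coord.
Qed.

(** Each coordinate split off by the recursion of [mu] contributes one factor [|c|^-1] from the
    line. *)
Lemma ge0_integral_affine n (c : R) (v : 'rV[R]_n) (F : 'rV[R]_n -> \bar R) :
  c != 0 -> measurable_fun setT F -> (forall x, 0 <= F x)%E ->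
  (\int[mu n]_x F (c *: x + v)%R = (`|c| ^- n)%:E * \int[mu n]_x F x)%E.
Proof.
move=> c0; elim: n v F => [|n IH] v F mF F0.
  rewrite expr0 invr1 mul1e; apply: eq_integral => x _; congr F.
  by apply/rowP => -[].
have mFc : measurable_fun setT (F \o @consv R n).
  by apply: measurableT_comp => //; exact: measurable_consv.
rewrite !ge0_integral_cons//; last first.
  exact: (measurable_fun_compT mF (measurable_affine _ _)).
pose v' : 'rV[R]_n := (splitv v).2; pose v0 := (splitv v).1.
have E t x : c *: consv (t, x) + v = consv (c * t + v0, c *: x + v').
  rewrite -[in LHS](splitvK v); apply/rowP => i; rewrite !mxE.
  by case: unliftP => [j _|_] /=; rewrite ?mxE.
have H : measurable_fun setT (fun t : R => \int[mu n]_x F (consv (t, x)))%E.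
  exact: (measurable_fun_fubini_tonelli_F (m2 := mu n) _ mFc (fun=> F0 _)).
transitivity (\int[leb]_t ((`|c| ^- n)%:E * \int[mu n]_x F (consv (c * t + v0, x)%R)))%E.
  apply: eq_integral => t _; under eq_integral do rewrite E.
  rewrite (IH v' (fun x => F (consv (c * t + v0, x))))//.
  exact: (measurableT_comp mFc (@pair1_measurable _ _ _ _ (c * t + v0))).
rewrite (ge0_integralZl leb measurableT
  (measurable_fun_compT H (measurable_affine1 c v0))); last 2 first.
- by move=> t _; exact: integral_ge0.
- by rewrite lee_fin invr_ge0 exprn_ge0.
rewrite (ge0_integral_affine1 v0 c0 (f := fun t => \int[mu n]_x F (consv (t, x)))%E)//;
  last first.
  by move=> t; exact: integral_ge0.
by rewrite muleA -EFinM -invfM -exprSr.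
Qed.

Lemma Rintegral_affine n (c : R) (v : 'rV[R]_n) (F : 'rV[R]_n -> R) :
  c != 0 -> measurable_fun setT F ->
  \int[mu n]_x F (c *: x + v) = `|c| ^- n * \int[mu n]_x F x.
Proof.
move=> c0; apply: (@Rintegral_transfer _ _ _ (mu n) (fun x => c *: x + v)).
  by rewrite invr_gt0 exprn_gt0// normr_gt0.
by move=> G; exact: ge0_integral_affine.
Qed.

Lemma Rintegral_affine1 (c v : R) (f : R -> R) :
  c != 0 -> measurable_fun setT f ->
  \int[leb]_t f (c * t + v) = `|c|^-1 * \int[leb]_t f t.
Proof.
move=> c0; apply: (@Rintegral_transfer _ _ _ leb (fun t => c * t + v)).
  by rewrite invr_gt0 normr_gt0.
by move=> G mG G0; exact: ge0_integral_affine1.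
Qed.

Lemma integrable_affine n (c : R) (v : 'rV[R]_n) (F : 'rV[R]_n -> R) :
  c != 0 -> (mu n).-integrable setT (EFin \o F) ->
  (mu n).-integrable setT (EFin \o (fun x => F (c *: x + v))).
Proof.
move=> c0 /integrableP[mF iF]; apply/integrableP; split.
  exact: (measurable_fun_compT mF (measurable_affine _ _)).
have maF : measurable_fun setT (abse \o (EFin \o F)) by exact: measurableT_comp.
rewrite (ge0_integral_affine v c0 maF (fun=> abse_ge0 _)).
by rewrite lte_mul_pinfty// lee_fin invr_ge0 exprn_ge0.
Qed.

Let consv_set0 n :
  @consv R n @^-1` [set 0] = [set 0 : R] `*` [set 0 : 'rV[R]_n].
Proof.
apply/seteqP; split => -[t x] /=.
  move=> /(congr1 (@splitv R n)); rewrite consvK => -[-> ->]; split => //=.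
    by rewrite mxE.
  by apply/rowP => i; rewrite !mxE.
by move=> [-> ->]; apply/rowP => i; rewrite !mxE; case: unliftP => *; rewrite ?mxE.
Qed.

Lemma measurable_rV_set1 n : measurable [set (0 : 'rV[R]_n)].
Proof.
elim: n => [|n IH].
  rewrite (_ : [set 0] = setT)//; apply/seteqP; split => // x _.
  by apply/rowP => -[].
have -> : [set (0 : 'rV[R]_n.+1)] = @splitv R n @^-1` ([set 0 : R] `*` [set 0]).
  by rewrite -consv_set0 -comp_preimage (_ : _ \o _ = id)//; exact/funext/splitvK.
rewrite -[X in measurable X]setTI; apply: measurable_splitv => //.
exact: measurableX.
Qed.

(** Homogeneous functions of negative degree and [radproj] have only conventional values at the
    origin; this makes those values irrelevant to integrals. *)
Lemma mu_set1 n : (0 < n)%N -> mu n [set (0 : 'rV[R]_n)] = 0%E.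
Proof.
case: n => // n _.
rewrite /= /cons_measure /pushforward consv_set0.
transitivity (leb [set 0%R] * mu n [set 0%R])%E.
  by apply: product_measure1E => //; exact: measurable_rV_set1.
by rewrite (lebesgue_measure_set1 (0 : R)) mul0e.
Qed.

End affine.

(** * Measurability and positivity criteria *)

Section continuous_measurable.
Variables (R : realType) (n : nat).

(* A function continuous at every point of [D] is there the pointwise limit of its
   values on finer and finer grids, each of which takes countably many values. *)
Let grid (k : nat) (z : 'rV[int]_n) : 'rV[R]_n := \row_i ((z ord0 i)%:~R / k.+1%:R).
Let flr (k : nat) (x : 'rV[R]_n) : 'rV[int]_n := \row_i Num.floor (x ord0 i * k.+1%:R).

Let measurable_flr k z : measurable [set x | flr k x = z].
Proof.
have -> : [set x | flr k x = z] =
    \bigcap_(i in [set: 'I_n])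
      ((fun x : 'rV[R]_n => x ord0 i) @^-1`
         ((fun t : R => t * k.+1%:R) @^-1` `[(z ord0 i)%:~R, (z ord0 i + 1)%:~R[)).
  apply/seteqP; split => x /=.
    by move=> <- i _ /=; rewrite mxE in_itv/=; exact: floor_itv.
  move=> h; apply/rowP => i; rewrite mxE; apply: floor_def.
  by have := h i I; rewrite /= in_itv.
apply: fin_bigcap_measurable => // i _.
have mk : measurable_fun setT (fun t : R => t * k.+1%:R).
  by apply: measurable_funM => //; exact: measurable_id.
rewrite -[X in measurable X]setTI; apply: measurable_coord => //.
by rewrite -[X in measurable X]setTI; exact: mk.
Qed.

Lemma continuous_on_measurable (D : set 'rV[R]_n) (F : 'rV[R]_n -> R) :
  measurable D -> (forall x, D x -> {for x, continuous F}) -> measurable_fun D F.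
Proof.
move=> mD cF; apply: (measurable_fun_cvg (h := fun k => F \o (grid k \o flr k))).
  move=> k; apply: (@measurable_funTS _ _ _ _ D) => _ Y mY; rewrite setTI.
  have -> : (F \o (grid k \o flr k)) @^-1` Y =
      \bigcup_z (if F (grid k z) \in Y then [set x | flr k x = z] else set0).
    apply/seteqP; split => x /=.
      by move=> Yx; exists (flr k x) => //; rewrite mem_set.
    by move=> [z _]; case: ifPn => //; rewrite inE => hY /= ->.
  apply: countable_bigcupT_measurable => // z.
  by case: ifP => // _; exact: measurable_flr.
move=> x Dx; apply: (cvg_comp _ F _ (cF x Dx)).
apply/cvg_ballP => e e0.
near=> k.
split=> // i j; rewrite /ball/= !ord1 !mxE.
have k0 : (0:R) < k.+1%:R by rewrite ltr0n.
have /andP[h1 h2] := floor_itv (x ord0 j * k.+1%:R).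
have h3 : x ord0 j - (Num.floor (x ord0 j * k.+1%:R))%:~R / k.+1%:R =
  (x ord0 j * k.+1%:R - (Num.floor (x ord0 j * k.+1%:R))%:~R) / k.+1%:R.
  by rewrite mulrBl mulfK// gt_eqF.
rewrite h3 ger0_norm; last by rewrite divr_ge0 ?subr_ge0// ltW.
rewrite ltr_pdivrMr//.
apply: (@lt_trans _ _ 1); first by rewrite ltrBlDl -[1]/(1%:~R) -intrD.
rewrite -ltr_pdivrMr// mul1r; near: k.
exact: near_infty_natSinv_lt (PosNum e0).
Unshelve. all: by end_near. Qed.

Lemma continuous_measurable_rV (F : 'rV[R]_n -> R) :
  continuous F -> measurable_fun setT F.
Proof. by move=> cF; apply: continuous_on_measurable => // x _; exact: cF. Qed.

End continuous_measurable.

Lemma Rintegral_gt0_set d (T : measurableType d) (R : realType)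
    (m : {measure set T -> \bar R}) (F : T -> R) (B : set T) (e : R) :
  measurable B -> (0 < m B)%E -> 0 < e -> (forall x, 0 <= F x) ->
  (forall x, B x -> e <= F x) -> m.-integrable setT (EFin \o F) ->
  0 < \int[m]_x F x.
Proof.
move=> mB B0 e0 F0 hb Fi; rewrite -lte_fin /Rintegral fineK; last exact:
  integrable_fin_num.
have mI := (measurable_EFinP setT (\1_B : T -> R)).2 (measurable_indic mB).
have : (\int[m]_x (e * \1_B x)%:E <= \int[m]_x (F x)%:E)%E.
  apply: ge0_le_integral => //.
  - by move=> x _; rewrite lee_fin mulr_ge0// ltW.
  - refine ((measurable_EFinP setT (fun x => e * \1_B x)).2 _).
    by apply: measurable_funM => //; exact: measurable_indic.
  - exact: (measurable_int _ Fi).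
  - move=> x _; rewrite lee_fin indicE; case: (boolP (x \in _)) => [|_]; last by
    rewrite mulr0.
    by rewrite inE mulr1; exact: hb.
apply: lt_le_trans.
under eq_integral do rewrite EFinM.
have k0 : (0 <= e%:E)%E by rewrite lee_fin ltW.
rewrite (ge0_integralZl m measurableT mI _ k0); last by move=> x _; rewrite lee_fin.
by rewrite integral_indic// setIT mule_gt0.
Qed.

Section positivity.
Variable R : realType.
Local Notation leb := (@lebesgue_measure R).

(** For [r > 0] this is the ball of the matrix norm, written by coordinates so that its measure is a
    product of lengths. *)
Definition box n (x : 'rV[R]_n) (r : R) := [set y : 'rV[R]_n | forall i, `|x ord0 i - y
  ord0 i| < r].

Lemma measurable_box n (x : 'rV[R]_n) r : measurable (box x r).
Proof.
have -> : box x r = \bigcap_(i in [set: 'I_n])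
      ((fun y : 'rV[R]_n => y ord0 i) @^-1` (ball (x ord0 i) r)).
  by apply/seteqP; split => y h i; [move=> _; exact: h|exact: (h i I)].
apply: fin_bigcap_measurable => // i _.
rewrite -[X in measurable X]setTI; apply: measurable_coord => //.
exact: measurable_ball.
Qed.

Lemma mu_box n (x : 'rV[R]_n) r : 0 < r -> mu n (box x r) = ((r *+ 2) ^+ n)%:E.
Proof.
move=> r0; elim: n x => [|n IH] x.
  have h : box x r 0 by move=> -[].
  by rewrite /= diracE mem_set.
rewrite [LHS]/= /cons_measure /pushforward.
have -> : @consv R n @^-1` (box x r) = ball (x ord0 ord0) r `*` box (splitv x).2 r.
  apply/seteqP; split => -[t y] /=.
    move=> h; split => /=.
      by have := h ord0; rewrite mxE unlift_none.
    by move=> i; have := h (lift ord0 i); rewrite !mxE liftK.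
  move=> [/= h1 h2] i; rewrite mxE; case: unliftP => [j ->|->] //=.
  by have := h2 j; rewrite mxE.
transitivity (leb (ball (x ord0 ord0) r) * mu n (box (splitv x).2 r))%E.
  by apply: product_measure1E; [exact: measurable_ball|exact: measurable_box].
by rewrite IH (lebesgue_measure_ball (x ord0 ord0) (ltW r0)) -EFinM exprS.
Qed.

Lemma integral0_continuous_eq0 n (F : 'rV[R]_n -> R) x0 :
  (mu n).-integrable setT (EFin \o F) -> (forall x, 0 <= F x) ->
  {for x0, continuous F} -> \int[mu n]_x F x = 0 -> F x0 = 0.
Proof.
move=> Fi F0 cF F00; apply/eqP; rewrite eq_le F0 andbT leNgt; apply/negP => Fx0.
have : nbhs x0 [set y | F x0 / 2 < F y].
  by apply: (cF [set y | F x0 / 2 < y]); apply: lt_nbhsr; rewrite ltr_pdivrMr//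
    ltr_pMr// ltr1n.
move=> /nbhs_ballP[r /= r0 hr].
have hb y : box x0 r y -> F x0 / 2 <= F y.
  by move=> h; apply/ltW/hr; split=> // i j; rewrite !ord1; exact: h.
have B0 : (0 < mu n (box x0 r))%E.
  by rewrite mu_box// lte_fin exprn_gt0// mulrn_wgt0.
have e0 : 0 < F x0 / 2 by rewrite divr_gt0.
by have := Rintegral_gt0_set (measurable_box x0 r) B0 e0 F0 hb Fi; rewrite F00 ltxx.
Qed.

End positivity.

Section integrable_tools.
Context d (T : measurableType d) (R : realType) (m : {measure set T -> \bar R}).

Lemma Rle_integrable (f g : T -> R) : measurable_fun setT f ->
  (forall x, `|f x| <= g x) -> m.-integrable setT (EFin \o g) ->
  m.-integrable setT (EFin \o f).
Proof.
move=> mf fg; apply: le_integrable => //; first exact/measurable_EFinP.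
move=> x _; rewrite /= lee_fin (le_trans (fg x))//; exact: ler_norm.
Qed.

Lemma integrableMbounded (f h : T -> R) (M : R) : measurable_fun setT h ->
  (forall x, `|h x| <= M) -> m.-integrable setT (EFin \o f) ->
  m.-integrable setT (EFin \o (fun x => h x * f x)).
Proof.
move=> mh hM fi; have mf := (measurable_EFinP _ _).1 (measurable_int _ fi).
apply: (@Rle_integrable _ (fun x => M * `|f x|)).
- exact: measurable_funM.
- by move=> x; rewrite normrM ler_wpM2r.
- by apply: (integrableZl measurableT M (integrable_norm fi)).
Qed.

Lemma RintegrableZ (f : T -> R) (k : R) : m.-integrable setT (EFin \o f) ->
  m.-integrable setT (EFin \o (fun x => k * f x)).
Proof. by move=> fi; apply: (integrableZl measurableT k fi). Qed.

Lemma RintegrableD (f g : T -> R) : m.-integrable setT (EFin \o f) ->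
  m.-integrable setT (EFin \o g) ->
  m.-integrable setT (EFin \o (fun x => f x + g x)).
Proof. by move=> fi gi; apply: (integrableD measurableT fi gi). Qed.

Lemma EFin_Rintegral (f : T -> R) : m.-integrable setT (EFin \o f) ->
  (\int[m]_x (f x)%:E = (\int[m]_x f x)%:E)%E.
Proof. by move=> fi; rewrite /Rintegral fineK//; exact: integrable_fin_num. Qed.

Lemma Rintegral_norm_le (f g : T -> R) : measurable_fun setT f ->
  (forall x, `|f x| <= g x) -> m.-integrable setT (EFin \o g) ->
  `|\int[m]_x f x| <= \int[m]_x g x.
Proof.
move=> mf fg gi; have fi := Rle_integrable mf fg gi.
apply: (le_trans (le_normr_Rintegral measurableT fi)).
by apply: le_Rintegral => //; exact: integrable_norm.
Qed.

End integrable_tools.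

Section integrable_prod.
Context d1 (T1 : measurableType d1) d2 (T2 : measurableType d2) (R : realType).
Variable m1 : {sigma_finite_measure set T1 -> \bar R}.
Variable m2 : {sigma_finite_measure set T2 -> \bar R}.

Lemma integrable_prod_bound (f : T1 * T2 -> R) (g : T1 -> R) :
  measurable_fun setT f ->
  (forall t, m2.-integrable setT (EFin \o (fun x => f (t, x)))) ->
  (forall t, \int[m2]_x `|f (t, x)| <= g t) ->
  m1.-integrable setT (EFin \o g) ->
  (m1 \x m2)%E.-integrable setT (EFin \o f).
Proof.
move=> mf fi fg gi.
have mf' := (measurable_EFinP _ _).2 mf.
apply/(integrable12ltyP _ _ mf').
have /integrableP[mg] := gi; apply: le_lt_trans.
have E t : (\int[m2]_y `|(EFin \o f) (t, y)| = (\int[m2]_y `|f (t, y)|)%:E)%E.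
  by rewrite -EFin_Rintegral//; exact: integrable_norm.
apply: ge0_le_integral => //.
- by move=> t _; exact: integral_ge0.
- have maf : measurable_fun setT (fun p => `|f p|) by exact: measurableT_comp.
  under eq_fun do rewrite E.
  apply/measurable_EFinP; exact: (measurable_fun_Rintegral m2 maf).
- exact: measurableT_comp.
- move=> t _; rewrite E lee_fin (le_trans (fg t))//; exact: ler_norm.
Qed.

End integrable_prod.

(** * Homogeneous averages *)

Section weights.
Variable R : realType.
Local Notation leb := (@lebesgue_measure R).

Lemma integrable_oneDsqrV : leb.-integrable setT (EFin \o (fun t : R => (oneDsqr t)^-1)).
Proof.
have o0 (t : R) : 0 < oneDsqr t by rewrite (lt_le_trans ltr01)// oneDsqr_ge1.
apply/integrableP; split.
  by apply/measurable_EFinP; apply: continuous_measurable_fun; exact: continuous_oneDsqrV.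
under eq_integral => x _ do rewrite gee0_abs ?lee_fin ?invr_ge0 ?ltW//.
rewrite ge0_symfun_integralT.
- by rewrite -set_itvcy integral0y_oneDsqr -EFinM ltry.
- by move=> x; rewrite invr_ge0 ltW.
- exact: continuous_oneDsqrV.
- by move=> x; rewrite /= /oneDsqr sqrrN.
Qed.

(** With [u = b |t| / 2] one has [1 + t^2 = 1 + (4 / b^2) u^2], while
    [e^(b |t|) = (e^u)^2 >= (1 + u)^2]. The function [1 / (1 + t^2)] then serves as the integrable
    majorant on the line throughout. *)
Lemma expR_decay (b : R) : 0 < b ->
  exists C, forall t, expR (- (b * `|t|)) <= C * (oneDsqr t)^-1.
Proof.
move=> b0; exists (1 + 4 / b ^+ 2) => t.
have o0 : 0 < oneDsqr t by rewrite (lt_le_trans ltr01)// oneDsqr_ge1.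
rewrite expRN ler_pdivlMr// mulrC ler_pdivrMr ?expR_gt0//.
set u := b * `|t| / 2.
have u0 : 0 <= u by rewrite divr_ge0// mulr_ge0// ltW.
have -> : expR (b * `|t|) = expR u ^+ 2.
  by rewrite -expRM_natl; congr expR; rewrite /u; field.
have h1 : (1 + u) ^+ 2 <= expR u ^+ 2.
  by rewrite lerXn2r// ?nnegrE ?expR_ge0 ?addr_ge0// expR_ge1Dx.
apply: le_trans (ler_wpM2l _ h1); last first.
  by rewrite addr_ge0// divr_ge0// exprn_ge0// ltW.
have -> : oneDsqr t = 1 + 4 / b ^+ 2 * u ^+ 2.
  rewrite /oneDsqr -(real_normK (num_real t)) /u; field.
  by rewrite gt_eqF.
have : 0 <= 4 / b ^+ 2 by rewrite divr_ge0// exprn_ge0// ltW.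
move: (4 / b ^+ 2) => k k0.
nra.
Qed.

(** An integrable majorant for Schwartz functions. The product form reduces its integrability to one
    dimension and makes it easy to compare with its translates along an axis. *)
Definition weight n (x : 'rV[R]_n) : R := \prod_(i < n) (oneDsqr (x ord0 i))^-1.

Lemma weight_ge0 n (x : 'rV[R]_n) : 0 <= weight x.
Proof.
apply: prodr_ge0 => i _; rewrite invr_ge0 (le_trans ler01)//; exact: oneDsqr_ge1.
Qed.

Lemma measurable_weight n : measurable_fun setT (@weight n).
Proof.
apply: measurable_prod => i _.
apply: (measurable_fun_compT (f := fun t : R => (oneDsqr t)^-1)).
  by apply: continuous_measurable_fun; exact: continuous_oneDsqrV.
exact: measurable_coord.
Qed.

Lemma integrable_weight n : (mu n).-integrable setT (EFin \o @weight n).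
Proof.
apply/integrableP; split; first by apply/measurable_EFinP; exact: measurable_weight.
under eq_integral => x _ do rewrite gee0_abs ?lee_fin ?weight_ge0//.
elim: n => [|n IH].
  rewrite /= integral_dirac//; last by apply/measurable_EFinP; exact: measurable_weight.
  by rewrite diracT mul1e ltry.
rewrite ge0_integral_cons; last 2 first.
- by apply/measurable_EFinP; exact: measurable_weight.
- by move=> x; rewrite lee_fin weight_ge0.
have E t (x : 'rV[R]_n) : weight (consv (t, x)) = (oneDsqr t)^-1 * weight x.
  rewrite /weight big_ord_recl; congr (_ * _).
    by rewrite mxE unlift_none.
  by apply: eq_bigr => i _; rewrite mxE liftK.
have o0 (t : R) : 0 <= (oneDsqr t)^-1.
  by rewrite invr_ge0 (le_trans ler01)//; exact: oneDsqr_ge1.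
have W : (\int[mu n]_x (weight x)%:E)%E \is a fin_num.
  rewrite ge0_fin_numE// integral_ge0// => x _; rewrite lee_fin weight_ge0//.
have mW := (measurable_EFinP _ _).2 (@measurable_weight n).
have W0 : (0 <= \int[mu n]_x (weight x)%:E)%E.
  by apply: integral_ge0 => x _; rewrite lee_fin weight_ge0.
apply: (@le_lt_trans _ _ (\int[leb]_t ((fine (\int[mu n]_x (weight x)%:E))%:E *
  ((oneDsqr t)^-1)%:E)))%E.
  rewrite le_eqVlt; apply/orP; left; apply/eqP.
  apply: eq_integral => t _; rewrite fineK// muleC.
  rewrite -(ge0_integralZl (mu n) measurableT mW)//; last first.
    by move=> x _; rewrite lee_fin weight_ge0.
  by apply: eq_integral => x _; rewrite /= E EFinM.
rewrite ge0_integralZl_EFin//; last 2 first.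
- by apply/measurable_EFinP; apply: continuous_measurable_fun; exact: continuous_oneDsqrV.
- exact: fine_ge0.
by rewrite (EFin_Rintegral integrable_oneDsqrV) -EFinM ltry.
Qed.

End weights.

Section enorm.
Variables (R : realType) (n : nat).
Implicit Types x y : 'rV[R]_n.

Lemma dotR_ge0 x : 0 <= dotR x x.
Proof. by apply: sumr_ge0 => i _; rewrite -expr2 sqr_ge0. Qed.

Lemma dotRC x y : dotR x y = dotR y x.
Proof. by apply: eq_bigr => i _; rewrite mulrC. Qed.

Lemma dotRDl x y z : dotR (x + y) z = dotR x z + dotR y z.
Proof. by rewrite /dotR -big_split; apply: eq_bigr => i _; rewrite mxE mulrDl. Qed.

Lemma dotRZl c x y : dotR (c *: x) y = c * dotR x y.
Proof. by rewrite /dotR mulr_sumr; apply: eq_bigr => i _; rewrite mxE mulrA. Qed.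

Lemma dotRZr c x y : dotR x (c *: y) = c * dotR x y.
Proof. by rewrite dotRC dotRZl dotRC. Qed.

Lemma dotRNl x y : dotR (- x) y = - dotR x y.
Proof. by rewrite -scaleN1r dotRZl mulN1r. Qed.

Lemma dotR_ei x i : dotR x (ei R i) = x ord0 i.
Proof.
rewrite /dotR (bigD1 i)//= mxE !eqxx mulr1 big1 ?addr0// => j ji.
by rewrite mxE (negbTE ji) andbF mulr0.
Qed.

Lemma dotR_eq0 x : (dotR x x == 0) = (x == 0).
Proof.
apply/eqP/eqP => [h|->]; last by rewrite /dotR big1// => i _; rewrite mxE mul0r.
apply/rowP => i; rewrite mxE; apply/eqP; rewrite -(sqrf_eq0 (x ord0 i)) expr2.
have := psumr_eq0P (P := predT) (F := fun i : 'I_n => x ord0 i * x ord0 i).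
by move=> -> //= j _; rewrite -expr2 sqr_ge0.
Qed.

Lemma enorm_ge0 x : 0 <= enorm x. Proof. exact: sqrtr_ge0. Qed.

Lemma sqr_enorm x : enorm x ^+ 2 = dotR x x.
Proof. by rewrite sqr_sqrtr// dotR_ge0. Qed.

Lemma enorm_eq0 x : (enorm x == 0) = (x == 0).
Proof. by rewrite -sqrf_eq0 sqr_enorm dotR_eq0. Qed.

Lemma enorm_gt0 x : (0 < enorm x) = (x != 0).
Proof. by rewrite lt_neqAle enorm_ge0 andbT eq_sym enorm_eq0. Qed.

Lemma enorm0 : enorm (0 : 'rV[R]_n) = 0.
Proof. by apply/eqP; rewrite enorm_eq0. Qed.

Lemma enormZ c x : enorm (c *: x) = `|c| * enorm x.
Proof. by rewrite /enorm dotRZl dotRZr mulrA sqrtrM ?sqr_ge0// -expr2 sqrtr_sqr. Qed.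

Lemma enormN x : enorm (- x) = enorm x.
Proof. by rewrite -scaleN1r enormZ normrN1 mul1r. Qed.

Lemma coord_le_enorm x i : `|x ord0 i| <= enorm x.
Proof.
rewrite -(ler_pXn2r (n := 2))// ?nnegrE ?enorm_ge0// sqr_enorm real_normK ?num_real//.
rewrite /dotR (bigD1 i)//= -expr2 lerDl sumr_ge0// => j _.
by rewrite -expr2 sqr_ge0.
Qed.

Lemma enorm_le_sum x : enorm x <= \sum_(i < n) `|x ord0 i|.
Proof.
have s0 : 0 <= \sum_(i < n) `|x ord0 i| by apply: sumr_ge0.
rewrite -(ler_pXn2r (n := 2))// ?nnegrE ?enorm_ge0// sqr_enorm.
rewrite expr2 mulr_suml; apply: ler_sum => i _.
rewrite -expr2 -(real_normK (num_real (x ord0 i))) expr2 ler_wpM2l//.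
by rewrite (bigD1 i)//= lerDl sumr_ge0.
Qed.

Lemma enorm_radproj x : x != 0 -> enorm (radproj x) = 1.
Proof.
move=> x0; rewrite /radproj enormZ ger0_norm ?invr_ge0 ?enorm_ge0//.
by rewrite mulVf// enorm_eq0.
Qed.

Lemma radproj_neq0 x : x != 0 -> radproj x != 0.
Proof. by move=> x0; rewrite -enorm_gt0 enorm_radproj. Qed.

Lemma enormK x : enorm x *: radproj x = x.
Proof.
have [->|x0] := eqVneq x 0; first by rewrite enorm0 scale0r.
by rewrite /radproj scalerA divff ?scale1r// enorm_eq0.
Qed.

Lemma radprojZ c x : 0 < c -> radproj (c *: x) = radproj x.
Proof.
move=> c0; rewrite /radproj enormZ gtr0_norm// invfM scalerA; congr (_ *: _).
by rewrite mulrAC mulVf ?mul1r// gt_eqF.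
Qed.

Lemma radprojN x : radproj (- x) = - radproj x.
Proof. by rewrite /radproj enormN scalerN. Qed.

Lemma radproj_sphere x : sphere x -> radproj x = x.
Proof. by rewrite /sphere /radproj /= => ->; rewrite invr1 scale1r. Qed.

Lemma radproj_id x : radproj (radproj x) = radproj x.
Proof.
have [->|x0] := eqVneq x 0; first by rewrite /radproj !scaler0.
by apply: radproj_sphere; exact: enorm_radproj.
Qed.

Lemma radproj0 : radproj (0 : 'rV[R]_n) = 0.
Proof. by rewrite /radproj scaler0. Qed.

Lemma expR_ln_enorm x : x != 0 -> expR (ln (enorm x)) *: radproj x = x.
Proof. by move=> x0; rewrite lnK ?enormK// posrE enorm_gt0. Qed.

Lemma measurable_dotR d (T : measurableType d) (f g : T -> 'rV[R]_n) :
  measurable_fun setT f -> measurable_fun setT g ->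
  measurable_fun setT (fun t => dotR (f t) (g t)).
Proof.
move=> mf mg; apply: measurable_sum => i; apply: measurable_funM.
  exact: (measurable_fun_compT (@measurable_coord R n i) mf).
exact: (measurable_fun_compT (@measurable_coord R n i) mg).
Qed.

End enorm.

(** * Averages over dilations and their symmetry *)

Section nice.
Variable R : realType.
Local Notation leb := (@lebesgue_measure R).

Lemma expR_neq0 (t : R) : expR t != 0.
Proof. by rewrite gt_eqF// expR_gt0. Qed.

Lemma measurable_expRM (a : R) : measurable_fun setT (fun t : R => expR (a * t)).
Proof.
apply: measurableT_comp; first exact: measurable_expR.
by apply: measurable_funM => //; exact: measurable_id.
Qed.

(** Boundedness controls an average at small scales and integrability at large ones; together they
    make the pairing of an average with another such function converge for [0 < a < n]. *)
Definition nice n (F : 'rV[R]_n -> R) :=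
  [/\ measurable_fun setT F, (exists M, forall x, `|F x| <= M) &
      (mu n).-integrable setT (EFin \o F)].

Lemma nice_bound n (F : 'rV[R]_n -> R) : nice F ->
  exists2 M, 0 <= M & forall x, `|F x| <= M.
Proof.
by move=> [_ [M hM] _]; exists M => //; exact: le_trans (normr_ge0 _) (hM 0).
Qed.

Lemma niceM n (F G : 'rV[R]_n -> R) : measurable_fun setT G ->
  (exists M, forall x, `|G x| <= M) -> nice F -> nice (fun x => G x * F x).
Proof.
move=> mG [M hM] nF; have [K K0 hK] := nice_bound nF; case: nF => mF _ iF.
split; first exact: measurable_funM.
  exists (M * K) => x; rewrite normrM ler_pM//.
exact: integrableMbounded hM iF.
Qed.

Lemma measurable_dilate n (x : 'rV[R]_n) :
  measurable_fun setT (fun t : measurableTypeR R => expR t *: x).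
Proof.
apply: measurable_fun_coordP => i.
have -> : (fun t => (expR t *: x) ord0 i) = (fun t => expR t * x ord0 i).
  by apply/funext => t; rewrite mxE.
apply: measurable_funM => //; exact: measurable_expR.
Qed.

Lemma measurable_dilate2 n :
  measurable_fun setT (fun p : measurableTypeR R * 'rV[R]_n => expR p.1 *: p.2).
Proof.
apply: measurable_fun_coordP => i.
have -> : (fun p : R * 'rV[R]_n => (expR p.1 *: p.2) ord0 i) =
  (fun p => expR p.1 * p.2 ord0 i).
  by apply/funext => t; rewrite mxE.
apply: measurable_funM => //.
  exact: (measurableT_comp (@measurable_expR R) (@measurable_fst _ _ _ _)).
exact: (measurableT_comp (@measurable_coord R n i) (@measurable_snd _ _ _ _)).
Qed.

Lemma nice_dilate n (G : 'rV[R]_n -> R) t : nice G -> nice (fun x => G (expR t *: x)).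
Proof.
move=> [mG [M hM] iG]; split.
- have h := measurable_fun_compT mG (measurable_affine (expR t) 0).
  by under eq_fun do rewrite -[_ *: _]addr0.
- by exists M.
- have := integrable_affine 0 (expR_neq0 t) iG.
  apply: eq_integrable => // x _ /=; by rewrite addr0.
Qed.

Lemma Rintegral_dilate n (F : 'rV[R]_n -> R) t : measurable_fun setT F ->
  \int[mu n]_x F (expR t *: x) = expR (- (n%:R * t)) * \int[mu n]_x F x.
Proof.
move=> mF; have := Rintegral_affine 0 (expR_neq0 t) mF.
under eq_Rintegral do rewrite addr0.
by rewrite gtr0_norm ?expR_gt0// expRN expRM_natl.
Qed.

(* [A_a G (x) = int_0^oo s^(a-1) G (s x) ds] with [s = e^t]: dilations of [x] become
   translations of [t], and [s -> 1/s] becomes [t -> - t]. *)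
Definition scaleint n (a : R) (G : 'rV[R]_n -> R) (x : 'rV[R]_n) : R :=
  \int[leb]_t (expR (a * t) * G (expR t *: x)).

Lemma measurable_scaleint_integrand n a (G : 'rV[R]_n -> R) x :
  measurable_fun setT G -> measurable_fun setT (fun t : R => expR (a * t) * G (expR t
    *: x)).
Proof.
move=> mG; apply: measurable_funM.
  exact: measurable_expRM.
exact: (measurableT_comp mG (measurable_dilate x)).
Qed.

Lemma scaleint_homo n a (G : 'rV[R]_n -> R) s x : measurable_fun setT G ->
  scaleint a G (expR s *: x) = expR (- (a * s)) * scaleint a G x.
Proof.
move=> mG; rewrite /scaleint.
have := @Rintegral_affine1 R 1 s _ (oner_neq0 _) (measurable_scaleint_integrand a x mG).
rewrite normr1 invr1 mul1r => <-.
rewrite -RintegralZ; last first.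
  exact: (measurable_fun_compT (measurable_scaleint_integrand a x mG)
    (measurable_affine1 1 s)).
apply: eq_Rintegral => t _; rewrite mul1r scalerA -expRD mulrA -expRD.
by congr (expR _ * _); ring.
Qed.

(* The integral at [0] diverges unless [G 0 = 0]; its conventional value must
   still be compatible with homogeneity. *)
Lemma scaleint0 n a (G : 'rV[R]_n -> R) : a != 0 -> measurable_fun setT G ->
  scaleint a G 0 = 0.
Proof.
(* Dilation by [e^(-1/a)] fixes the origin, yet homogeneity multiplies the value there by [e]. *)
move=> a0 mG; have := scaleint_homo a (- a^-1) 0 mG.
rewrite scaler0 mulrN opprK divff// => h.
have : (expR 1 - 1) * scaleint a G 0 = 0 by rewrite mulrBl mul1r -h subrr.
move/eqP; rewrite mulf_eq0 => /orP[|/eqP//].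
by rewrite subr_eq0 gt_eqF// expR_gt1.
Qed.

Lemma scaleint_hr n a (G : 'rV[R]_n -> R) : a != 0 -> measurable_fun setT G ->
  hr (scaleint a G) (- a) = scaleint a G.
Proof.
move=> a0 mG; apply/funext => x; rewrite /hr.
have [->|x0] := eqVneq x 0.
  by rewrite enorm0 powR0 ?oppr_eq0// mul0r scaleint0.
rewrite -[in RHS](expR_ln_enorm x0) scaleint_homo//; congr (_ * _).
by rewrite /powR enorm_eq0 (negbTE x0) mulNr.
Qed.

(** Separation of variables: dilations do not move [radproj], so the radial profile contributes only
    its Mellin transform at [a], written in the variable [t]. *)
Lemma scaleint_radial n a (G F : 'rV[R]_n -> R) (rho : R -> R) (x : 'rV[R]_n) :
  measurable_fun setT G -> measurable_fun setT rho -> x != 0 ->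
  (forall y, y != 0 -> G y = F (radproj y) * rho (enorm y)) ->
  scaleint a G x = (\int[leb]_t (expR (a * t) * rho (expR t))) *
    ((enorm x) `^ (- a) * F (radproj x)).
Proof.
move=> mG mr x0 hG.
rewrite -[in LHS](expR_ln_enorm x0) scaleint_homo//.
have -> : expR (- (a * ln (enorm x))) = (enorm x) `^ (- a).
  by rewrite /powR enorm_eq0 (negbTE x0) mulNr.
rewrite mulrCA; congr (_ * _); rewrite mulrC -RintegralZ; last first.
  apply: measurable_funM.
    exact: measurable_expRM.
  exact: (measurableT_comp mr (@measurable_expR R)).
apply: eq_Rintegral => t _.
rewrite hG; last by rewrite scaler_eq0 negb_or radproj_neq0// gt_eqF// expR_gt0.
rewrite radprojZ ?expR_gt0// radproj_id enormZ enorm_radproj// mulr1.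
by rewrite gtr0_norm ?expR_gt0//; ring.
Qed.

Section bilinear.
Variables (n : nat) (a : R) (G H : 'rV[R]_n -> R).
Hypotheses (a0 : 0 < a) (an : a < n%:R) (nG : nice G) (nH : nice H).

Let f (p : measurableTypeR R * 'rV[R]_n) := expR (a * p.1) * (G (expR p.1 *: p.2) * H
  p.2).

(** For [t <= 0], bound [G] by its supremum and integrate [H], which leaves [e^(a t)]. For [t > 0],
    exchange the roles: integrating the dilate of [G] contributes [e^(- n t)] and leaves
    [e^((a - n) t)]. Both are at most [e^(-b |t|)] for [b = min(a, n - a)]. *)
Lemma scaleint_bilinear_integrable : (leb \x mu n)%E.-integrable setT (EFin \o f).
Proof.
have [mG _ iG] := nG; have [mH _ iH] := nH.
have [MG MG0 hMG] := nice_bound nG; have [MH MH0 hMH] := nice_bound nH.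
pose IG := \int[mu n]_x `|G x|; pose IH := \int[mu n]_x `|H x|.
have IG0 : 0 <= IG by apply: Rintegral_ge0.
have IH0 : 0 <= IH by apply: Rintegral_ge0.
pose b := Num.min a (n%:R - a).
have b0 : 0 < b by rewrite lt_min a0 subr_gt0.
have ba : b <= a by rewrite ge_min lexx.
have bna : b <= n%:R - a by rewrite ge_min lexx orbT.
pose K := MG * IH + IG * MH.
have [C hC] := expR_decay b0.
have mf : measurable_fun setT f.
  apply: measurable_funM.
    exact: (measurableT_comp (measurable_expRM a) (@measurable_fst _ _ _ _)).
  apply: measurable_funM; last exact: (measurableT_comp mH (@measurable_snd _ _ _ _)).
  exact: (measurableT_comp mG (@measurable_dilate2 n)).
have nGt t : nice (fun x => G (expR t *: x)) by exact: nice_dilate.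
apply: (@integrable_prod_bound _ _ _ _ R leb (mu n) f (fun t => (K * C) * (oneDsqr
  t)^-1)) => //.
- move=> t; rewrite /f /=; apply: RintegrableZ.
  by have [mGt _ _] := nGt t; exact: (integrableMbounded mGt (fun x => hMG _) iH).
- move=> t.
  apply: (@le_trans _ _ (K * expR (- (b * `|t|)))); last first.
    by rewrite -mulrA ler_wpM2l// addr_ge0// mulr_ge0.
  have [mGt _ iGt] := nGt t.
  have iGH := integrableMbounded mGt (fun x => hMG (expR t *: x)) iH.
  have -> : \int[mu n]_x `|f (t, x)| =
     expR (a * t) * \int[mu n]_x `|G (expR t *: x) * H x|.
    rewrite -RintegralZ; last by apply: measurableT_comp => //; exact: measurable_funM.
    by apply: eq_Rintegral => x _; rewrite /f normrM (ger0_norm (expR_ge0 _)).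
  have nGHt : (mu n).-integrable setT (EFin \o (fun x => `|G (expR t *: x) * H x|)).
    exact: integrable_norm iGH.
  have [t0|t0] := leP t 0.
  + apply: (@le_trans _ _ (expR (a * t) * (MG * IH))).
      rewrite ler_wpM2l ?expR_ge0// -RintegralZ; last exact: measurableT_comp.
      apply: le_Rintegral => //.
        by apply: RintegrableZ; exact: integrable_norm.
      by move=> x _; rewrite normrM ler_wpM2r.
    rewrite mulrC ler_pM ?expR_ge0 ?mulr_ge0//.
      by rewrite lerDl mulr_ge0.
    rewrite ler_expR ler0_norm// mulrN opprK.
    by rewrite ler_wnM2r.
  + apply: (@le_trans _ _ (expR (a * t) * (expR (- (n%:R * t)) * (IG * MH)))).
      rewrite ler_wpM2l ?expR_ge0//.
      have mGn : measurable_fun setT (fun x => `|G x|) by exact: measurableT_comp.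
      rewrite mulrA -(Rintegral_dilate t mGn) mulrC -RintegralZ; last first.
        exact: measurableT_comp.
      apply: le_Rintegral => //.
        by apply: RintegrableZ; exact: (integrable_norm iGt).
      by move=> x _; rewrite normrM mulrC ler_wpM2r.
    rewrite mulrA -expRD mulrC ler_pM ?expR_ge0 ?mulr_ge0//.
      by rewrite lerDr mulr_ge0.
    rewrite ler_expR gtr0_norm//.
    have := ler_wpM2r (ltW t0) bna; rewrite mulrBl; lra.
- by apply: RintegrableZ; exact: integrable_oneDsqrV.
Qed.

Lemma integrable_scaleintM :
  (mu n).-integrable setT (EFin \o (fun x => scaleint a G x * H x)).
Proof.
have [mG _ _] := nG.
have := RFubini_integrable2 scaleint_bilinear_integrable.
apply: eq_integrable => // x _ /=; congr EFin.
rewrite /scaleint mulrC -RintegralZ; last exact: measurable_scaleint_integrand.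
by apply: eq_Rintegral => t _; rewrite /f /=; ring.
Qed.

Lemma Rintegral_scaleintM :
  \int[mu n]_x (scaleint a G x * H x) =
  \int[leb]_t (expR (a * t) * \int[mu n]_x (G (expR t *: x) * H x)).
Proof.
have [mG _ _] := nG; have [mH _ _] := nH.
transitivity (\int[mu n]_x \int[leb]_t f (t, x)).
  apply: eq_Rintegral => x _.
  rewrite /scaleint mulrC -RintegralZ; last exact: measurable_scaleint_integrand.
  by apply: eq_Rintegral => t _; rewrite /f /=; ring.
rewrite -(RFubini scaleint_bilinear_integrable).
apply: eq_Rintegral => t _; rewrite -RintegralZ//.
apply: measurable_funM => //.
by have [] := nice_dilate t nG.
Qed.

End bilinear.

(** Reflect [t] and substitute [e^t x] for [x]: the Jacobian [e^(n t)] turns the factor [e^(- a t)]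
    into [e^((n - a) t)]. *)
Lemma scaleint_sym n (a : R) (G H : 'rV[R]_n -> R) : 0 < a < n%:R ->
  nice G -> nice H ->
  \int[mu n]_x (scaleint a G x * H x) =
  \int[mu n]_x (scaleint (n%:R - a) H x * G x).
Proof.
move=> /andP[a0 an] nG nH; have [mG _ _] := nG; have [mH _ _] := nH.
rewrite !Rintegral_scaleintM ?subr_gt0 ?ltrBlDr ?ltrDl//.
pose k (t : R) := expR (a * t) * \int[mu n]_x (G (expR t *: x) * H x).
have mk : measurable_fun setT k.
  apply: measurable_funM.
    exact: measurable_expRM.
  apply: (measurable_fun_Rintegral (mu n) (f := fun p => G (expR p.1 *: p.2) * H p.2)).
  apply: measurable_funM; last exact: (measurableT_comp mH (@measurable_snd _ _ _ _)).
  exact: (measurableT_comp mG (@measurable_dilate2 n)).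
have := @Rintegral_affine1 R (-1) 0 k _ mk.
rewrite oppr_eq0 oner_eq0 normrN1 invr1 mul1r => /(_ isT) <-.
apply: eq_Rintegral => t _; rewrite /k addr0 mulN1r.
have mGH : measurable_fun setT (fun x : 'rV[R]_n => G (expR (- t) *: x) * H x).
  by apply: measurable_funM => //; have [] := nice_dilate (- t) nG.
transitivity (expR ((n%:R - a) * t) * (expR (- (n%:R * t)) *
    \int[mu n]_x (G (expR (- t) *: x) * H x))).
  by rewrite mulrA -expRD; congr (expR _ * _); ring.
congr (_ * _); rewrite -(Rintegral_dilate t mGH).
by apply: eq_Rintegral => x _; rewrite scalerA -expRD addNr expR0 scale1r mulrC.
Qed.

End nice.

(** * The Fourier transform *)

Section fourier.
Variables (R : realType) (n : nat).
Local Notation leb := (@lebesgue_measure R).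
Implicit Types (F G H phi : 'rV[R]_n -> R).

(* The phase [alpha] covers cosine and sine transforms at once, and both [d/dx_i]
   and multiplication by [x_i] amount to adding [pi / 2] to it. *)
Definition ft (alpha : R) phi (x : 'rV[R]_n) : R :=
  \int[mu n]_xi (phi xi * cos (dotR x xi + alpha)).

Lemma norm_cos_le1 (t : R) : `|cos t| <= 1.
Proof. by rewrite ler_norml cos_geN1 cos_le1. Qed.

Lemma measurable_cos : measurable_fun setT (@cos R).
Proof. by apply: continuous_measurable_fun; exact: continuous_cos. Qed.

Let measurable_cos_dot (alpha : R) x :
  measurable_fun setT (fun xi : 'rV[R]_n => cos (dotR x xi + alpha)).
Proof.
apply: (measurableT_comp measurable_cos); apply: measurable_funD => //.
by apply: measurable_dotR.
Qed.

Let measurable_cos_dot2 (alpha : R) :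
  measurable_fun setT (fun p : 'rV[R]_n * 'rV[R]_n => cos (dotR p.1 p.2 + alpha)).
Proof.
apply: (measurableT_comp measurable_cos); apply: measurable_funD => //.
by apply: measurable_dotR.
Qed.

Section integrable_phi.
Variable phi : 'rV[R]_n -> R.
Hypothesis iphi : (mu n).-integrable setT (EFin \o phi).
Let mphi : measurable_fun setT phi.
Proof. by apply/measurable_EFinP; exact: measurable_int iphi. Qed.

Lemma integrable_ft_integrand alpha x :
  (mu n).-integrable setT (EFin \o (fun xi => phi xi * cos (dotR x xi + alpha))).
Proof.
apply: eq_integrable (integrableMbounded (measurable_cos_dot alpha x)
  (fun=> norm_cos_le1 _) iphi) => //.
by move=> xi _ /=; rewrite mulrC.
Qed.

Lemma ft_bound alpha x : `|ft alpha phi x| <= \int[mu n]_xi `|phi xi|.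
Proof.
apply: Rintegral_norm_le; last exact: integrable_norm.
  exact: measurable_funM.
by move=> xi; rewrite normrM ler_piMr// norm_cos_le1.
Qed.

Lemma ft_cosE x : ft_cos phi x = ft 0 phi x.
Proof.
rewrite /ft_cos integral_RnE; first by apply: eq_Rintegral => xi _; rewrite addr0.
apply: eq_integrable (integrable_ft_integrand 0 x) => // xi _.
by rewrite /= addr0.
Qed.

Lemma ft_sinE x : ft_sin phi x = ft (- (pi / 2)) phi x.
Proof.
have E xi : cos (dotR x xi + - (pi / 2)) = sin (dotR x xi) by rewrite cosBpihalf.
rewrite /ft_sin integral_RnE; first by apply: eq_Rintegral => xi _; rewrite E.
apply: eq_integrable (integrable_ft_integrand (- (pi / 2)) x) => // xi _.
by rewrite /= E.
Qed.

End integrable_phi.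

Lemma ft_mult G H : (mu n).-integrable setT (EFin \o G) ->
  (mu n).-integrable setT (EFin \o H) ->
  \int[mu n]_x (G x * ft 0 H x) = \int[mu n]_x (ft 0 G x * H x).
Proof.
move=> iG iH.
have mG : measurable_fun setT G by apply/measurable_EFinP; exact: measurable_int iG.
have mH : measurable_fun setT H by apply/measurable_EFinP; exact: measurable_int iH.
pose f (p : 'rV[R]_n * 'rV[R]_n) := G p.1 * (H p.2 * cos (dotR p.1 p.2 + 0)).
have mf : measurable_fun setT f.
  apply: measurable_funM; first exact: (measurableT_comp mG (@measurable_fst _ _ _ _)).
  apply: measurable_funM => //; exact: (measurableT_comp mH (@measurable_snd _ _ _ _)).
pose IH := \int[mu n]_x `|H x|.
have fi : (mu n \x mu n)%E.-integrable setT (EFin \o f).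
  apply: (@integrable_prod_bound _ _ _ _ R (mu n) (mu n) f (fun x => IH * `|G x|)) => //.
  - by move=> t; rewrite /f /=; apply: RintegrableZ; exact: integrable_ft_integrand.
  - move=> t; rewrite /f /= mulrC -RintegralZ; last exact: measurableT_comp.
    apply: le_Rintegral => //.
    + by apply: integrable_norm; apply: RintegrableZ; exact: integrable_ft_integrand.
    + by apply: RintegrableZ; exact: integrable_norm.
    + move=> x _; rewrite !normrM ler_wpM2l// ler_piMr// norm_cos_le1//.
  - by apply: RintegrableZ; exact: integrable_norm.
transitivity (\int[mu n]_x \int[mu n]_y f (x, y)).
  apply: eq_Rintegral => x _; rewrite /f /= RintegralZ//.
  exact: measurable_funM.
rewrite (RFubini fi); apply: eq_Rintegral => y _.
rewrite mulrC -RintegralZ; last exact: measurable_funM.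
by apply: eq_Rintegral => x _; rewrite /f /= (dotRC x y); ring.
Qed.

Lemma ft_dilate G t y : measurable_fun setT G ->
  ft 0 (fun x => G (expR t *: x)) y = expR (- (n%:R * t)) * ft 0 G (expR (- t) *: y).
Proof.
move=> mG; rewrite /ft -Rintegral_dilate; last exact: measurable_funM.
apply: eq_Rintegral => x _; rewrite dotRZl dotRZr mulrA -expRD addNr expR0 mul1r//.
Qed.

(** The multiplication formula is applied at each fixed scale. The transform of a dilate is the
    inverse dilate of the transform times a power of the scale, and this power changes [a] into
    [n - a] after reflecting [t]. *)
Lemma scaleint_ft (a : R) G H : 0 < a < n%:R -> nice G -> nice H ->
  nice (ft 0 G) -> nice (ft 0 H) ->
  \int[mu n]_x (scaleint a G x * ft 0 H x) =
  \int[mu n]_x (scaleint (n%:R - a) (ft 0 G) x * H x).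
Proof.
move=> /andP[a0 an] nG nH nfG nfH; have [mG _ iG] := nG; have [mH _ iH] := nH.
have [mfG _ _] := nfG.
rewrite !Rintegral_scaleintM ?subr_gt0 ?ltrBlDr ?ltrDl//.
pose k (t : R) := expR (a * t) * \int[mu n]_x (G (expR t *: x) * ft 0 H x).
have mk : measurable_fun setT k.
  apply: measurable_funM; first exact: measurable_expRM.
  apply: (measurable_fun_Rintegral (mu n) (f := fun p => G (expR p.1 *: p.2) * ft 0 H
    p.2)).
  apply: measurable_funM; last first.
    by have [mfH _ _] := nfH; exact: (measurableT_comp mfH (@measurable_snd _ _ _ _)).
  exact: (measurableT_comp mG (@measurable_dilate2 R n)).
have := @Rintegral_affine1 R (-1) 0 k _ mk.
rewrite oppr_eq0 oner_eq0 normrN1 invr1 mul1r => /(_ isT) <-.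
apply: eq_Rintegral => t _; rewrite /k addr0 mulN1r.
have [_ _ iGt] := nice_dilate (- t) nG.
rewrite ft_mult//.
have mft : measurable_fun setT (fun x : 'rV[R]_n => ft 0 G (expR t *: x) * H x).
  by apply: measurable_funM => //; have [] := nice_dilate t nfG.
transitivity (expR (a * - t) * (expR (- (n%:R * - t)) *
    \int[mu n]_x (ft 0 G (expR t *: x) * H x))).
  congr (_ * _); rewrite -RintegralZ//; apply: eq_Rintegral => x _.
  by rewrite ft_dilate// opprK mulrA.
by rewrite mulrA -expRD; congr (expR _ * _); ring.
Qed.

Lemma Rintegral_opp F : measurable_fun setT F ->
  \int[mu n]_x F (- x) = \int[mu n]_x F x.
Proof.
move=> mF; have := Rintegral_affine (n := n) (c := -1) 0 _ mF.
rewrite oppr_eq0 oner_eq0 normrN1 expr1n invr1 mul1r => /(_ isT) <-.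
by apply: eq_Rintegral => x _; rewrite scaleN1r addr0.
Qed.

Lemma Rintegral_odd F : measurable_fun setT F -> (forall x, F (- x) = - F x) ->
  \int[mu n]_x F x = 0.
Proof.
move=> mF oF; have := Rintegral_opp mF.
under eq_Rintegral do rewrite oF -mulN1r.
by rewrite RintegralZ//; lra.
Qed.

Lemma ftN_even phi x : measurable_fun setT phi -> (forall xi, phi (- xi) = phi xi) ->
  ft 0 phi (- x) = ft 0 phi x.
Proof.
move=> mphi ephi; apply: eq_Rintegral => xi _.
by rewrite !addr0 dotRNl cosN.
Qed.

Lemma ft_sinN phi x : measurable_fun setT phi ->
  ft (- (pi / 2)) phi (- x) = - ft (- (pi / 2)) phi x.
Proof.
move=> mphi; rewrite /ft -[RHS]mulN1r -RintegralZ; last exact: measurable_funM.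
by apply: eq_Rintegral => xi _; rewrite dotRNl !cosBpihalf sinN; ring.
Qed.

End fourier.

(** * Smooth and Schwartz functions *)

Section derivatives.
Variables (R : realType) (V : normedModType R).
Implicit Types (F G : V -> R) (x v : V).

Lemma is_deriveD_fun F G x v a b : is_derive x v F a -> is_derive x v G b ->
  is_derive x v (fun y => F y + G y) (a + b).
Proof. exact: is_deriveD. Qed.

Lemma is_deriveM_fun F G x v a b : is_derive x v F a -> is_derive x v G b ->
  is_derive x v (fun y => F y * G y) (F x * b + a * G x).
Proof.
move=> hF hG; have := is_deriveM hF hG.
by move=> h; apply: is_derive_eq h _; rewrite [a * _]mulrC.
Qed.

Lemma is_derive_cst_fun x v (c : R) : is_derive x v (fun=> c) 0.
Proof. exact: is_derive_cst. Qed.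

Lemma is_deriveZ_fun F x v (c a : R) : is_derive x v F a ->
  is_derive x v (fun y => c * F y) (c * a).
Proof.
move=> h; have := is_deriveM_fun (is_derive_cst_fun x v c) h.
by move=> h'; apply: is_derive_eq h' _; rewrite mul0r addr0.
Qed.

(** Directional derivatives become derivatives in one real variable, where the chain rule, the mean
    value theorem and differentiation under the integral sign apply. *)
Lemma is_derive_line F x v (t d : R) :
  is_derive (t *: v + x) v F d <-> is_derive t 1 (fun s : R => F (s *: v + x)) d.
Proof.
have E : (fun h : R => h^-1 *: ((F \o shift (t *: v + x)) (h *: v) - F (t *: v + x))) =
    (fun h : R => h^-1 *: (((fun s : R => F (s *: v + x)) \o shift t) (h *: (1 : R)) -
       F (t *: v + x))).
  apply/funext => h /=; congr (_ *: (F _ - _)).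
  by rewrite /= scalerDl -addrA [h *: 1]mulr1.
by split => -[h1 h2]; split; [move: h1|move: h2|move: h1|move: h2];
  rewrite /derivable /derive E.
Qed.

Lemma is_derive_line0 F x v (d : R) :
  is_derive x v F d <-> is_derive (0 : R) 1 (fun s : R => F (s *: v + x)) d.
Proof. by rewrite -is_derive_line scale0r add0r. Qed.

Lemma is_derive_comp (u : R -> R) F x v (a b : R) :
  is_derive (F x) 1 u a -> is_derive x v F b -> is_derive x v (fun y => u (F y)) (a * b).
Proof.
move=> hu /is_derive_line0 hF; apply/is_derive_line0.
apply: (@is_derive1_comp _ u (fun s : R => F (s *: v + x))) => //.
by rewrite scale0r add0r.
Qed.

Lemma is_derive1_continuous (u : R -> R) (t a : R) : is_derive t 1 u a ->
  {for t, continuous u}.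
Proof. by move=> [h _]; apply: differentiable_continuous; exact/derivable1_diffP. Qed.

End derivatives.

Section lipschitz.
Variables (R : realType) (n : nat).
Implicit Types (F : 'rV[R]_n -> R) (x y : 'rV[R]_n).

(** Pass from [x] to [y] by changing one coordinate at a time: the point [p k] has the first [k]
    coordinates of [y]. Each segment is parallel to an axis and stays in the box, so the mean value
    theorem applies to it. *)
Lemma box_lipschitz F (D : 'I_n -> 'rV[R]_n -> R) x (r M : R) :
  (forall y i, box x r y -> is_derive y (ei R i) F (D i y)) ->
  (forall y i, box x r y -> `|D i y| <= M) ->
  forall y, 0 < r -> box x r y -> `|F y - F x| <= M * \sum_(i < n) `|y ord0 i - x ord0 i|.
Proof.
move=> hD hM y r0 hy.
pose p (k : nat) : 'rV[R]_n := \row_i (if (i < k)%N then y ord0 i else x ord0 i).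
have step (k : 'I_n) : `|F (p k.+1) - F (p k)| <= M * `|y ord0 k - x ord0 k|.
  set d := y ord0 k - x ord0 k.
  pose q (t : R) := (t * d) *: ei R k + p k.
  have q0 : q 0 = p k by rewrite /q mul0r scale0r add0r.
  have q1 : q 1 = p k.+1.
    apply/rowP => i; rewrite /q mul1r !mxE eqxx /=.
    have [->|ik] := eqVneq i k.
      by rewrite ltnn ltnSn mulr1 /d subrK.
    have ikN : (i == k :> nat) = false by exact/negbTE.
    have -> : (i < k.+1)%N = (i < k)%N by rewrite ltnS leq_eqVlt ikN.
    by rewrite mulr0 add0r.
  have qb (t : R) : 0 <= t <= 1 -> box x r (q t).
    move=> /andP[t0 t1] i; rewrite /q !mxE eqxx /=.
    have [->|ik] := eqVneq i k.
      rewrite ltnn mulr1 opprD addrCA subrr addr0 normrN normrM (ger0_norm t0).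
      apply: le_lt_trans (hy k); rewrite /d distrC ler_piMl//.
    rewrite mulr0 add0r; case: ifP => _; first exact: hy.
    by rewrite subrr normr0.
  have dq (t : R) : 0 <= t <= 1 -> is_derive t 1 (F \o q) (D k (q t) * d).
    move=> ht.
    have h1 := (is_derive_line F (p k) (ei R k) (t * d) (D k (q t))).1 (hD _ _ (qb _ ht)).
    have h2 : is_derive t (1 : R) (fun t : R => t * d) d.
      apply: is_derive_eq (is_deriveM_fun (is_derive_id t (1 : R)) (is_derive_cst_fun t
        (1 : R) d)) _.
      by rewrite mulr0 add0r mul1r.
    pose proof (is_derive1_comp (x := t) h1 h2) as h3; refine h3.
  have [||c c01 hc] := @MVT _ (F \o q) (fun t => D k (q t) * d) 0 1 ltr01.
  - by move=> t; rewrite in_itv/= => /andP[/ltW t0 /ltW t1]; apply: dq; rewrite t0 t1.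
  - apply: continuous_in_subspaceT => t; rewrite inE/= in_itv/= => ht.
    exact: is_derive1_continuous (dq _ ht).
  move: c01; rewrite in_itv/= => /andP[/ltW c0 /ltW c1].
  rewrite -q0 -q1; move: hc; rewrite subr0 mulr1 /= => ->; rewrite normrM ler_wpM2r//.
  by apply: hM; apply: qb; rewrite c0 c1.
have -> : F y - F x = \sum_(k < n) (F (p k.+1) - F (p k)).
  rewrite -(big_mkord xpredT (fun k => F (p k.+1) - F (p k))) telescope_sumr//.
  congr (F _ - F _); apply/rowP => i; rewrite mxE//.
  by rewrite ltn_ord.
rewrite mulr_sumr; apply: le_trans (ler_norm_sum _ _ _) _.
by apply: ler_sum => i _; exact: step.
Qed.

(** Partial derivatives alone do not give continuity, but locally bounded ones do. This supplies the
    continuity clause of [smooth_on] for functions defined by integrals. *)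
Lemma box_continuous F (D : 'I_n -> 'rV[R]_n -> R) x (r M : R) : 0 < r ->
  (forall y i, box x r y -> is_derive y (ei R i) F (D i y)) ->
  (forall y i, box x r y -> `|D i y| <= M) -> {for x, continuous F}.
Proof.
move=> r0 hD hM.
suff : F y @[y --> (x : 'rV[R]_n)] --> F x by [].
apply/(@cvgrPdist_lt _ _ _ (nbhs x) _) => e e0.
have MM : 0 < `|M| + 1 by rewrite ltr_pwDr.
(* Taking [n + 1] in place of [n] keeps the denominator positive in dimension [0] and makes the
   final estimate strict. *)
pose s := Num.min r (e / ((`|M| + 1) * n.+1%:R)).
have s0 : 0 < s by rewrite lt_min r0 divr_gt0// mulr_gt0.
near=> y.
have [_ hy] : ball x s y by near: y; exact: nbhsx_ballx.
have hb i : `|x ord0 i - y ord0 i| < s by exact: hy.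
have byr : box x r y by move=> i; apply: lt_le_trans (hb i) _; rewrite ge_min lexx.
rewrite distrC; apply: le_lt_trans (box_lipschitz hD hM r0 byr) _.
apply: (@le_lt_trans _ _ ((`|M| + 1) * \sum_(i < n) s)).
  apply: (@le_trans _ _ ((`|M| + 1) * \sum_(i < n) `|y ord0 i - x ord0 i|)).
    rewrite ler_wpM2r ?sumr_ge0//.
    by rewrite (le_trans (ler_norm _))// lerDl.
  apply: ler_wpM2l; first exact: ltW.
  apply: ler_sum => i _.
  by rewrite distrC ltW.
rewrite sumr_const card_ord -mulr_natr.
apply: (@le_lt_trans _ _ ((`|M| + 1) * (e / ((`|M| + 1) * n.+1%:R) * n%:R))).
  apply: ler_wpM2l; first exact: ltW.
  by apply: ler_wpM2r => //; rewrite ge_min lexx orbT.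
have n0 : 0 < n.+1%:R :> R by rewrite ltr0n.
have -> : (`|M| + 1) * (e / ((`|M| + 1) * n.+1%:R) * n%:R) = e * (n%:R / n.+1%:R).
  by field; rewrite !gt_eqF.
by rewrite gtr_pMr// ltr_pdivrMr// mul1r ltr_nat.
Unshelve. all: by end_near. Qed.

End lipschitz.

Section smooth.
Variables (R : realType) (n : nat).
Local Notation V := 'rV[R]_n.
Implicit Types (F G : V -> R) (U : set V) (i : 'I_n).

(** Coinduction: by iteration every [pderiv l F] agrees on [U] with a member of [P]. As [U] is open,
    agreement on [U] passes to derivatives, and no formula for higher derivatives is ever
    written. *)
Lemma smooth_on_coind U (P : (V -> R) -> Prop) : open U ->
  (forall F x, P F -> U x -> {for x, continuous F}) ->
  (forall F i, P F -> exists2 G, P G & forall x, U x -> is_derive x (ei R i) F (G x)) ->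
  forall F, P F -> smooth_on U F.
Proof.
move=> oU cP dP F PF.
have key l : exists2 G, P G & forall x, U x -> pderiv l F x = G x.
  elim: l => [|i l [G PG hG]]; first by exists F.
  have [H PH hH] := dP _ i PG; exists H => // x Ux /=.
  have [_ <-] := hH x Ux; apply: near_eq_derive.
  by apply: filterS (open_nbhs_nbhs (conj oU Ux)) => y Uy; exact: hG.
move=> l x Ux; have [G PG hG] := key l.
have nU : \forall y \near x, G y = pderiv l F y.
  by apply: filterS (open_nbhs_nbhs (conj oU Ux)) => y Uy; rewrite hG.
split.
  move=> i; have [H PH hH] := dP _ i PG; have [dG _] := hH x Ux.
  exact: near_eq_derivable dG.
have cG := cP _ _ PG Ux.
rewrite /prop_for /continuous_at -(nbhs_singleton nU).
exact: cvg_trans (near_eq_cvg nU) cG.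
Qed.

Lemma smooth_on_is_derive U F x i : smooth_on U F -> U x ->
  is_derive x (ei R i) F (derive F x (ei R i)).
Proof. by move=> sF Ux; have [d _] := sF [::] x Ux; split. Qed.

Lemma smooth_on_continuous U F x : smooth_on U F -> U x -> {for x, continuous F}.
Proof. by move=> sF Ux; have [] := sF [::] x Ux. Qed.

Lemma pderiv_rcons (l : seq 'I_n) i F :
  pderiv l (fun x => derive F x (ei R i)) = pderiv (rcons l i) F.
Proof. by elim: l => [//|j l IH] /=; rewrite IH. Qed.

Lemma smooth_on_derive U F i : smooth_on U F ->
  smooth_on U (fun x => derive F x (ei R i)).
Proof. by move=> sF l x Ux; rewrite pderiv_rcons; exact: sF. Qed.

(** The sequence [w] lists the successive derivatives, so that a shift of [w] witnesses the
    smoothness of the derivative. *)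
Definition smooth1 (D : set R) (u : R -> R) :=
  exists2 w : nat -> R -> R, w 0%N = u &
    forall k t, D t -> is_derive t 1 (w k) (w k.+1 t).

Section closure.
Variables (U : set V) (oU : open U).

(* This class is stable under partial derivatives, so all its members are smooth. *)
Inductive smooth_closure : (V -> R) -> Prop :=
| sc_base F : smooth_on U F -> smooth_closure F
| sc_coord i : smooth_closure (fun x => x ord0 i)
| sc_cst c : smooth_closure (fun=> c)
| sc_add F G : smooth_closure F -> smooth_closure G -> smooth_closure (fun x => F x + G x)
| sc_mul F G : smooth_closure F -> smooth_closure G -> smooth_closure (fun x => F x * G x)
| sc_comp D u F : smooth1 D u -> (forall x, U x -> D (F x)) -> smooth_closure F ->
    smooth_closure (fun x => u (F x)).

Lemma is_derive_coord (x v : V) i : is_derive x v (fun y : V => y ord0 i) (v ord0 i).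
Proof.
apply/is_derive_line0.
have -> : (fun s : R => (s *: v + x) ord0 i) = (fun s => v ord0 i * s + x ord0 i).
  by apply/funext => s; rewrite !mxE mulrC.
have h := is_deriveD_fun (is_deriveZ_fun (v ord0 i) (is_derive_id (0 : R) (1 : R)))
  (is_derive_cst_fun (0 : R) (1 : R) (x ord0 i)).
by apply: is_derive_eq h _; rewrite mulr1 addr0.
Qed.

Lemma smooth_closureP F : smooth_closure F -> smooth_on U F.
Proof.
apply: (smooth_on_coind (P := smooth_closure)) => //.
  move=> {}F x; elim=> {F}.
  - by move=> F sF Ux; exact: smooth_on_continuous sF Ux.
  - by move=> i _; exact: coord_continuous.
  - by move=> c _; exact: cst_continuous.
  - by move=> F G _ hF _ hG Ux; exact: cvgD (hF Ux) (hG Ux).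
  - by move=> F G _ hF _ hG Ux; exact: cvgM (hF Ux) (hG Ux).
  - move=> D u F [w <- hw] hD _ hF Ux.
    apply: (cvg_comp F (w 0%N) (hF Ux)).
    exact: is_derive1_continuous (hw 0%N _ (hD _ Ux)).
move=> {}F i; elim=> {F}.
- move=> F sF; exists (fun x => derive F x (ei R i)).
    by apply: sc_base; exact: smooth_on_derive.
  by move=> x Ux; exact: smooth_on_is_derive sF Ux.
- move=> j; exists (fun=> (ei R i) ord0 j); first exact: sc_cst.
  by move=> x _; exact: is_derive_coord.
- move=> c; exists (fun=> 0); first exact: sc_cst.
  by move=> x _; exact: is_derive_cst_fun.
- move=> F G _ [F' sF' hF] _ [G' sG' hG]; exists (fun x => F' x + G' x).
    exact: sc_add.
  by move=> x Ux; apply: is_deriveD_fun; [exact: hF|exact: hG].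
- move=> F G sF [F' sF' hF] sG [G' sG' hG]; exists (fun x => F x * G' x + F' x * G x).
    by apply: sc_add; apply: sc_mul.
  by move=> x Ux; apply: is_deriveM_fun; [exact: hF|exact: hG].
- move=> D u F [w <- hw] hD sF [F' sF' hF].
  exists (fun x => w 1%N (F x) * F' x).
    apply: sc_mul => //; apply: (sc_comp (D := D)) => //.
    by exists (fun k => w k.+1) => // k t Dt; exact: hw.
  by move=> x Ux; apply: is_derive_comp; [exact: hw (hD _ Ux)|exact: hF].
Qed.

Lemma smooth_onD F G : smooth_on U F -> smooth_on U G ->
  smooth_on U (fun x => F x + G x).
Proof. by move=> ? ?; apply: smooth_closureP; apply: sc_add; exact: sc_base. Qed.

Lemma smooth_onM F G : smooth_on U F -> smooth_on U G ->
  smooth_on U (fun x => F x * G x).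
Proof. by move=> ? ?; apply: smooth_closureP; apply: sc_mul; exact: sc_base. Qed.

Lemma smooth_on_coord i : smooth_on U (fun x => x ord0 i).
Proof. by apply: smooth_closureP; exact: sc_coord. Qed.

Lemma smooth_on_cst (c : R) : smooth_on U (fun=> c).
Proof. by apply: smooth_closureP; exact: sc_cst. Qed.

Lemma smooth_on_comp D u F : smooth1 D u -> (forall x, U x -> D (F x)) ->
  smooth_on U F -> smooth_on U (fun x => u (F x)).
Proof.
by move=> su hD sF; apply: smooth_closureP; apply: (sc_comp su hD); exact: sc_base.
Qed.

Lemma smooth_on_dotR : smooth_on U (fun x => dotR x x).
Proof.
rewrite /dotR; elim: (index_enum _) => [|i s IH].
  have -> : (fun x : V => \sum_(i <- [::]) x ord0 i * x ord0 i) = (fun=> 0).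
    by apply/funext => x; rewrite big_nil.
  exact: smooth_on_cst.
have -> : (fun x : V => \sum_(i <- i :: s) x ord0 i * x ord0 i) =
    (fun x => x ord0 i * x ord0 i + \sum_(i <- s) x ord0 i * x ord0 i).
  by apply/funext => x; rewrite big_cons.
by apply: smooth_onD => //; apply: smooth_onM; exact: smooth_on_coord.
Qed.

Lemma smooth_on_eq F G : (forall x, U x -> F x = G x) -> smooth_on U F -> smooth_on U G.
Proof.
move=> FG sF.
apply: (smooth_on_coind (P := fun G => exists2 F, smooth_on U F & forall x, U x -> F x
  = G x)) => //; last by exists F.
- move=> {FG sF F}G x [F sF FG] Ux.
  have nU : \forall y \near x, F y = G y.
    by apply: filterS (open_nbhs_nbhs (conj oU Ux)) => y Uy; exact: FG.
  rewrite /prop_for /continuous_at -(nbhs_singleton nU).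
  exact: cvg_trans (near_eq_cvg nU) (smooth_on_continuous sF Ux).
- move=> {FG sF F}G i [F sF FG].
  exists (fun x => derive F x (ei R i)).
    by exists (fun x => derive F x (ei R i)) => //; exact: smooth_on_derive.
  move=> x Ux; apply: near_eq_is_derive (smooth_on_is_derive i sF Ux).
  by apply: filterS (open_nbhs_nbhs (conj oU Ux)) => y Uy; rewrite FG.
Qed.

End closure.

Lemma smooth_on_pderiv0 U F : open U -> (forall x, U x -> F x = 0) ->
  forall l x, U x -> pderiv l F x = 0.
Proof.
move=> oU F0; elim=> [|i l IH] x Ux /=; first exact: F0.
rewrite (@near_eq_derive _ _ _ _ (cst 0)); first by rewrite derive_cst.
by apply: filterS (open_nbhs_nbhs (conj oU Ux)) => y Uy; exact: IH.
Qed.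

Lemma smooth_onU U W F : smooth_on U F -> smooth_on W F -> smooth_on (U `|` W) F.
Proof. by move=> sU sW l x [Ux|Wx]; [exact: sU|exact: sW]. Qed.

Lemma smooth_on_subset U W F : U `<=` W -> smooth_on W F -> smooth_on U F.
Proof. by move=> UW sW l x /UW; exact: sW. Qed.

End smooth.

Section schwartz.
Variables (R : realType) (n : nat).
Local Notation V := 'rV[R]_n.
Implicit Types (F G : V -> R) (i : 'I_n).

Lemma schwartz_coind (P : (V -> R) -> Prop) :
  (forall F x, P F -> {for x, continuous F}) ->
  (forall F i, P F -> exists2 G, P G & forall x, is_derive x (ei R i) F (G x)) ->
  (forall F k, P F -> exists C, forall x, enorm x ^+ k * `|F x| <= C) ->
  forall F, P F -> schwartz F.
Proof.
move=> cP dP bP F PF; split.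
  apply: (@smooth_on_coind _ _ setT P) => //; first exact: openT.
    by move=> G x PG _; exact: cP.
  by move=> G i /(dP _ i)[H PH hH]; exists H.
move=> l k.
suff : P (pderiv l F) by exact: bP.
elim: l => [//|i l IH] /=.
have [H PH hH] := dP _ i IH.
have -> : (fun x => derive (pderiv l F) x (ei R i)) = H.
  by apply/funext => x; have [] := hH x.
exact: PH.
Qed.

Lemma schwartz_derive F i : schwartz F -> schwartz (fun x => derive F x (ei R i)).
Proof.
move=> [sF bF]; split; first exact: smooth_on_derive.
by move=> l k; rewrite pderiv_rcons; exact: bF.
Qed.

Lemma schwartz_continuous F : schwartz F -> continuous F.
Proof. by move=> [sF _] x; exact: (smooth_on_continuous sF I). Qed.

Lemma schwartz_is_derive F x i : schwartz F -> is_derive x (ei R i) F (derive F x (ei R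
  i)).
Proof. by move=> [sF _]; exact: (smooth_on_is_derive i sF I). Qed.

Lemma schwartz_decay F k : schwartz F -> exists C, forall x, enorm x ^+ k * `|F x| <= C.
Proof. by move=> [_ /(_ [::] k)]. Qed.

(** The product rule for [x_j F] produces a sum and a constant multiple; adding these two operations
    closes the class under partial derivatives. *)
Inductive schwartz_closure : (V -> R) -> Prop :=
| zc_base F : schwartz F -> schwartz_closure F
| zc_zero : schwartz_closure (fun=> 0)
| zc_coord i F : schwartz_closure F -> schwartz_closure (fun x => x ord0 i * F x)
| zc_scale c F : schwartz_closure F -> schwartz_closure (fun x => c * F x)
| zc_add F G : schwartz_closure F -> schwartz_closure G ->
    schwartz_closure (fun x => F x + G x).

Lemma schwartz_closureP F : schwartz_closure F -> schwartz F.
Proof.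
apply: schwartz_coind => {F}.
- move=> F x; elim=> {F}.
  + by move=> F sF; exact: schwartz_continuous.
  + exact: cst_continuous.
  + by move=> i F _ hF; apply: cvgM hF; exact: coord_continuous.
  + by move=> c F _ hF; apply: cvgM hF; exact: cst_continuous.
  + by move=> F G _ hF _ hG; exact: cvgD hF hG.
- move=> F i; elim=> {F}.
  + move=> F sF; exists (fun x => derive F x (ei R i)).
      by apply: zc_base; exact: schwartz_derive.
    by move=> x; exact: schwartz_is_derive.
  + by exists (fun=> 0); [exact: zc_zero|move=> x; exact: is_derive_cst_fun].
  + move=> j F sF [F' sF' hF].
    exists (fun x : V => x ord0 j * F' x + (ei R i) ord0 j * F x).
      by apply: zc_add; [exact: zc_coord|exact: zc_scale].
    by move=> x; exact: (is_deriveM_fun (is_derive_coord x _ j) (hF x)).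
  + move=> c F sF [F' sF' hF]; exists (fun x => c * F' x); first exact: zc_scale.
    by move=> x; exact: is_deriveZ_fun.
  + move=> F G _ [F' sF' hF] _ [G' sG' hG]; exists (fun x => F' x + G' x).
      exact: zc_add.
    by move=> x; exact: is_deriveD_fun.
- move=> F k hF; elim: hF k => {F}.
  + by move=> F sF k; exact: schwartz_decay.
  + by move=> k; exists 0 => x; rewrite normr0 mulr0.
  + move=> i F _ hF k; have [C hC] := hF k.+1; exists C => x.
    apply: le_trans (hC x); rewrite normrM exprSr -mulrA ler_wpM2l ?exprn_ge0
      ?enorm_ge0//.
    by rewrite ler_wpM2r// coord_le_enorm.
  + move=> c F _ hF k; have [C hC] := hF k; exists (`|c| * C) => x.
    by rewrite normrM mulrCA ler_wpM2l.
  + move=> F G _ hF _ hG k; have [C hC] := hF k; have [C' hC'] := hG k.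
    exists (C + C') => x; apply: le_trans (lerD (hC x) (hC' x)).
    by rewrite -mulrDr ler_wpM2l ?exprn_ge0 ?enorm_ge0// ler_normD.
Qed.

Lemma schwartz_coord i F : schwartz F -> schwartz (fun x => x ord0 i * F x).
Proof. by move=> sF; apply: schwartz_closureP; apply: zc_coord; exact: zc_base. Qed.

(** The inverse of [weight x] is at most [(1 + |x|^2)^n], hence at most [2^n (1 + |x|^(2n))]; so
    decay of orders [0] and [2n] is enough. *)
Lemma schwartz_weight F : schwartz F -> exists C, forall x, `|F x| <= C * weight x.
Proof.
move=> sF; have [C0 hC0] := schwartz_decay 0 sF.
have [C1 hC1] := schwartz_decay (n.*2) sF.
exists (2 ^+ n * (C0 + C1)) => x.
have o1 i : 1 <= oneDsqr (x ord0 i) by exact: oneDsqr_ge1.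
have p0 : 0 < \prod_(i < n) oneDsqr (x ord0 i).
  by apply: prodr_gt0 => i _; rewrite (lt_le_trans ltr01).
have -> : weight x = (\prod_(i < n) oneDsqr (x ord0 i))^-1.
  by rewrite /weight -prodfV.
rewrite ler_pdivlMr// mulrC.
have e0 : 0 <= enorm x ^+ 2 by rewrite exprn_ge0// enorm_ge0.
apply: (@le_trans _ _ ((1 + enorm x ^+ 2) ^+ n * `|F x|)).
  rewrite ler_wpM2r//.
  have -> : (1 + enorm x ^+ 2) ^+ n = \prod_(i < n) (1 + enorm x ^+ 2).
    by rewrite prodr_const card_ord.
  apply: ler_prod => i _; rewrite (le_trans ler01)//= /oneDsqr lerD2l.
  rewrite -(real_normK (num_real (x ord0 i))) lerXn2r// ?nnegrE ?enorm_ge0//.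
  exact: coord_le_enorm.
apply: (@le_trans _ _ (2 ^+ n * (1 + enorm x ^+ n.*2) * `|F x|)).
  rewrite ler_wpM2r//.
  have [h|h] := leP (enorm x ^+ 2) 1.
    apply: (@le_trans _ _ (2 ^+ n)).
      by rewrite lerXn2r// ?nnegrE ?addr_ge0//; lra.
    by rewrite ler_peMr ?exprn_ge0// lerDl exprn_ge0// enorm_ge0.
  apply: (@le_trans _ _ (2 ^+ n * enorm x ^+ n.*2)).
    rewrite -muln2 mulnC exprM -exprMn; move: (enorm x ^+ 2) e0 h => s s0 s1.
    by rewrite lerXn2r// ?nnegrE ?addr_ge0 ?mulr_ge0//; lra.
  by rewrite ler_wpM2l ?exprn_ge0// lerDr.
rewrite -mulrA ler_wpM2l ?exprn_ge0// mulrDl mul1r lerD//.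
by have := hC0 x; rewrite expr0 mul1r.
Qed.

Lemma schwartz_nice F : schwartz F -> nice F.
Proof.
move=> sF; have mF : measurable_fun setT F.
  by apply: continuous_measurable_rV; exact: schwartz_continuous.
split => //.
- by have [C hC] := schwartz_decay 0 sF; exists C => x; have := hC x; rewrite expr0 mul1r.
- have [C hC] := schwartz_weight sF.
  by apply: (Rle_integrable mF hC); apply: RintegrableZ; exact: integrable_weight.
Qed.

End schwartz.

(** * Fourier inversion for even Schwartz functions *)

Section under_integral.
Context d (Y : measurableType d) (R : realType) (m : {measure set Y -> \bar R}).

Lemma is_derive_under_integral (f f' : R -> Y -> R) (G : Y -> R) (u v a : R) :
  u < a < v ->
  (forall t, u < t < v -> m.-integrable setT (EFin \o f t)) ->
  (forall t y, u < t < v -> is_derive t 1 (f ^~ y) (f' t y)) ->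
  (forall t y, u < t < v -> `|f' t y| <= G y) ->
  m.-integrable setT (EFin \o G) ->
  is_derive a 1 (fun t => \int[m]_y f t y) (\int[m]_y f' a y).
Proof.
move=> auv fi df fG Gi.
have Ia : [set` `]u, v[] a by rewrite /= in_itv.
have itvE t : [set` `]u, v[] t -> u < t < v by rewrite /= in_itv.
have intf t : [set` `]u, v[] t -> m.-integrable setT (EFin \o f t).
  by move=> /itvE; exact: fi.
have derf t y : [set` `]u, v[] t -> setT y -> derivable (f ^~ y) t 1.
  by move=> /itvE h _; have [] := df t y h.
have G0 y : 0 <= G y by exact: le_trans (normr_ge0 _) (fG a y auv).
have E t y : u < t < v -> partial1of2 f t y = f' t y.
  by move=> h; rewrite partial1of2E; have [] := df t y h.
have ub t y : [set` `]u, v[] t -> setT y -> `|partial1of2 f t y| <= G y.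
  by move=> /itvE h _; rewrite E//; exact: fG.
split; first exact: (derivable_under_integral measurableT Ia intf derf G0 Gi ub).
rewrite -derive1E (differentiation_under_integral measurableT Ia intf derf G0 Gi ub).
by apply: eq_Rintegral => y _; exact: E.
Qed.

End under_integral.

Section parts.
Variables (R : realType) (n : nat).
Local Notation V := 'rV[R]_n.

Lemma weight_shift (x : V) i (t : R) : `|t| <= 1 ->
  weight (t *: ei R i + x) <= 3 * weight x.
Proof.
move=> t1; rewrite /weight (bigD1 i)//= [in leRHS](bigD1 i)//= mulrA.
have o0 (s : R) : 0 < oneDsqr s by rewrite (lt_le_trans ltr01)// oneDsqr_ge1.
have -> : \prod_(j < n | j != i) (oneDsqr ((t *: ei R i + x) ord0 j))^-1 =
  \prod_(j < n | j != i) (oneDsqr (x ord0 j))^-1.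
  by apply: eq_bigr => j ji; rewrite !mxE (negbTE ji) andbF mulr0 add0r.
apply: ler_wpM2r.
  by apply: prodr_ge0 => j _; rewrite invr_ge0 ltW.
rewrite !mxE !eqxx mulr1 ler_pdivlMr// mulrC ler_pdivrMr//.
rewrite /oneDsqr; have : t ^+ 2 <= 1 by rewrite -(real_normK (num_real t)) expr_le1.
(* The difference of the two sides is [2 - (3/2) t^2 + (2 s + 3 t)^2 / 2]. *)
move: (x ord0 i) => s; have := sqr_ge0 (2 * s + 3 * t); nra.
Qed.

(* By translation invariance [t |-> int psi (t e_i + x) dx] is constant. *)
Lemma Rintegral_derive0 (psi psi' : V -> R) i (C : R) :
  (mu n).-integrable setT (EFin \o psi) ->
  (forall x, is_derive x (ei R i) psi (psi' x)) ->
  (forall x, `|psi' x| <= C * weight x) ->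
  \int[mu n]_x psi' x = 0.
Proof.
move=> ipsi dpsi bpsi.
have mpsi : measurable_fun setT psi by apply/measurable_EFinP; exact: measurable_int ipsi.
pose f (t : R) (y : V) := psi (t *: ei R i + y).
pose f' (t : R) (y : V) := psi' (t *: ei R i + y).
have C0 : 0 <= C.
  have : 0 <= C * weight (0 : V) by exact: le_trans (normr_ge0 _) (bpsi 0).
  suff w0 : 0 < weight (0 : V) by rewrite pmulr_lge0.
  by apply: prodr_gt0 => j _; rewrite invr_gt0 (lt_le_trans ltr01)// oneDsqr_ge1.
have fE t y : f t y = psi (1 *: y + t *: ei R i) by rewrite /f scale1r addrC.
have h : is_derive (0 : R) 1 (fun t => \int[mu n]_y f t y) (\int[mu n]_y f' 0 y).
  apply: (@is_derive_under_integral _ _ R (mu n) f f' (fun y => (3 * C) * weight y)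
    (-1) 1).
  - by rewrite ltrN10 ltr01.
  - move=> t _; have := integrable_affine (t *: ei R i) (oner_neq0 R) ipsi.
    by apply: eq_integrable => // y _; rewrite /= fE.
  - by move=> t y _; exact: ((is_derive_line psi y (ei R i) t _).1 (dpsi _)).
  - move=> t y /andP[t1 t2]; apply: le_trans (bpsi _) _.
    rewrite (mulrC 3) -mulrA ler_wpM2l// weight_shift// ler_norml; apply/andP; split;
      exact: ltW.
  - by apply: RintegrableZ; exact: integrable_weight.
have [_] := h.
have -> : (fun t => \int[mu n]_y f t y) = cst (\int[mu n]_y psi y).
  apply/funext => t /=.
  have := Rintegral_affine (t *: ei R i) (oner_neq0 R) mpsi.
  rewrite normr1 expr1n invr1 mul1r => <-.
  by apply: eq_Rintegral => y _; rewrite fE.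
rewrite derive_cst => E; rewrite [RHS]E.
by apply: eq_Rintegral => y _; rewrite /f' scale0r add0r.
Qed.

End parts.

Section schwartz_ft.
Variables (R : realType) (n : nat).
Local Notation V := 'rV[R]_n.
Implicit Types (phi : V -> R).

Lemma is_derive_dot (x y v : V) (alpha : R) :
  is_derive x v (fun z => dotR z y + alpha) (dotR v y).
Proof.
apply/is_derive_line0.
have -> : (fun s : R => dotR (s *: v + x) y + alpha) = (fun s => dotR v y * s + (dotR x
  y + alpha)).
  by apply/funext => s; rewrite dotRDl dotRZl mulrC addrA.
have h := is_deriveD_fun (is_deriveZ_fun (dotR v y) (is_derive_id (0 : R) (1 : R)))
  (is_derive_cst_fun (0 : R) (1 : R) (dotR x y + alpha)).
by apply: is_derive_eq h _; rewrite mulr1 addr0.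
Qed.

Lemma is_derive_cos_dot (x y v : V) (alpha : R) :
  is_derive x v (fun z => cos (dotR z y + alpha)) (dotR v y * cos (dotR x y + alpha +
    pi / 2)).
Proof.
have h := is_derive_comp (F := fun z : V => dotR z y + alpha) (x := x)
    (is_derive_cos (dotR x y + alpha)) (is_derive_dot x y v alpha).
by apply: is_derive_eq h _; rewrite cosDpihalf; ring.
Qed.

Lemma is_derive_ft phi alpha (x : V) i : schwartz phi ->
  is_derive x (ei R i) (ft alpha phi) (ft (alpha + pi / 2) (fun xi => xi ord0 i * phi
    xi) x).
Proof.
move=> sphi; have [mphi _ iphi] := schwartz_nice sphi.
have sxphi := schwartz_coord i sphi; have [mxphi _ ixphi] := schwartz_nice sxphi.
apply/is_derive_line0.
pose f (t : R) (xi : V) := phi xi * cos (dotR (t *: ei R i + x) xi + alpha).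
pose f' (t : R) (xi : V) := xi ord0 i * phi xi * cos (dotR (t *: ei R i + x) xi +
  (alpha + pi / 2)).
have -> : ft (alpha + pi / 2) (fun xi => xi ord0 i * phi xi) x = \int[mu n]_xi f' 0 xi.
  by apply: eq_Rintegral => xi _; rewrite /f' scale0r add0r.
apply: (@is_derive_under_integral _ _ R (mu n) f f' (fun xi => `|xi ord0 i * phi xi|)
  (-1) 1).
- by rewrite ltrN10 ltr01.
- by move=> t _; exact: integrable_ft_integrand.
- move=> t xi _.
  apply: (is_derive_line (fun z => phi xi * cos (dotR z xi + alpha)) x (ei R i) t _).1.
  have h := is_deriveZ_fun (phi xi) (is_derive_cos_dot (t *: ei R i + x) xi (ei R i)
    alpha).
  by apply: is_derive_eq h _; rewrite /f' (dotRC (ei R i)) dotR_ei addrA; ring.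
- by move=> t xi _; rewrite normrM ler_piMr// norm_cos_le1.
- exact: integrable_norm.
Qed.

(** Integration by parts: the derivative of [phi] times the cosine with phase [alpha - pi / 2] has
    integral [0]. The phase is chosen so that differentiating the cosine gives [x_i] times the one
    with phase [alpha]; the sign of the other term turns [- pi / 2] into [+ pi / 2]. *)
Lemma coord_ft phi alpha (x : V) i : schwartz phi ->
  x ord0 i * ft alpha phi x = ft (alpha + pi / 2) (fun xi => derive phi xi (ei R i)) x.
Proof.
move=> sphi; have [mphi _ iphi] := schwartz_nice sphi.
have sdphi := schwartz_derive i sphi; have [mdphi _ idphi] := schwartz_nice sdphi.
pose psi xi := phi xi * cos (dotR xi x + (alpha - pi / 2)).
pose psi' xi := phi xi * (x ord0 i * cos (dotR xi x + alpha)) +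
   derive phi xi (ei R i) * cos (dotR xi x + (alpha - pi / 2)).
have ipsi : (mu n).-integrable setT (EFin \o psi).
  apply: eq_integrable (integrable_ft_integrand iphi (alpha - pi / 2) x) => // xi _.
  by rewrite /= dotRC.
have dpsi xi : is_derive xi (ei R i) psi (psi' xi).
  have h := is_deriveM_fun (schwartz_is_derive xi i sphi)
     (is_derive_cos_dot xi x (ei R i) (alpha - pi / 2)).
  apply: is_derive_eq h _; rewrite /psi' (dotRC (ei R i)) dotR_ei.
  by rewrite -addrA subrK.
have [C hC] := schwartz_weight sphi; have [C' hC'] := schwartz_weight sdphi.
have bpsi xi : `|psi' xi| <= (`|x ord0 i| * C + C') * weight xi.
  rewrite /psi'; apply: le_trans (ler_normD _ _) _; rewrite [leRHS]mulrDl; apply: lerD.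
    rewrite normrM normrM mulrCA -mulrA ler_wpM2l//.
    by apply: le_trans (hC xi); rewrite ler_piMr// norm_cos_le1.
  by rewrite normrM; apply: le_trans (hC' xi); rewrite ler_piMr// norm_cos_le1.
have := Rintegral_derive0 ipsi dpsi bpsi.
have i1 : (mu n).-integrable setT (EFin \o (fun xi => phi xi * (x ord0 i * cos (dotR xi
  x + alpha)))).
  apply: eq_integrable (RintegrableZ (x ord0 i) (integrable_ft_integrand iphi alpha x))
    => // xi _.
  by rewrite /= dotRC mulrCA.
have i2 : (mu n).-integrable setT (EFin \o (fun xi => derive phi xi (ei R i) * cos
  (dotR xi x + (alpha - pi / 2)))).
  apply: eq_integrable (integrable_ft_integrand idphi (alpha - pi / 2) x) => // xi _.
  by rewrite /= dotRC.
rewrite RintegralD// => /eqP; rewrite addr_eq0 => /eqP E.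
transitivity (\int[mu n]_xi (phi xi * (x ord0 i * cos (dotR xi x + alpha)))).
  have [mI _] := integrableP _ _ _ (integrable_ft_integrand iphi alpha x).
  rewrite -RintegralZ; last exact/measurable_EFinP.
  by apply: eq_Rintegral => xi _; rewrite dotRC mulrCA.
rewrite E -mulN1r -RintegralZ; last by apply/measurable_EFinP; exact: measurable_int i2.
apply: eq_Rintegral => xi _; rewrite dotRC addrA cosBpihalf addrA cosDpihalf; ring.
Qed.

(** Coinduction on the class of all transforms, with arbitrary phase, of Schwartz functions;
    [is_derive_ft] keeps it closed. For decay, [|x|] is at most the sum of the [|x_i|], and
    [coord_ft] trades each [x_i] for a derivative of [phi]. *)
Lemma schwartz_ft phi alpha : schwartz phi -> schwartz (ft alpha phi).
Proof.
move=> sphi.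
apply: (schwartz_coind (P := fun F => exists phi alpha, schwartz phi /\ F = ft alpha
  phi)); last by exists phi, alpha.
- move=> _ x [{sphi alpha}phi [alpha [sphi ->]]].
  pose M := \sum_(i < n) \int[mu n]_xi `|xi ord0 i * phi xi|.
  apply: (@box_continuous R n _ (fun i => ft (alpha + pi / 2) (fun xi => xi ord0 i *
    phi xi)) x 1 M ltr01).
    by move=> y i _; exact: is_derive_ft.
  move=> y i _; have [_ _ ixphi] := schwartz_nice (schwartz_coord i sphi).
  apply: le_trans (ft_bound ixphi _ _) _.
  by rewrite /M (bigD1 i)//= lerDl sumr_ge0// => j _; apply: Rintegral_ge0.
- move=> _ i [{sphi alpha}phi [alpha [sphi ->]]].
  exists (ft (alpha + pi / 2) (fun xi => xi ord0 i * phi xi)).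
    by exists (fun xi : V => xi ord0 i * phi xi), (alpha + pi / 2); split => //; exact:
      schwartz_coord.
  by move=> x; exact: is_derive_ft.
- move=> _ k [{sphi alpha}phi [alpha [sphi ->]]].
  elim: k phi alpha sphi => [|k IH] phi alpha sphi.
    have [_ _ iphi] := schwartz_nice sphi.
    by exists (\int[mu n]_xi `|phi xi|) => x; rewrite expr0 mul1r; exact: ft_bound.
  have /choice[C hC] : forall i : 'I_n, exists C, forall x,
      enorm x ^+ k * `|ft (alpha + pi / 2) (fun xi => derive phi xi (ei R i)) x| <= C.
    by move=> i; apply: IH; exact: schwartz_derive.
  exists (\sum_(i < n) C i) => x.
  apply: (@le_trans _ _ (\sum_(i < n) `|x ord0 i| * (enorm x ^+ k * `|ft alpha phi x|))).
    rewrite exprS -mulrA -mulr_suml ler_wpM2r ?enorm_le_sum//.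
    by rewrite mulr_ge0// exprn_ge0// enorm_ge0.
  apply: ler_sum => i _; apply: le_trans (hC i x).
  by rewrite mulrCA -normrM coord_ft.
Qed.

End schwartz_ft.

Section inversion.
Variables (R : realType) (n : nat).
Local Notation V := 'rV[R]_n.
Implicit Types (phi gam : V -> R).

Lemma schwartz_lipschitz phi : schwartz phi ->
  exists2 L, 0 <= L & forall x y, `|phi y - phi x| <= L * \sum_(i < n) `|y ord0 i - x
    ord0 i|.
Proof.
move=> sphi.
have /choice[M hM] : forall i : 'I_n, exists M, forall x, `|derive phi x (ei R i)| <= M.
  move=> i; have [C hC] := schwartz_decay 0 (schwartz_derive i sphi).
  by exists C => x; have := hC x; rewrite expr0 mul1r.
have M0 i : 0 <= M i by exact: le_trans (normr_ge0 _) (hM i 0).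
exists (\sum_i M i); first by apply: sumr_ge0.
move=> x y.
pose r := 1 + \sum_(i < n) `|x ord0 i - y ord0 i|.
have r0 : 0 < r by rewrite ltr_pwDl// sumr_ge0.
have hb : box x r y.
  move=> i; rewrite /r ltr_pwDl// (bigD1 i)//= lerDl sumr_ge0//.
apply: (@box_lipschitz R n phi (fun i z => derive phi z (ei R i)) x r) => //.
  by move=> z i _; exact: schwartz_is_derive.
move=> z i _; apply: le_trans (hM i z) _.
by rewrite (bigD1 i)//= lerDl sumr_ge0.
Qed.

Lemma schwartz_norm_coord_integrable phi i : schwartz phi ->
  (mu n).-integrable setT (EFin \o (fun x : V => `|x ord0 i| * `|phi x|)).
Proof.
move=> sphi; have [_ _ ix] := schwartz_nice (schwartz_coord i sphi).
have := integrable_norm ix; apply: eq_integrable => // x _ /=.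
by rewrite normrM.
Qed.

Lemma integrable_sumT (F : 'I_n -> V -> R) :
  (forall i, (mu n).-integrable setT (EFin \o F i)) ->
  (mu n).-integrable setT (EFin \o (fun x => \sum_(i < n) F i x)).
Proof.
move=> iF; elim: (index_enum _) => [|i s IH].
  apply: (@eq_integrable _ _ _ _ setT measurableT (cst 0%E)) => //.
    by move=> x _; rewrite /= big_nil.
  exact: integrable0.
apply: (@eq_integrable _ _ _ _ setT measurableT (EFin \o (fun x => F i x + \sum_(i <-
  s) F i x))) => //.
  by move=> x _; rewrite /= big_cons.
exact: RintegrableD.
Qed.

(** The Lipschitz bound on [phi] leaves the first moment of [W]. The constant [K] precedes [H], [t]
    and [y]: [H] may thus carry a cosine, and letting [t] tend to [-oo] costs nothing. *)
Lemma approx_identity phi (W : V -> R) : schwartz phi -> schwartz W -> exists K,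
  forall (H : V -> R) (t : R) (y : V), measurable_fun setT H -> (forall x, `|H x| <=
    `|W x|) ->
  `|\int[mu n]_u (phi (expR t *: u + y) * H u) - phi y * \int[mu n]_u H u| <= expR t * K.
Proof.
move=> sphi sW; have [L L0 hL] := schwartz_lipschitz sphi.
have [mphi [M hM] _] := schwartz_nice sphi.
have [mW _ iW] := schwartz_nice sW.
pose S (u : V) := \sum_(i < n) `|u ord0 i| * `|W u|.
have iS : (mu n).-integrable setT (EFin \o S).
  by apply: integrable_sumT => i; exact: schwartz_norm_coord_integrable.
exists (L * \int[mu n]_u S u) => H t y mH HW.
have iH : (mu n).-integrable setT (EFin \o H).
  by apply: (Rle_integrable mH HW); exact: integrable_norm.
have mphit : measurable_fun setT (fun u : V => phi (expR t *: u + y)).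
  exact: (measurable_fun_compT mphi (measurable_affine (expR t) y)).
have i1 := integrableMbounded mphit (fun=> hM _) iH.
rewrite -RintegralZ// -RintegralB//; last exact: RintegrableZ.
rewrite mulrA -RintegralZ; last by apply/measurable_EFinP; exact: measurable_int iS.
apply: Rintegral_norm_le.
- apply: measurable_funB; apply: measurable_funM => //.
- move=> u; rewrite -mulrBl normrM.
  apply: (@le_trans _ _ ((L * \sum_(i < n) `|(expR t *: u + y) ord0 i - y ord0 i|) *
    `|W u|)).
    by apply: ler_pM.
  have -> : \sum_(i < n) `|(expR t *: u + y) ord0 i - y ord0 i| = expR t * \sum_(i < n)
    `|u ord0 i|.
    rewrite mulr_sumr; apply: eq_bigr => i _.
    by rewrite !mxE addrK normrM gtr0_norm ?expR_gt0.
  by rewrite /S -mulr_suml le_eqVlt; apply/orP; left; apply/eqP; ring.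
- exact: RintegrableZ.
Qed.

Lemma eq0_of_expR_bound (x K : R) : (forall t, `|x| <= expR t * K) -> x = 0.
Proof.
move=> h; apply/eqP; rewrite -normr_le0 leNgt; apply/negP => x0.
have K0 : 0 < K by have := lt_le_trans x0 (h 0); rewrite expR0 mul1r.
(* At this [t] the bound reads [|x| <= |x| / 2]. *)
have := h (ln (`|x| / (2 * K))); rewrite lnK ?posrE ?divr_gt0 ?mulr_gt0//.
have -> : `|x| / (2 * K) * K = `|x| / 2 by field; rewrite gt_eqF.
by rewrite leNgt ltr_pdivrMr// ltr_pMr// ltr1n.
Qed.

(** The product of two cosines is the mean of the cosines of the difference and of the sum, so
    modulation becomes a mean of two translates. *)
Lemma ft_modulated gam t y xi : measurable_fun setT gam -> (mu n).-integrable setT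
  (EFin \o gam) ->
  ft 0 (fun x => gam (expR t *: x) * cos (dotR x y + 0)) xi =
  2^-1 * (expR (- (n%:R * t)) * ft 0 gam (expR (- t) *: (xi - y)) +
          expR (- (n%:R * t)) * ft 0 gam (expR (- t) *: (xi + y))).
Proof.
move=> mg ig.
have igt : (mu n).-integrable setT (EFin \o (fun x : V => gam (expR t *: x))).
  have := integrable_affine 0 (expR_neq0 t) ig.
  by apply: eq_integrable => // x _ /=; rewrite addr0.
rewrite -!ft_dilate// /ft -RintegralD//; try exact: integrable_ft_integrand.
rewrite -RintegralZ; last first.
  have mI z : measurable_fun setT (fun x : V => gam (expR t *: x) * cos (dotR z x + 0)).
    by apply/measurable_EFinP; exact: measurable_int (integrable_ft_integrand igt 0 z).
  exact: measurable_funD (mI _) (mI _).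
apply: eq_Rintegral => x _; rewrite !addr0 !dotRDl dotRNl cosB cosD (dotRC y x) (dotRC
  xi x).
by field.
Qed.

Section fixed.
Variables (phi gam : V -> R).
Hypotheses (sphi : schwartz phi) (sgam : schwartz gam).
Hypotheses (ephi : forall x, phi (- x) = phi x) (gam0 : gam 0 = 1).

Let Gam := ft 0 gam.
Let kap := \int[mu n]_x Gam x.

(* Damp the outer integral by [gam (e^t x)] and let [t -> -oo]: by the multiplication
   formula the damped integral is a mean of [phi (e^t u + y)] and [phi (e^t u - y)]
   against [Gam u du]. *)
Lemma ft_ft_even y : ft 0 (ft 0 phi) y = (\int[mu n]_x ft 0 gam x) * phi y.
Proof.
rewrite -/Gam -/kap.
have sfphi := schwartz_ft 0 sphi; have sGam := schwartz_ft 0 sgam.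
have [K1 hK1] := approx_identity sgam sfphi.
have [K2 hK2] := approx_identity sphi sGam.
have [mphi [Mp hMp] iphi] := schwartz_nice sphi.
have [mgam [Mg hMg] igam] := schwartz_nice sgam.
have [mfphi _ ifphi] := schwartz_nice sfphi.
have [mGam _ iGam] := schwartz_nice sGam.
apply/eqP; rewrite -subr_eq0; apply/eqP.
apply: (@eq0_of_expR_bound _ (K1 + K2)) => t.
pose H x := ft 0 phi x * cos (dotR y x + 0).
have iH := integrable_ft_integrand ifphi 0 y.
have mH : measurable_fun setT H by apply/measurable_EFinP; exact: measurable_int iH.
pose It := \int[mu n]_x (gam (expR t *: x) * H x).
(* Here [gam] is the Lipschitz function, evaluated near [0] where its value is [1], and the
   transform of [phi] is the majorant of [H]. *)
have h1 : `|It - ft 0 (ft 0 phi) y| <= expR t * K1.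
  have := hK1 H t 0 mH; rewrite gam0 mul1r.
  under eq_Rintegral do rewrite addr0.
  by apply => x; rewrite normrM ler_piMr// norm_cos_le1.
have mgt : measurable_fun setT (fun x : V => gam (expR t *: x) * cos (dotR x y + 0)).
  apply: measurable_funM.
    by have [] := nice_dilate t (schwartz_nice sgam).
  apply: (measurableT_comp (@measurable_cos R)); apply: measurable_funD => //.
  exact: measurable_dotR.
have igt : (mu n).-integrable setT (EFin \o (fun x : V => gam (expR t *: x) * cos (dotR
  x y + 0))).
  have [_ _ igt'] := nice_dilate t (schwartz_nice sgam).
  apply: eq_integrable (integrable_ft_integrand igt' 0 y) => // x _.
  by rewrite /= dotRC.
pose J z := \int[mu n]_u (phi (expR t *: u + z) * Gam u).
(* Substituting [xi = e^t u + z] cancels the factor [e^(- n t)]. *)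
have Jz z : \int[mu n]_xi (phi xi * (expR (- (n%:R * t)) * Gam (expR (- t) *: (xi -
  z)))) = J z.
  pose F xi := phi xi * Gam (expR (- t) *: (xi - z)).
  have mF : measurable_fun setT F.
    apply: measurable_funM => //.
    have := measurable_fun_compT mGam (measurable_affine (expR (- t)) (- (expR (- t) *:
      z))).
    by under eq_fun do rewrite -scalerBr.
  have := Rintegral_affine z (expR_neq0 t) mF.
  rewrite gtr0_norm ?expR_gt0// -expRM_natl -expRN => E.
  transitivity (expR (- (n%:R * t)) * \int[mu n]_x F x).
    by rewrite -RintegralZ//; apply: eq_Rintegral => xi _; rewrite /F; ring.
  rewrite -E; apply: eq_Rintegral => u _; rewrite /F addrK scalerA.
  by rewrite -expRD addNr expR0 scale1r.
have ItE : It = 2^-1 * (J y + J (- y)).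
  transitivity (\int[mu n]_x (ft 0 phi x * (gam (expR t *: x) * cos (dotR x y + 0)))).
    by apply: eq_Rintegral => x _; rewrite /H dotRC; ring.
  rewrite -ft_mult//.
  have iG z : (mu n).-integrable setT (EFin \o (fun xi : V => phi xi * (expR (- (n%:R *
    t)) * Gam (expR (- t) *: (xi - z))))).
    apply: integrableMbounded hMp _ => //; apply: RintegrableZ.
    have := integrable_affine (- (expR (- t) *: z)) (expR_neq0 (- t)) iGam.
    by apply: eq_integrable => // xi _; rewrite /= -scalerBr.
  have iG' := iG (- y).
  rewrite -Jz -(Jz (- y)) -RintegralD//.
  rewrite -RintegralZ; last first.
    apply/measurable_EFinP; apply: measurable_int; exact: (RintegrableD (iG y) iG').
  apply: eq_Rintegral => xi _; rewrite ft_modulated// opprK -/Gam; ring.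
have h2 z : phi z = phi y -> `|J z - kap * phi y| <= expR t * K2.
  by move=> <-; rewrite mulrC; apply: hK2.
(* The translate by [- y] contributes [phi (- y)], which evenness identifies with [phi y]. *)
have h3 := h2 y erefl; have h4 := h2 (- y) (ephi y).
rewrite mulrDr.
have -> : ft 0 (ft 0 phi) y - kap * phi y =
  - (It - ft 0 (ft 0 phi) y) + (2^-1 * (J y - kap * phi y) + 2^-1 * (J (- y) - kap *
    phi y)).
  by rewrite ItE; field.
apply: le_trans (ler_normD _ _) _; rewrite normrN lerD//.
apply: le_trans (ler_normD _ _) _; rewrite !normrM ger0_norm ?invr_ge0//.
lra.
Qed.

End fixed.

Lemma Rintegral_gt0 (F : V -> R) x0 : nice F -> continuous F ->
  (forall x, 0 <= F x) -> F x0 != 0 -> 0 < \int[mu n]_x F x.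
Proof.
move=> [_ _ iF] cF F0 Fx0; rewrite lt_neqAle Rintegral_ge0// andbT eq_sym.
apply: contra_neq Fx0 => h; exact: integral0_continuous_eq0 iF F0 (cF x0) h.
Qed.

Lemma nice_sqr phi : schwartz phi -> nice (fun x => phi x * phi x).
Proof.
by move=> sphi; have nphi := schwartz_nice sphi; have [? ? _] := nphi; exact: niceM.
Qed.

Lemma sqr_continuous phi : schwartz phi -> continuous (fun x => phi x * phi x).
Proof. by move=> sphi x; have hc := @schwartz_continuous R n phi sphi x; exact: (cvgM
  hc hc). Qed.

(* No explicit transform is needed to see the sign of the constant:
   [int (gam^)^2 = const * int gam^2]. *)
Lemma ft_ft_const_gt0 gam : schwartz gam -> (forall x, gam (- x) = gam x) ->
  (forall x, 0 <= gam x) -> gam 0 = 1 -> 0 < \int[mu n]_x ft 0 gam x.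
Proof.
move=> sg eg g0 g1; set kap := (X in 0 < X).
have sG := schwartz_ft 0 sg.
have [mg [M hM] ig] := schwartz_nice sg; have [mG [MG hMG] iG] := schwartz_nice sG.
have E : \int[mu n]_x (ft 0 gam x * ft 0 gam x) = kap * \int[mu n]_x (gam x * gam x).
  rewrite -(ft_mult ig iG) -RintegralZ; last exact: measurable_funM.
  by apply: eq_Rintegral => x _; rewrite (ft_ft_even sg sg eg g1) -/kap; ring.
have sq0 (phi : V -> R) x : 0 <= phi x * phi x by rewrite -expr2 sqr_ge0.
have p1 : 0 < \int[mu n]_x (gam x * gam x).
  apply: (@Rintegral_gt0 _ 0 (nice_sqr sg) (sqr_continuous sg)) => //.
  by rewrite g1 mulr1 oner_eq0.
have p2 : 0 < \int[mu n]_x (ft 0 gam x * ft 0 gam x).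
  apply: (@Rintegral_gt0 _ 0 (nice_sqr sG) (sqr_continuous sG)) => //.
  rewrite -expr2 sqrf_eq0 gt_eqF// /ft.
  have -> : \int[mu n]_xi (gam xi * cos (dotR 0 xi + 0)) = \int[mu n]_xi gam xi.
    apply: eq_Rintegral => xi _.
    by rewrite addr0 -(scale0r 0) dotRZl mul0r cos0 mulr1.
  apply: (@Rintegral_gt0 _ 0 (schwartz_nice sg) (schwartz_continuous sg)) => //.
  by rewrite g1 oner_eq0.
by move: p2; rewrite E pmulr_lgt0.
Qed.

End inversion.

(** * Smoothness of the averages and cut-off functions *)

Section scaleint_smooth.
Variables (R : realType) (n : nat).
Local Notation V := 'rV[R]_n.
Local Notation leb := (@lebesgue_measure R).
Implicit Types (phi : V -> R).

(** For [t <= 0] boundedness of [phi] leaves [e^(a t)]; for [t > 0] decay of an order [k >= a + 1]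
    leaves at most [e^(- t)]. Uniformity over [delta <= |y|] is what differentiation under the
    integral sign requires. *)
Lemma schwartz_scale_bound phi (a delta : R) : schwartz phi -> 0 < a -> 0 < delta ->
  exists K, forall y t, delta <= enorm y ->
    `|expR (a * t) * phi (expR t *: y)| <= K * (oneDsqr t)^-1.
Proof.
move=> sphi a0 d0.
have [C0 hC0] := schwartz_decay 0 sphi.
pose k := (Num.truncn (a + 1)).+1.
have ak : a + 1 <= k%:R by apply: ltW; exact: truncnS_gt.
have [C1 hC1] := schwartz_decay k sphi.
have C00 : 0 <= C0 by apply: le_trans (hC0 0); rewrite mulr_ge0// exprn_ge0// enorm_ge0.
have C10 : 0 <= C1 by apply: le_trans (hC1 0); rewrite mulr_ge0// exprn_ge0// enorm_ge0.
pose b := Num.min a 1.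
have b0 : 0 < b by rewrite lt_min a0 ltr01.
have ba : b <= a by rewrite ge_min lexx.
have b1 : b <= 1 by rewrite ge_min lexx orbT.
have [C hC] := expR_decay b0.
pose K0 := C0 + C1 * delta ^- k.
have dk0 : 0 <= delta ^- k by rewrite invr_ge0 exprn_ge0// ltW.
have K00 : 0 <= K0 by rewrite addr_ge0// mulr_ge0.
exists (K0 * C) => y t dy.
apply: (@le_trans _ _ (K0 * expR (- (b * `|t|)))); last first.
  by rewrite -mulrA ler_wpM2l.
rewrite normrM (ger0_norm (expR_ge0 _)).
have [t0|t0] := leP t 0.
  rewrite mulrC ler_pM ?expR_ge0//.
    have := hC0 (expR t *: y); rewrite expr0 mul1r => /le_trans; apply.
    by rewrite lerDl mulr_ge0.
  by rewrite ler_expR ler0_norm// mulrN opprK ler_wnM2r.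
have e0 : 0 < expR t * delta by rewrite mulr_gt0// expR_gt0.
have hz : expR t * delta <= enorm (expR t *: y).
  by rewrite enormZ gtr0_norm ?expR_gt0// ler_wpM2l ?expR_ge0.
have h : `|phi (expR t *: y)| <= C1 * (expR t * delta) ^- k.
  rewrite ler_pdivlMr ?exprn_gt0// mulrC; apply: le_trans (hC1 (expR t *: y)).
  by rewrite ler_wpM2r// lerXn2r// nnegrE ?enorm_ge0// ltW.
apply: (@le_trans _ _ (expR (a * t) * (C1 * (expR t * delta) ^- k))).
  by rewrite ler_wpM2l ?expR_ge0.
have -> : expR (a * t) * (C1 * (expR t * delta) ^- k) =
    (C1 * delta ^- k) * expR ((a - k%:R) * t).
  rewrite exprMn invfM -expRM_natl -expRN mulrBl expRD.
  by rewrite [in RHS]mulrC; ring.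
apply: ler_pM; rewrite ?expR_ge0 ?mulr_ge0//.
  by rewrite lerDr.
rewrite ler_expR gtr0_norm// -mulNr; apply: ler_wpM2r; [exact: ltW|lra].
Qed.

Lemma scaleint_integrand_integrable phi (a : R) y : schwartz phi -> 0 < a -> y != 0 ->
  leb.-integrable setT (EFin \o (fun t => expR (a * t) * phi (expR t *: y))).
Proof.
move=> sphi a0 y0; have ey0 : 0 < enorm y by rewrite enorm_gt0.
have [K hK] := schwartz_scale_bound sphi a0 ey0.
have [mphi _ _] := schwartz_nice sphi.
apply: (@Rle_integrable _ _ R leb _ (fun t => K * (oneDsqr t)^-1)).
- exact: measurable_scaleint_integrand.
- by move=> t; exact: hK.
by apply: RintegrableZ; exact: integrable_oneDsqrV.
Qed.

Lemma scaleint_bound phi (a delta : R) : schwartz phi -> 0 < a -> 0 < delta ->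
  exists K, forall y, delta <= enorm y -> `|scaleint a phi y| <= K.
Proof.
move=> sphi a0 d0; have [K hK] := schwartz_scale_bound sphi a0 d0.
have [mphi _ _] := schwartz_nice sphi.
exists (\int[leb]_t (K * (oneDsqr t)^-1)) => y dy.
apply: Rintegral_norm_le; first exact: measurable_scaleint_integrand.
  by move=> t; exact: hK.
by apply: RintegrableZ; exact: integrable_oneDsqrV.
Qed.

(** Half the modulus of a nonzero coordinate serves both as radius of the box and as lower bound for
    the norm on it. *)
Lemma neq0_box (x : V) : x != 0 ->
  exists2 r, 0 < r & forall y, box x r y -> r <= enorm y.
Proof.
move=> x0; have [j xj] : exists j, x ord0 j != 0.
  apply/existsP; rewrite -negb_forall; apply: contra x0 => /forallP h.
  by apply/eqP/rowP => j; rewrite mxE; apply/eqP.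
exists (`|x ord0 j| / 2); first by rewrite divr_gt0// normr_gt0.
move=> y /(_ j) h; apply: le_trans (coord_le_enorm y j).
have := ler_normD (x ord0 j - y ord0 j) (y ord0 j); rewrite subrK.
lra.
Qed.

Lemma is_derive_dilate (F : V -> R) (c d : R) x v : is_derive (c *: x) v F d ->
  is_derive x v (fun y => F (c *: y)) (c * d).
Proof.
move=> /is_derive_line0 h; apply/is_derive_line0.
have -> : (fun s : R => F (c *: (s *: v + x))) =
    (fun s : R => F (s *: v + c *: x)) \o (fun s => c * s).
  by apply/funext => s /=; rewrite scalerDr scalerA.
rewrite mulrC; apply: is_derive1_comp; first by rewrite mulr0.
have h2 := is_deriveZ_fun c (is_derive_id (0 : R) (1 : R)).
by apply: is_derive_eq h2 _; rewrite mulr1.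
Qed.

(** The chain rule brings out the scale [e^s], which raises the exponent by one. Averages of
    Schwartz functions thus form a class closed under partial derivatives, to which
    [smooth_on_coind] applies. *)
Lemma is_derive_scaleint phi (a : R) x i : schwartz phi -> 0 < a -> x != 0 ->
  is_derive x (ei R i) (scaleint a phi)
    (scaleint (a + 1) (fun y => derive phi y (ei R i)) x).
Proof.
move=> sphi a0 x0; have [r r0 hr] := neq0_box x0.
have sd := schwartz_derive i sphi.
have a10 : 0 < a + 1 by rewrite addr_gt0.
have [K hK] := schwartz_scale_bound sd a10 r0.
have hb t : - r < t < r -> r <= enorm (t *: ei R i + x).
  move=> tr; have tr' : `|t| < r by rewrite ltr_norml.
  apply: hr => j; rewrite !mxE eqxx /= opprD addrCA subrr addr0 normrN.
  by case: (j == i); rewrite ?mulr1 ?mulr0 ?normr0.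
apply/is_derive_line0.
pose f (t s : R) := expR (a * s) * phi (expR s *: (t *: ei R i + x)).
pose f' (t s : R) := expR ((a + 1) * s) * derive phi (expR s *: (t *: ei R i + x)) (ei
  R i).
have -> : scaleint (a + 1) (fun y => derive phi y (ei R i)) x = \int[leb]_s f' 0 s.
  by apply: eq_Rintegral => s _; rewrite /f' scale0r add0r.
apply: (@is_derive_under_integral _ _ R leb f f' (fun s => K * (oneDsqr s)^-1) (- r) r).
- by rewrite oppr_lt0 r0.
- move=> t tr; apply: scaleint_integrand_integrable => //.
  by rewrite -enorm_gt0 (lt_le_trans r0)// hb.
- move=> t s _.
  apply: (is_derive_line (fun y => expR (a * s) * phi (expR s *: y)) x (ei R i) t _).1.
  have h := is_deriveZ_fun (expR (a * s))
    (is_derive_dilate (schwartz_is_derive (expR s *: (t *: ei R i + x)) i sphi)).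
  by apply: is_derive_eq h _; rewrite /f' mulrDl mul1r expRD mulrA.
- by move=> t s tr; apply: hK; exact: hb.
- by apply: RintegrableZ; exact: integrable_oneDsqrV.
Qed.

Lemma open_neq0 : open [set x : V | x != 0].
Proof.
have -> : [set x : V | x != 0] = ~` [set 0].
  by apply/seteqP; split => x /= /eqP.
by apply: closed_openC; apply: accessible_closed_set1; apply: hausdorff_accessible;
  exact: norm_hausdorff.
Qed.

Lemma smooth_on_scaleint phi (a : R) : schwartz phi -> 0 < a ->
  smooth_on [set x | x != 0] (scaleint a phi).
Proof.
move=> sphi a0.
apply: (smooth_on_coind (P := fun F => exists phi a, [/\ schwartz phi, 0 < a & F =
  scaleint a phi]) open_neq0);
  last by exists phi, a.
- move=> _ x [{sphi a0 a}phi [a [sphi a0 ->]]] /= x0.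
  have [r r0 hr] := neq0_box x0.
  have a10 : 0 < a + 1 by rewrite addr_gt0.
  have /choice[K hK] : forall i : 'I_n, exists K, forall y, r <= enorm y ->
      `|scaleint (a + 1) (fun y => derive phi y (ei R i)) y| <= K.
    by move=> i; apply: scaleint_bound => //; exact: schwartz_derive.
  have K0 i : 0 <= K i.
    apply: le_trans (normr_ge0 _) (hK i x (hr x _)) => j.
    by rewrite subrr normr0.
  apply: (@box_continuous R n _ (fun i => scaleint (a + 1) (fun y => derive phi y (ei R
    i))) x r (\sum_i K i)) => //.
    move=> y i hy; apply: is_derive_scaleint => //.
    by rewrite -enorm_gt0 (lt_le_trans r0)// hr.
  move=> y i hy; apply: le_trans (hK i y (hr _ hy)) _.
  by rewrite (bigD1 i)//= lerDl sumr_ge0.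
- move=> _ i [{sphi a0 a}phi [a [sphi a0 ->]]].
  exists (scaleint (a + 1) (fun y => derive phi y (ei R i))).
    exists (fun y => derive phi y (ei R i)), (a + 1); split => //; last by rewrite
      addr_gt0.
    exact: schwartz_derive.
  by move=> x x0; exact: is_derive_scaleint.
Qed.

Lemma smooth1_powR (s : R) : smooth1 [set t | 0 < t] (fun t : R => t `^ s).
Proof.
exists (fun k t => (\prod_(j < k) (s - j%:R)) * t `^ (s - k%:R)).
  by apply/funext => t; rewrite big_ord0 mul1r subr0.
move=> k t /= t0.
have h := is_deriveZ_fun (\prod_(j < k) (s - j%:R)) (is_derive1_powR (s - k%:R) t0).
apply: is_derive_eq h _; rewrite big_ord_recr /= mulrA; congr (_ * _ `^ _).
by rewrite -addrA -opprD -natr1.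
Qed.

Lemma enorm_powR (x : V) (s : R) : enorm x `^ s = (dotR x x) `^ (s / 2).
Proof. by rewrite -sqr_enorm -powR_mulrn ?enorm_ge0// -powRrM mulrC divfK. Qed.

Lemma smooth_on_enorm_powR (s : R) : smooth_on [set x : V | x != 0] (fun x => enorm x
  `^ s).
Proof.
have -> : (fun x : V => enorm x `^ s) = (fun x => (dotR x x) `^ (s / 2)).
  by apply/funext => x; exact: enorm_powR.
apply: (smooth_on_comp open_neq0 (smooth1_powR (s / 2))).
  by move=> x /= x0; rewrite lt_neqAle dotR_ge0 andbT eq_sym dotR_eq0.
exact: (smooth_on_dotR open_neq0).
Qed.

Lemma scaleint_even phi a x : (forall y, phi (- y) = phi y) ->
  scaleint a phi (- x) = scaleint a phi x.
Proof. by move=> ephi; apply: eq_Rintegral => t _; rewrite scalerN ephi. Qed.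

Lemma scaleint_radproj phi a x : measurable_fun setT phi -> x != 0 ->
  scaleint a phi (radproj x) = enorm x `^ a * scaleint a phi x.
Proof.
move=> mphi x0; have e0 : (enorm x == 0) = false by rewrite gt_eqF// enorm_gt0.
rewrite -{3}(expR_ln_enorm x0) scaleint_homo// mulrA.
by rewrite /powR e0 -expRD subrr expR0 mul1r.
Qed.

Lemma Ce_scaleint phi a : schwartz phi -> (forall y, phi (- y) = phi y) -> 0 < a ->
  Ce (scaleint a phi).
Proof.
move=> sphi ephi a0; split; first by move=> x _; exact: scaleint_even.
have [mphi _ _] := schwartz_nice sphi.
apply: (smooth_on_eq open_neq0 (F := fun x => enorm x `^ a * scaleint a phi x)).
  by move=> x /= x0; rewrite scaleint_radproj.
apply: smooth_onM; first exact: open_neq0.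
  exact: smooth_on_enorm_powR.
exact: smooth_on_scaleint.
Qed.

Lemma CeZ (c : R) (F : V -> R) : Ce F -> Ce (fun x => c * F x).
Proof.
move=> [eF sF]; split; first by move=> x sx; rewrite eF.
by apply: smooth_onM => //; [exact: open_neq0|apply: smooth_on_cst; exact: open_neq0].
Qed.

Lemma CeD (F G : V -> R) : Ce F -> Ce G -> Ce (fun x => F x + G x).
Proof.
move=> [eF sF] [eG sG]; split; first by move=> x sx; rewrite eF// eG.
by apply: smooth_onD => //; exact: open_neq0.
Qed.

End scaleint_smooth.

(** * A bump function, cut-offs and the inversion constant *)

Section flat.
Variable R : realType.

Definition flat (t : R) : R := if 0 < t then expR (- t^-1) else 0.

(* The [k]-th derivative of [e^(-1/t)] is [flat_poly k] at [1/t] times [e^(-1/t)]. *)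
Fixpoint flat_poly (k : nat) : {poly R} :=
  if k is k'.+1 then 'X^2 * (flat_poly k' - (flat_poly k')^`()) else 1.

Definition flat_deriv (k : nat) (t : R) : R :=
  if 0 < t then (flat_poly k).[t^-1] * expR (- t^-1) else 0.

(** The rate [c] is arbitrary because each degree spends half of it, through
    [y <= (2 / c) e^(c y / 2)]. *)
Lemma poly_expR_bound (p : {poly R}) (c : R) : 0 < c ->
  exists2 C, 0 <= C & forall y, 0 <= y -> `|p.[y]| <= C * expR (c * y).
Proof.
elim/poly_ind: p c => [|p b IH] c c0.
  by exists 0 => // y _; rewrite horner0 normr0 mul0r.
have c20 : 0 < c / 2 by rewrite divr_gt0.
have [C C0 hC] := IH _ c20.
exists (C * (2 / c) + `|b|) => [|y y0].
  by rewrite addr_ge0// mulr_ge0// divr_ge0// ltW.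
rewrite hornerMXaddC; apply: le_trans (ler_normD _ _) _; rewrite [leRHS]mulrDl.
apply: lerD; last first.
  rewrite ler_peMr//; have := @expR_ge1Dx R (c * y).
  by have : 0 <= c * y by [rewrite mulr_ge0// ltW]; lra.
rewrite normrM (ger0_norm y0).
have h1 : y <= 2 / c * expR (c / 2 * y).
  have h := @expR_ge1Dx R (c / 2 * y).
  apply: (@le_trans _ _ (2 / c * (c / 2 * y))).
    by rewrite le_eqVlt; apply/orP; left; apply/eqP; field; rewrite gt_eqF.
  apply: ler_wpM2l; [by rewrite divr_ge0// ltW|lra].
apply: (le_trans (ler_pM _ _ (hC y y0) h1)) => //.
rewrite le_eqVlt; apply/orP; left; apply/eqP.
have -> : expR (c * y) = expR (c / 2 * y) * expR (c / 2 * y).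
  by rewrite -expRD; congr expR; field.
ring.
Qed.

Lemma is_derive_flat0 k : is_derive (0 : R) 1 (flat_deriv k) 0.
Proof.
have [C C0 hC] := poly_expR_bound ('X^2 * flat_poly k) ltr01.
(* The polynomial bounded above carries an extra ['X^2]: one power of [1/h] is the difference
   quotient, the other buys the factor [|h|]. *)
have bnd h : `|h^-1 * flat_deriv k h| <= C * `|h|.
  rewrite /flat_deriv; case: ifPn => [h0|_]; last by rewrite mulr0 normr0 mulr_ge0.
  have y0 : 0 <= h^-1 by rewrite invr_ge0 ltW.
  have := hC _ y0; rewrite hornerM hornerXn mul1r => hh.
  have -> : h^-1 * ((flat_poly k).[h^-1] * expR (- h^-1)) =
     h * ((h^-1 ^+ 2 * (flat_poly k).[h^-1]) * expR (- h^-1)).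
    by field; rewrite gt_eqF.
  rewrite normrM mulrC ler_wpM2r// normrM (ger0_norm (expR_ge0 _)) expRN.
  by rewrite ler_pdivrMr ?expR_gt0.
have C1 : 0 < C + 1 by rewrite ltr_pwDr.
have cvg0 : (fun h : R => h^-1 *: ((flat_deriv k \o shift 0) (h *: (1 : R)) -
  flat_deriv k 0)) @ 0^' --> (0 : R).
  apply/cvgrPdist_lt => e e0; near=> h.
  rewrite sub0r normrN /= addr0 [h *: 1]mulr1 {2}/flat_deriv ltxx subr0.
  apply: le_lt_trans (bnd h) _.
  apply: (@le_lt_trans _ _ ((C + 1) * `|h|)); first by rewrite ler_wpM2r// lerDl.
  rewrite mulrC -ltr_pdivlMr//; near: h; apply: dnbhs0_lt; exact: (divr_gt0 e0 C1).
split; first by apply/cvg_ex; exists 0.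
exact: (cvg_lim _ cvg0).
Unshelve. all: by end_near. Qed.

Lemma smooth1_flat : smooth1 setT flat.
Proof.
exists flat_deriv.
  by apply/funext => t; rewrite /flat_deriv /flat hornerC mul1r.
move=> k t _; have [t0|t0|->] := ltgtP t 0.
- apply: (@near_eq_is_derive _ _ _ (cst 0)).
    near=> s; rewrite /flat_deriv ifN// -leNgt ltW//; near: s; exact: lt_nbhsl.
  have -> : flat_deriv k.+1 t = 0 by rewrite /flat_deriv ifN// -leNgt ltW.
  exact: is_derive_cst.
- have tn0 : t != 0 by rewrite gt_eqF.
  have hi : is_derive t 1 (fun s : R => s^-1) (- t ^- 2).
    by apply: is_derive_eq (is_deriveV tn0 (is_derive_id t (1 : R))) _; rewrite [_ *:
      _]mulr1.
  have hp := is_derive_comp (u := horner (flat_poly k)) (F := fun s : R => s^-1) (x := t)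
    (is_derive_poly (flat_poly k) t^-1) hi.
  have hn := is_deriveZ_fun (-1) hi.
  have he := is_derive_comp (u := expR) (F := fun s : R => -1 * s^-1) (x := t)
    (is_derive_expR (-1 * t^-1)) hn.
  have h := is_deriveM_fun hp he.
  have H : is_derive t (1 : R) (fun s : R => (flat_poly k).[s^-1] * expR (-1 * s^-1))
      (flat_deriv k.+1 t).
    apply: is_derive_eq h _; rewrite /flat_deriv t0 /= hornerM hornerXn hornerD hornerN.
    by rewrite !mulN1r; field; exact: tn0.
  apply: near_eq_is_derive H.
  near=> s; rewrite /flat_deriv ifT ?mulN1r//; near: s; exact: lt_nbhsr.
- have -> : flat_deriv k.+1 0 = 0 by rewrite /flat_deriv ltxx.
  exact: is_derive_flat0.
Unshelve. all: by end_near. Qed.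

Lemma flat_ge0 t : 0 <= flat t.
Proof. by rewrite /flat; case: ifP => // _; exact: expR_ge0. Qed.

Lemma flat_gt0 t : 0 < t -> 0 < flat t.
Proof. by move=> t0; rewrite /flat t0 expR_gt0. Qed.

Lemma flat_eq0 t : t <= 0 -> flat t = 0.
Proof. by move=> t0; rewrite /flat ifN// -leNgt. Qed.

Lemma continuous_flat : continuous flat.
Proof.
have [w <- hw] := smooth1_flat => t.
exact: is_derive1_continuous (hw 0%N t I).
Qed.

(** Evaluated at the polynomial [dotR x x], it needs no square root to be smooth; vanishing up to
    [1], it hides whatever [F (radproj x)] does near the origin. *)
Definition chi (t : R) : R := flat (t - 1) * flat (4 - t).

Lemma chi_ge0 t : 0 <= chi t.
Proof. by rewrite mulr_ge0// flat_ge0. Qed.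

Lemma chi_eq0l t : t <= 1 -> chi t = 0.
Proof. by move=> t1; rewrite /chi flat_eq0 ?mul0r// subr_le0. Qed.

Lemma chi_eq0r t : 4 <= t -> chi t = 0.
Proof. by move=> t1; rewrite /chi [flat (4 - t)]flat_eq0 ?mulr0// subr_le0. Qed.

Lemma chi_gt0 t : 1 < t < 4 -> 0 < chi t.
Proof. by move=> /andP[t1 t4]; rewrite mulr_gt0// flat_gt0// subr_gt0. Qed.

Lemma continuous_chi : continuous chi.
Proof.
move=> t; apply: cvgM.
  apply: (cvg_comp (fun t : R => t - 1) flat _ (@continuous_flat _)).
  by apply: cvgB; [exact: cvg_id|exact: cvg_cst].
apply: (cvg_comp (fun t : R => 4 - t) flat _ (@continuous_flat _)).
by apply: cvgB; [exact: cvg_cst|exact: cvg_id].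
Qed.

End flat.

Section compact_support.
Variables (R : realType) (n : nat).
Local Notation V := 'rV[R]_n.

Lemma continuous_dotR : continuous (fun x : V => dotR x x).
Proof. by move=> x; apply: (smooth_on_continuous (smooth_on_dotR (openT : open [set:
  V]))). Qed.

Lemma open_dotR_lt (c : R) : open [set x : V | dotR x x < c].
Proof.
have := @continuous_dotR => /continuousP /(_ _ (@open_lt R c)); exact.
Qed.

Lemma open_dotR_gt (c : R) : open [set x : V | c < dotR x x].
Proof.
have := @continuous_dotR => /continuousP /(_ _ (@open_gt R c)); exact.
Qed.

Lemma continuous_ball_bounded (F : V -> R) (c : R) : continuous F ->
  exists M, forall x, dotR x x <= c -> `|F x| <= M.
Proof.
move=> cF; pose A := [set x : V | dotR x x <= c].
have cA : compact A.
  apply: bounded_closed_compact.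
    exists (`|c| + 1); split; first exact: num_real.
    move=> M hM x /= hx; apply: le_trans (ltW hM).
    rewrite [leLHS]/Num.Def.normr /= mx_normrE; apply/bigmax_leP; split => [|[i j] _ /=].
      by rewrite addr_ge0.
    rewrite ord1; have h := coord_le_enorm x j.
    have h2 : `|x ord0 j| ^+ 2 <= `|c|.
      apply: (@le_trans _ _ (enorm x ^+ 2)); first by rewrite lerXn2r// ?nnegrE
        ?enorm_ge0.
      by rewrite sqr_enorm (le_trans hx)// ler_norm.
    move: (`|x ord0 j|) h2 (normr_ge0 (x ord0 j)) => s h2 s0; nra.
  have -> : A = ~` [set x : V | c < dotR x x].
    by apply/seteqP; split => x /=; rewrite /A /= leNgt => /negP.
  by apply: open_closedC; exact: open_dotR_gt.
have : compact (F @` A).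
  by apply: continuous_compact => //; exact: continuous_subspaceT.
move=> /compact_bounded [M [_ hM]].
by exists (M + 1) => x Ax; apply: (hM (M + 1)); [rewrite ltrDl|exists x].
Qed.

Lemma schwartz_compact_support (F : V -> R) (c : R) : 0 <= c -> smooth_on setT F ->
  (forall x, c < dotR x x -> F x = 0) -> schwartz F.
Proof.
move=> c0 sF F0; split => // l k.
have cl : continuous (pderiv l F) by move=> x; have [_] := sF l x I.
have [M hM] := continuous_ball_bounded c cl.
have M0 : 0 <= M by apply: le_trans (normr_ge0 _) (hM 0 _); rewrite -sqr_enorm enorm0
  expr0n.
exists (Num.sqrt c ^+ k * M) => x.
have [xc|xc] := leP (dotR x x) c.
  rewrite ler_pM ?exprn_ge0 ?enorm_ge0//; last exact: hM.
  by rewrite lerXn2r ?nnegrE ?enorm_ge0 ?sqrtr_ge0// ler_sqrt.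
rewrite (@smooth_on_pderiv0 R n [set x | c < dotR x x] F (@open_dotR_gt c) F0 l x xc)
  normr0 mulr0.
by rewrite mulr_ge0// exprn_ge0// sqrtr_ge0.
Qed.

Definition cutoff (F : V -> R) (x : V) : R := F (radproj x) * chi (dotR x x).

Lemma smooth1_setT_comp (U : set V) (u : R -> R) F : open U -> smooth1 setT u ->
  smooth_on U F -> smooth_on U (fun x => u (F x)).
Proof. by move=> oU su; apply: (smooth_on_comp oU su). Qed.

Lemma smooth_on_chi (U : set V) : open U -> smooth_on U (fun x => chi (dotR x x)).
Proof.
move=> oU; apply: smooth_onM => //; apply: smooth1_setT_comp => //.
- exact: smooth1_flat.
- by apply: smooth_onD => //; [exact: smooth_on_dotR|exact: smooth_on_cst].
- exact: smooth1_flat.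
- apply: smooth_onD => //; first exact: smooth_on_cst.
  apply: (smooth_on_eq oU (F := fun x => -1 * dotR x x)).
    by move=> x _; rewrite mulN1r.
  by apply: smooth_onM => //; [exact: smooth_on_cst|exact: smooth_on_dotR].
Qed.

(** Two open sets cover the space: the complement of the origin, and the open unit ball, on which
    [F] is zero. *)
Lemma schwartz_annulus (F : V -> R) : smooth_on [set x | x != 0] F ->
  (forall x, dotR x x < 1 -> F x = 0) -> (forall x, 4 < dotR x x -> F x = 0) ->
  schwartz F.
Proof.
move=> sF F1 F4; apply: (@schwartz_compact_support _ 4) => //.
apply: (@smooth_on_subset _ _ _ ([set x | x != 0] `|` [set x | dotR x x < 1])).
  move=> x _; have [->|x0] := eqVneq x 0; last by left.
  by right; rewrite /= -sqr_enorm enorm0 expr0n.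
apply: smooth_onU => //.
apply: (@smooth_on_eq R n [set x | dotR x x < 1] (@open_dotR_lt 1) (fun=> 0)).
  by move=> x /= x1; rewrite F1.
by apply: smooth_on_cst; exact: (@open_dotR_lt 1).
Qed.

Lemma cutoff_eq0l F x : dotR x x <= 1 -> cutoff F x = 0.
Proof. by move=> x1; rewrite /cutoff chi_eq0l ?mulr0. Qed.

Lemma cutoff_eq0r F x : 4 <= dotR x x -> cutoff F x = 0.
Proof. by move=> x4; rewrite /cutoff chi_eq0r ?mulr0. Qed.

Lemma schwartz_cutoff_pow F (s : R) : Ce F ->
  schwartz (fun x => enorm x `^ s * cutoff F x).
Proof.
move=> [_ sF]; apply: schwartz_annulus.
- apply: smooth_onM; [exact: open_neq0|exact: smooth_on_enorm_powR|].
  apply: smooth_onM => //; first exact: open_neq0.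
  by apply: smooth_on_chi; exact: open_neq0.
- by move=> x /ltW x1; rewrite cutoff_eq0l// mulr0.
- by move=> x /ltW x4; rewrite cutoff_eq0r// mulr0.
Qed.

Lemma schwartz_cutoff F : Ce F -> schwartz (cutoff F).
Proof.
move=> /(schwartz_cutoff_pow 0); congr schwartz.
by apply/funext => x; rewrite powRr0 mul1r.
Qed.

Lemma cutoff_even F x : Ce F -> cutoff F (- x) = cutoff F x.
Proof.
move=> [eF _]; rewrite /cutoff dotRNl (dotRC x) dotRNl opprK radprojN.
have [->|x0] := eqVneq x 0; first by rewrite radproj0 oppr0.
by rewrite eF//; exact: enorm_radproj.
Qed.

(** It takes the place of the usual Gaussian: damping needs an even nonnegative Schwartz function
    with value [1] at the origin, and its transform is never computed. *)
Definition gauge (x : V) : R := flat (1 - dotR x x) / flat 1.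

Lemma schwartz_gauge : schwartz gauge.
Proof.
apply: (@schwartz_compact_support _ 1) => //; last first.
  by move=> x x1; rewrite /gauge flat_eq0 ?mul0r// subr_le0 ltW.
apply: smooth_onM; [exact: openT| |by apply: smooth_on_cst; exact: openT].
apply: smooth1_setT_comp; [exact: openT|exact: smooth1_flat|].
apply: smooth_onD; [exact: openT|by apply: smooth_on_cst; exact: openT|].
apply: (smooth_on_eq openT (F := fun x => -1 * dotR x x)).
  by move=> x _; rewrite mulN1r.
by apply: smooth_onM; [exact: openT|apply: smooth_on_cst; exact: openT|apply:
  smooth_on_dotR; exact: openT].
Qed.

Lemma ft_inversion : exists2 k : R, 0 < k &
  forall (phi : V -> R) y, schwartz phi -> (forall x, phi (- x) = phi x) ->
    ft 0 (ft 0 phi) y = k * phi y.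
Proof.
have sg := schwartz_gauge.
have f1 : 0 < flat (1 : R) by exact: flat_gt0.
have g0 : gauge 0 = 1.
  by rewrite /gauge -sqr_enorm enorm0 expr0n subr0 divff// gt_eqF.
exists (\int[mu n]_x ft 0 gauge x).
  apply: ft_ft_const_gt0 => //.
    by move=> x; rewrite /gauge dotRNl (dotRC x) dotRNl opprK.
  by move=> x; rewrite divr_ge0// flat_ge0.
by move=> phi y sphi ephi; exact: ft_ft_even.
Qed.

End compact_support.

(** * The operator T_q *)

Section mellin.
Variable R : realType.
Local Notation leb := (@lebesgue_measure R).

Lemma powR_expR (t s : R) : expR t `^ s = expR (s * t).
Proof. by rewrite /powR gt_eqF ?expR_gt0// expRK. Qed.

Lemma flat_le (t : R) : 1 <= t -> flat 1 <= flat t.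
Proof.
move=> t1; have t0 : 0 < t by exact: lt_le_trans t1.
rewrite /flat ltr01 t0 ler_expR lerN2 invr1 invf_le1//.
Qed.

(** The constant [c_b], that is the integral of [s^(b-1) chi (s^2)] over [s > 0], with [s = e^t]. *)
Definition mellin_chi (b : R) : R := \int[leb]_t (expR (b * t) * chi (expR t ^+ 2)).

Lemma Ce_cst n (c : R) : Ce (fun _ : 'rV[R]_n => c).
Proof. by split => //; apply: smooth_on_cst; exact: open_neq0. Qed.

Lemma mellin_chi_gt0 b : 0 < b -> 0 < mellin_chi b.
Proof.
(* In dimension one with [y] a unit vector, [chi (e^(2t))] is the cut-off of the constant [1] at
   [e^t y]; integrability is then an instance of the one for averages. *)
move=> b0; pose y := ei R (ord0 : 'I_1).
have ey : dotR y y = 1 by rewrite dotR_ei mxE !eqxx.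
have y0 : y != 0 by rewrite -dotR_eq0 ey oner_eq0.
have := scaleint_integrand_integrable (schwartz_cutoff (Ce_cst 1 1)) b0 y0.
rewrite [X in EFin \o X](_ : _ = (fun t => expR (b * t) * chi (expR t ^+ 2))); last first.
  by apply/funext => t; rewrite /cutoff mul1r dotRZl dotRZr ey mulr1 expr2.
(* On [B] the number [e^(2t)] lies between [2] and [3], so both factors of [chi] are at least
   [flat 1]. *)
move=> iF; pose B : set (measurableTypeR R) := `[ln 2 / 2, ln 3 / 2]%classic.
have l23 : ln 2 < ln 3 :> R by rewrite ltr_ln ?posrE//; lra.
have l2 : 0 <= ln 2 :> R by rewrite ln_ge0//; lra.
have B0 : (0 < leb B)%E.
  rewrite /B lebesgue_measure_itv/= lte_fin ltr_pM2r ?invr_gt0// l23 -EFinB lte_fin.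
  by rewrite subr_gt0 ltr_pM2r ?invr_gt0.
have e0 : 0 < flat 1 ^+ 2 :> R by rewrite exprn_gt0// flat_gt0.
apply: (@Rintegral_gt0_set _ _ R leb _ B _ _ B0 e0 _ _ iF).
- exact: measurable_itv.
- by move=> t; rewrite mulr_ge0 ?expR_ge0 ?chi_ge0.
- move=> t; rewrite /B /= in_itv/= => /andP[t1 t2].
  have t0 : 0 <= t by apply: le_trans t1; rewrite divr_ge0.
  have s1 : 2 <= expR t ^+ 2.
    rewrite -expRM_natl -[leLHS](@lnK R)// ?posrE// ler_expR.
    by move: t1; rewrite ler_pdivrMr// mulrC.
  have s2 : expR t ^+ 2 <= 3.
    rewrite -expRM_natl -[leRHS](@lnK R)// ?posrE// ler_expR.
    by move: t2; rewrite ler_pdivlMr// mulrC.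
  apply: (@le_trans _ _ (1 * chi (expR t ^+ 2))).
    rewrite mul1r /chi expr2 ler_pM ?flat_ge0// flat_le//; lra.
  rewrite ler_wpM2r ?chi_ge0//.
  by apply: le_trans (expR_ge1Dx _); rewrite lerDl mulr_ge0// ltW.
Qed.

(** The Mellin transform at [s] of [r^s] cut off at [r = 1], which is [1 / (2 s)] for [s > 0]. The
    unsimplified form is the one that [scaleint_radial] produces. *)
Definition mellin_unit (s : R) : R :=
  \int[leb]_t (expR (s * t) * (expR t `^ s * \1_(`]-oo, 1]%classic) (expR t))).

Lemma mellin_unit_gt0 s : 0 < s -> 0 < mellin_unit s.
Proof.
move=> s0.
have s20 : 0 < s + s by rewrite addr_gt0.
have E (t : R) : expR (s * t) * (expR t `^ s * \1_(`]-oo, 1]%classic) (expR t)) =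
   if t <= 0 then expR ((s + s) * t) else 0.
  rewrite powR_expR indicE mem_setE in_itv/= -[X in _ <= X]expR0 ler_expR.
  by case: ifP => _; rewrite ?mulr0// mulr1 -expRD mulrDl.
have mE : measurable_fun setT (fun t : R => expR (s * t) * (expR t `^ s * \1_(`]-oo,
  1]%classic) (expR t))).
  apply: measurable_funM; first exact: measurable_expRM.
  apply: measurable_funM.
    exact: (measurableT_comp (@measurable_powR R s) (@measurable_expR R)).
  apply: (measurableT_comp _ (@measurable_expR R)).
  by apply: measurable_indic; exact: measurable_itv.
have [C hC] := expR_decay s20.
have iF : leb.-integrable setT (EFin \o (fun t : R => expR (s * t) * (expR t `^ s *
  \1_(`]-oo, 1]%classic) (expR t)))).
  apply: (@Rle_integrable _ _ R leb _ (fun t => C * (oneDsqr t)^-1)) => //.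
    move=> t; rewrite E; apply: le_trans (hC t).
    case: ifP => t0; last by rewrite normr0 expR_ge0.
    by rewrite ger0_norm ?expR_ge0// ler0_norm// mulrN opprK.
  by apply: RintegrableZ; exact: integrable_oneDsqrV.
pose B : set (measurableTypeR R) := `[-1, 0]%classic.
have B0 : (0 < leb B)%E.
  by rewrite /B lebesgue_measure_itv/= lte_fin ltrN10 -EFinB lte_fin subr_gt0 ltrN10.
apply: (@Rintegral_gt0_set _ _ R leb _ B _ _ B0 (expR_gt0 (- (s + s))) _ _ iF).
- exact: measurable_itv.
- by move=> t; rewrite E; case: ifP => // _; exact: expR_ge0.
- move=> t; rewrite /B /= in_itv/= => /andP[t1 t0].
  rewrite E t0 ler_expR -mulrN1 ler_wpM2l// ltW//.
Qed.

End mellin.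

(** * Homogeneous functions as averages of cut-offs *)

Section homogeneous.
Variables (R : realType) (n : nat).
Local Notation V := 'rV[R]_n.
Local Notation leb := (@lebesgue_measure R).

Lemma CeM (F G : V -> R) : Ce F -> Ce G -> Ce (fun x => F x * G x).
Proof.
move=> [eF sF] [eG sG]; split; first by move=> x sx; rewrite eF// eG.
by apply: smooth_onM => //; exact: open_neq0.
Qed.

(** On the sphere of radius [sqrt 2] the cut-off is [F] times the positive number [chi 2], so
    boundedness of a Schwartz function suffices. The term [|F 0|] accounts for [radproj 0 = 0]. *)
Lemma Ce_bounded (F : V -> R) : Ce F -> exists M, forall x, `|F (radproj x)| <= M.
Proof.
move=> cF; have [C hC] := schwartz_decay 0 (schwartz_cutoff cF).
have c2 : 0 < chi (2 : R) by rewrite chi_gt0//; lra.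
have C0 : 0 <= C by apply: le_trans (hC 0); rewrite mulr_ge0// exprn_ge0// enorm_ge0.
exists (C / chi 2 + `|F 0|) => x; have [->|x0] := eqVneq x 0.
  by rewrite radproj0 lerDr divr_ge0// ltW.
apply: (@le_trans _ _ (C / chi 2)); last by rewrite lerDl.
have s2 : 0 < Num.sqrt 2 :> R by rewrite sqrtr_gt0.
have := hC (Num.sqrt 2 *: radproj x).
rewrite expr0 mul1r /cutoff radprojZ// radproj_id dotRZl dotRZr -sqr_enorm.
rewrite enorm_radproj// expr1n mulr1 -expr2 sqr_sqrtr// normrM (gtr0_norm c2).
by rewrite ler_pdivlMr.
Qed.

Lemma measurable_radproj (F : V -> R) : Ce F -> measurable_fun setT (fun x => F
  (radproj x)).
Proof.
move=> [_ sF].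
have -> : [set: V] = [set x | x != 0] `|` [set 0].
  apply/seteqP; split => // x _; have [->|x0] := eqVneq x 0; [by right|by left].
have m1 := @measurable_rV_set1 R n.
have mD : measurable [set x : V | x != 0].
  have -> : [set x : V | x != 0] = ~` [set 0] by apply/seteqP; split => x /= /eqP.
  exact: measurableC.
apply/measurable_funU => //; split; last exact: measurable_fun_set1.
apply: continuous_on_measurable => // x x0; exact: (smooth_on_continuous sF x0).
Qed.

Lemma hr0 (F : V -> R) s : s != 0 -> hr F s 0 = 0.
Proof. by move=> s0; rewrite /hr enorm0 powR0// mul0r. Qed.

Lemma hr_even (F : V -> R) s x : Ce F -> hr F s (- x) = hr F s x.
Proof.
move=> [eF _]; rewrite /hr enormN radprojN.
have [->|x0] := eqVneq x 0; first by rewrite radproj0 oppr0.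
by rewrite eF//; exact: enorm_radproj.
Qed.

Lemma scaleint_cutoff (a : R) (F : V -> R) x : a != 0 -> Ce F ->
  scaleint a (cutoff F) x = mellin_chi a * hr F (- a) x.
Proof.
move=> a0 cF; have [mF _ _] := schwartz_nice (schwartz_cutoff cF).
have [->|x0] := eqVneq x 0; first by rewrite scaleint0// hr0 ?mulr0// oppr_eq0.
have mrho : measurable_fun setT (fun r : R => chi (r ^+ 2)).
  apply: continuous_measurable_fun => r.
  apply: (cvg_comp (fun r : R => r ^+ 2) (@chi R) _ (@continuous_chi R _)).
  exact: exprn_continuous.
rewrite (@scaleint_radial R n a _ F (fun r => chi (r ^+ 2)))//.
by move=> y _; rewrite /cutoff sqr_enorm.
Qed.

Section exponent.
Variable a : R.
Hypotheses (a0 : 0 < a) (an : a < n%:R).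

Let aN0 : a != 0. Proof. by rewrite gt_eqF. Qed.
Let ca0 : mellin_chi a != 0. Proof. by rewrite gt_eqF// mellin_chi_gt0. Qed.

(** This replaces direct estimates near the singularity: integrability of [F . r^(-a)] against test
    functions and all its pairings are read off from those of averages. *)
Lemma hrE (F : V -> R) x : Ce F ->
  hr F (- a) x = (mellin_chi a)^-1 * scaleint a (cutoff F) x.
Proof. by move=> cF; rewrite scaleint_cutoff// mulrA mulVf// mul1r. Qed.

Lemma integrable_hrM (F H : V -> R) : Ce F -> nice H ->
  (mu n).-integrable setT (EFin \o (fun x => hr F (- a) x * H x)).
Proof.
move=> cF nH; have nF := schwartz_nice (schwartz_cutoff cF).
have := RintegrableZ (mellin_chi a)^-1 (integrable_scaleintM a0 an nF nH).
by apply: eq_integrable => // x _; rewrite /= hrE// mulrA.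
Qed.

Lemma Rintegral_hrM (F H : V -> R) : Ce F -> nice H ->
  \int[mu n]_x (hr F (- a) x * H x) =
  (mellin_chi a)^-1 * \int[mu n]_x (scaleint a (cutoff F) x * H x).
Proof.
move=> cF nH; have nF := schwartz_nice (schwartz_cutoff cF).
rewrite -RintegralZ; last first.
  apply/measurable_EFinP; exact: measurable_int (integrable_scaleintM a0 an nF nH).
by apply: eq_Rintegral => x _; rewrite hrE// mulrA.
Qed.

Lemma FT_reE (F phi : V -> R) : Ce F -> schwartz phi ->
  FT_re (hr F (- a)) phi = \int[mu n]_x (hr F (- a) x * ft 0 phi x).
Proof.
move=> cF sphi; have [_ _ iphi] := schwartz_nice sphi.
have E : (fun x => hr F (- a) x * ft_cos phi x) = (fun x => hr F (- a) x * ft 0 phi x).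
  by apply/funext => x; rewrite ft_cosE.
rewrite /FT_re E integral_RnE//; apply: integrable_hrM => //.
exact/schwartz_nice/schwartz_ft.
Qed.

Lemma FT_im0 (F phi : V -> R) : Ce F -> schwartz phi -> FT_im (hr F (- a)) phi = 0.
Proof.
move=> cF sphi; have [mphi _ iphi] := schwartz_nice sphi.
have E : (fun x => hr F (- a) x * ft_sin phi x) =
    (fun x => hr F (- a) x * ft (- (pi / 2)) phi x).
  by apply/funext => x; rewrite ft_sinE.
have iH := integrable_hrM cF (schwartz_nice (schwartz_ft (- (pi / 2)) sphi)).
rewrite /FT_im E integral_RnE// Rintegral_odd ?oppr0//.
  by apply/measurable_EFinP; exact: measurable_int iH.
by move=> x; rewrite hr_even// ft_sinN// mulrN.
Qed.

Lemma pair_reE (F phi : V -> R) : Ce F -> schwartz phi ->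
  pair_re (hr F (- a)) phi = \int[mu n]_x (hr F (- a) x * phi x).
Proof.
move=> cF sphi; rewrite /pair_re integral_RnE//; apply: integrable_hrM => //.
exact: schwartz_nice.
Qed.

(** Test the difference [D] against its own cut-off: the integrand is
    [|y|^(-a) chi (|y|^2) D (y/|y|)^2], nonnegative with integral [0], hence zero wherever it is
    continuous. *)
Lemma hr_unique (F G : V -> R) : Ce F -> Ce G ->
  (forall phi, schwartz phi ->
    \int[mu n]_x (hr F (- a) x * phi x) = \int[mu n]_x (hr G (- a) x * phi x)) ->
  forall x, sphere x -> F x = G x.
Proof.
move=> cF cG h x sx.
pose D y := F y + -1 * G y.
have cD : Ce D by apply: CeD => //; exact: CeZ.
have sD := schwartz_cutoff cD; have nD := schwartz_nice sD.
have iF := integrable_hrM cF nD; have iG := integrable_hrM cG nD.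
have E y : hr D (- a) y * cutoff D y = hr F (- a) y * cutoff D y - hr G (- a) y *
  cutoff D y.
  by rewrite /hr /D; ring.
have int0 : \int[mu n]_y (hr D (- a) y * cutoff D y) = 0.
  under eq_Rintegral do rewrite E.
  by rewrite RintegralB// h// subrr.
(* The point [sqrt 2 x] has squared norm [2], where [chi] is positive. *)
have s2 : 0 < Num.sqrt 2 :> R by rewrite sqrtr_gt0.
have x0 : x != 0 by rewrite -enorm_gt0 (_ : enorm x = 1)// ltr01.
have z0 : Num.sqrt 2 *: x != 0 by rewrite scaler_eq0 negb_or x0 andbT gt_eqF.
have pos y : hr D (- a) y * cutoff D y = enorm y `^ (- a) * chi (dotR y y) * D (radproj
  y) ^+ 2.
  by rewrite /hr /cutoff; ring.
have ge0 y : 0 <= hr D (- a) y * cutoff D y.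
  by rewrite pos mulr_ge0 ?sqr_ge0// mulr_ge0 ?powR_ge0 ?chi_ge0.
have cont : {for Num.sqrt 2 *: x, continuous (fun y => hr D (- a) y * cutoff D y)}.
  have sm : smooth_on [set y : V | y != 0] (fun y => hr D (- a) y * cutoff D y).
    apply: smooth_onM; first exact: open_neq0.
      apply: smooth_onM; first exact: open_neq0.
        exact: smooth_on_enorm_powR.
      by case: cD.
    by apply: smooth_on_subset (proj1 sD).
  exact: smooth_on_continuous sm z0.
have := integral0_continuous_eq0 (integrable_hrM cD nD) ge0 cont int0.
rewrite pos enormZ sx mulr1 dotRZl dotRZr -sqr_enorm sx expr1n mulr1 -expr2 sqr_sqrtr//.
rewrite radprojZ// radproj_sphere// => /eqP.
rewrite mulf_eq0 sqrf_eq0 mulf_eq0 powR_eq0 (gtr0_norm s2) (gt_eqF s2) /=.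
have c2 : 0 < chi (2 : R) by rewrite chi_gt0//; lra.
by rewrite (gt_eqF c2) /= /D mulN1r subr_eq0 => /eqP.
Qed.

End exponent.

End homogeneous.

(** * Surface integrals as volume integrals *)

Section polar.
Variables (R : realType) (n : nat).
Local Notation V := 'rV[R]_n.
Local Notation leb := (@lebesgue_measure R).
Hypothesis n0 : (0 < n)%N.
Let nR : 0 < n%:R :> R. Proof. by rewrite ltr0n. Qed.
(** The self-dual exponent: as [n - b = b], both sides of [scaleint_sym] involve the same
    exponent. *)
Let b : R := n%:R / 2.
Let b0 : 0 < b. Proof. by rewrite divr_gt0. Qed.
Let bn : b < n%:R. Proof. by rewrite ltr_pdivrMr// ltr_pMr// ltr1n. Qed.
Let bb : n%:R - b = b. Proof. by rewrite /b; field. Qed.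
Let nbb : n%:R = b + b. Proof. by rewrite /b; field. Qed.

Lemma Rintegral_eq_off0 (F G : V -> R) : measurable_fun setT F -> measurable_fun setT G ->
  (forall x, x != 0 -> F x = G x) -> \int[mu n]_x F x = \int[mu n]_x G x.
Proof.
move=> mF mG FG; rewrite /Rintegral; congr fine; apply: ae_eq_integral => //.
- exact/measurable_EFinP.
- exact/measurable_EFinP.
exists [set 0]; split; [exact: measurable_rV_set1|exact: mu_set1|].
move=> x /= h; apply: contrapT => /eqP x0; apply: h => _; congr EFin; exact: FG.
Qed.

Lemma measurable_enorm : measurable_fun setT (@enorm R n).
Proof.
apply: (measurableT_comp (continuous_measurable_fun (@sqrt_continuous R))).
exact: measurable_dotR.
Qed.

Let one1 (x : V) : R := \1_(`]-oo, 1]%classic) (enorm x).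

Let one1E x : one1 x = (enorm x <= 1)%R%:R.
Proof. by rewrite /one1 indicE mem_setE in_itv. Qed.

Let measurable_one1 : measurable_fun setT one1.
Proof.
apply: (measurableT_comp _ measurable_enorm).
by apply: measurable_indic; exact: measurable_itv.
Qed.

Let one1_weight x : one1 x <= 2 ^+ n * weight x.
Proof.
rewrite one1E; case: (leP (enorm x) 1) => x1; last first.
  by rewrite [leLHS]mulr0n mulr_ge0 ?exprn_ge0 ?weight_ge0.
have -> : 2 ^+ n = \prod_(i < n) (2 : R) by rewrite prodr_const card_ord.
rewrite /weight -big_split /=.
have -> : true%:R = \prod_(i < n) (1 : R) by rewrite big1_eq.
apply: ler_prod => i _; rewrite ler01 /= ler_pdivlMr ?mul1r; last first.
  by rewrite (lt_le_trans ltr01)// oneDsqr_ge1.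
have : `|x ord0 i| ^+ 2 <= 1.
  by rewrite expr_le1// (le_trans (coord_le_enorm x i)).
by rewrite real_normK ?num_real// /oneDsqr; lra.
Qed.

Let nice_one1M (F : V -> R) M : measurable_fun setT F -> (forall x, `|F x| <= M) ->
  (mu n).-integrable setT (EFin \o (fun x => F x * one1 x)).
Proof.
move=> mF hM; apply: (integrableMbounded mF hM).
apply: (@Rle_integrable _ _ R (mu n) _ (fun x => 2 ^+ n * weight x)) => //.
  by move=> x; rewrite ger0_norm ?one1_weight// one1E ler0n.
by apply: RintegrableZ; exact: integrable_weight.
Qed.

Let G (x : V) : R := enorm x `^ b * one1 x.

Let nice_G : nice G.
Proof.
have G1 x : `|G x| <= one1 x.
  rewrite /G one1E; case: (leP (enorm x) 1) => x1; last by rewrite mulr0 normr0.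
  rewrite mulr1 ger0_norm ?powR_ge0//.
  apply: (@le_trans _ _ (1 `^ b)); last by rewrite powR1.
  by rewrite ge0_ler_powR ?nnegrE ?enorm_ge0// ltW.
have mG : measurable_fun setT G.
  apply: measurable_funM => //.
  exact: (measurableT_comp (@measurable_powR R b) measurable_enorm).
split => //.
  by exists 1 => x; apply: le_trans (G1 x) _; rewrite one1E; case: (enorm x <= 1).
apply: (@Rle_integrable _ _ R (mu n) _ (fun x => 2 ^+ n * weight x)) => //.
  by move=> x; exact: le_trans (G1 x) (one1_weight x).
by apply: RintegrableZ; exact: integrable_weight.
Qed.

Let scaleint_G x : scaleint b G x = mellin_unit b * enorm x `^ (- b).
Proof.
have [mG _ _] := nice_G.
have bN0 : b != 0 by rewrite gt_eqF.
have [->|x0] := eqVneq x 0.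
  by rewrite scaleint0// enorm0 powR0 ?oppr_eq0// mulr0.
rewrite (@scaleint_radial R n b G (fun=> 1) (fun r => r `^ b * \1_(`]-oo, 1]%classic)
  r))//.
- by rewrite mulr1.
- apply: measurable_funM; first exact: measurable_powR.
  by apply: measurable_indic; exact: measurable_itv.
- by move=> y _; rewrite mul1r.
Qed.

(* Apply [scaleint_sym] with exponent [n / 2] to [|x|^(n/2) 1_(|x| <= 1)] and
   [F (x/|x|) |x|^(n/2-a) chi (|x|^2)]: both averages are explicit. *)
Lemma polar (a : R) : 0 < a < n%:R -> exists2 k, 0 < k & forall F : V -> R, Ce F ->
  \int[mu n]_x (hr F (- a) x * chi (dotR x x)) = k * sphere_int F.
Proof.
move=> /andP[a0 an].
have c0 : 0 < mellin_chi (n%:R - a) by rewrite mellin_chi_gt0// subr_gt0.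
have d0 : 0 < mellin_unit b by exact: mellin_unit_gt0.
exists (mellin_chi (n%:R - a) / (mellin_unit b * n%:R)); first by rewrite divr_gt0//
  mulr_gt0.
move=> F cF.
(* The average of [G] is a multiple of [|x|^(-b)], so the power [b - a] makes the product
   homogeneous of degree [-a] apart from [chi]. *)
have sH := schwartz_cutoff_pow (b - a) cF; have nH := schwartz_nice sH.
have [mH _ _] := nH.
have [M hM] := Ce_bounded cF; have mF := measurable_radproj cF.
pose S x := F (radproj x) * one1 x.
have mS : measurable_fun setT S by exact: measurable_funM.
have iS : (mu n).-integrable setT (EFin \o S) by exact: nice_one1M mF hM.
have -> : sphere_int F = n%:R * \int[mu n]_x S x.
  rewrite /sphere_int; congr (_ * _).
  have -> : (fun x => if enorm x <= 1 then F (radproj x) else 0) = S.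
    by apply/funext => x; rewrite /S one1E; case: ifP => _; rewrite ?mulr1 ?mulr0.
  by rewrite integral_RnE.
have := @scaleint_sym R n b G _ _ nice_G nH; rewrite b0 bn bb => /(_ isT).
have mchi : measurable_fun setT (fun x : V => chi (dotR x x)).
  apply: continuous_measurable_rV => x.
  exact: (cvg_comp _ _ (@continuous_dotR R n x) (@continuous_chi R _)).
have -> : \int[mu n]_x (scaleint b G x * (enorm x `^ (b - a) * cutoff F x)) =
    mellin_unit b * \int[mu n]_x (hr F (- a) x * chi (dotR x x)).
  rewrite -RintegralZ; last first.
    apply: measurable_funM => //; apply: measurable_funM => //.
    exact: (measurableT_comp (@measurable_powR R (- a)) measurable_enorm).
  apply: eq_Rintegral => x _; rewrite scaleint_G /hr /cutoff.
  have [->|x0] := eqVneq x 0.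
    by rewrite chi_eq0l ?mulr0// -sqr_enorm enorm0 expr0n.
  have -> : enorm x `^ (- a) = enorm x `^ (- b) * enorm x `^ (b - a).
    rewrite -powRD; first by congr (_ `^ _); ring.
    by apply/implyP => _; rewrite enorm_eq0.
  ring.
have -> : \int[mu n]_x (scaleint b (fun x => enorm x `^ (b - a) * cutoff F x) x * G x) =
    mellin_chi (n%:R - a) * \int[mu n]_x S x.
  rewrite -RintegralZ//.
  have [_ _ iHG] := nH.
  have mscale : measurable_fun setT (fun x => scaleint b (fun x => enorm x `^ (b - a) *
    cutoff F x) x * G x).
    by apply/measurable_EFinP; exact: measurable_int (integrable_scaleintM b0 bn nH
      nice_G).
  (* At the origin the left side is [0] while [S 0] is [F 0]; the two functions agree only off this
     null set. *)
  apply: Rintegral_eq_off0 => //; first exact: measurable_funM.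
  move=> x x0.
  rewrite (@scaleint_radial R n b _ F (fun r => r `^ (b - a) * chi (r ^+ 2)))//.
  (* The exponents add up to [b + (b - a) = n - a]. *)
  - have -> : \int[leb]_t (expR (b * t) * (expR t `^ (b - a) * chi (expR t ^+ 2))) =
    mellin_chi (n%:R - a).
      apply: eq_Rintegral => t _; rewrite powR_expR mulrA -expRD.
      by congr (expR _ * _); rewrite nbb; ring.
    rewrite /G /S -!mulrA; congr (_ * _).
    rewrite mulrCA; congr (_ * _); rewrite mulrA -powRD ?addNr ?powRr0 ?mul1r//.
    by apply/implyP => _; rewrite enorm_eq0.
  - apply: measurable_funM; first exact: measurable_powR.
    apply: continuous_measurable_fun => r.
    apply: (cvg_comp (fun r : R => r ^+ 2) (@chi R) _ (@continuous_chi R _)).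
    exact: exprn_continuous.
  - by move=> y _; rewrite /cutoff sqr_enorm mulrCA.
move=> E.
have d1 : mellin_unit b != 0 by rewrite gt_eqF.
have n1 : n%:R != 0 :> R by rewrite gt_eqF.
apply: (mulfI d1); rewrite E; field.
by rewrite d1 n1.
Qed.

End polar.

(** * Existence and uniqueness of [T_q f], and the two inclusions *)

Section operator.
Variables (R : realType) (n : nat) (q : R).
Local Notation V := 'rV[R]_n.
Hypothesis nq : - (n%:R) < q < 0.
Let a : R := n%:R + q.
Let a0 : 0 < a. Proof. by rewrite /a; move: nq => /andP[]; lra. Qed.
Let an : a < n%:R. Proof. by rewrite /a; move: nq => /andP[]; lra. Qed.
(** Thus [c = - q]. The degrees [-a] and [-c] are exchanged by the Fourier transform, and both
    exponents lie strictly between [0] and [n], so every fact about [a] is available for [c]. *)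
Let c : R := n%:R - a.
Let c0 : 0 < c. Proof. by rewrite subr_gt0. Qed.
Let cn : c < n%:R. Proof. by rewrite /c; move: a0; lra. Qed.
Let c0n : 0 < c < n%:R. Proof. by rewrite c0 cn. Qed.
Let a0n : 0 < a < n%:R. Proof. by rewrite a0 an. Qed.
Let qE : q = - c. Proof. by rewrite /c /a; ring. Qed.
Let aE : - n%:R - q = - a. Proof. by rewrite /a; ring. Qed.
Let caE : n%:R - c = a. Proof. by rewrite /c; ring. Qed.

Lemma hrZ k (F : V -> R) s x : hr (fun y => k * F y) s x = k * hr F s x.
Proof. by rewrite /hr mulrCA. Qed.

Lemma dim_gt0 : (0 < n)%N.
Proof. by rewrite lt0n; apply/eqP => n0; move: nq; rewrite n0 => /andP[]; lra. Qed.

Lemma Tq_relP (f g : V -> R) : Ce f -> Ce g ->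
  Tq_rel q f g <-> forall phi, schwartz phi ->
    \int[mu n]_x (hr f (- a) x * ft 0 phi x) = \int[mu n]_x (hr g (- c) x * phi x).
Proof.
move=> cf cg; rewrite /Tq_rel aE qE; split => h phi sphi.
  by have [+ _] := h phi sphi; rewrite (FT_reE a0 an)// (pair_reE c0 cn).
by rewrite (FT_reE a0 an)// (pair_reE c0 cn)// (FT_im0 a0 an)//; split => //; exact: h.
Qed.

Lemma Rintegral_hr_ft (f phi : V -> R) : Ce f -> schwartz phi ->
  \int[mu n]_x (hr f (- a) x * ft 0 phi x) =
  (mellin_chi a)^-1 * \int[mu n]_x (scaleint c (ft 0 (cutoff f)) x * phi x).
Proof.
move=> cf sphi; have sf := schwartz_cutoff cf.
rewrite (Rintegral_hrM a0 an)//; last exact/schwartz_nice/schwartz_ft.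
by rewrite (scaleint_ft a0n)//; do ?exact: schwartz_nice; exact/schwartz_nice/schwartz_ft.
Qed.

Lemma ft0_even (phi : V -> R) x : schwartz phi -> (forall y, phi (- y) = phi y) ->
  ft 0 phi (- x) = ft 0 phi x.
Proof. by move=> sphi ephi; apply: ftN_even => //; have [] := schwartz_nice sphi. Qed.

Lemma Tq_exists (f : V -> R) : Ce f -> exists g, Ce g /\ Tq_rel q f g.
Proof.
move=> cf; have sf := schwartz_cutoff cf; have sff := schwartz_ft 0 sf.
have [mff _ _] := schwartz_nice sff.
have cs : Ce (scaleint c (ft 0 (cutoff f))).
  apply: Ce_scaleint => // y; apply: ft0_even => // z; exact: cutoff_even.
exists (fun x => (mellin_chi a)^-1 * scaleint c (ft 0 (cutoff f)) x).
have cg := CeZ (mellin_chi a)^-1 cs.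
split => //; apply/Tq_relP => // phi sphi; rewrite Rintegral_hr_ft//.
have iS := integrable_scaleintM c0 cn (schwartz_nice sff) (schwartz_nice sphi).
rewrite -RintegralZ; last by apply/measurable_EFinP; exact: measurable_int iS.
by apply: eq_Rintegral => x _; rewrite hrZ scaleint_hr ?gt_eqF// mulrA.
Qed.

(** Existence is what makes the choice by [epsilon] meet its specification; its values on the sphere
    are pinned down by [Tq_unique]. *)
Lemma TqP (f : V -> R) : Ce f -> Ce (Tq q f) /\ Tq_rel q f (Tq q f).
Proof.
move=> cf.
exact: (epsilon_spec (inhabits (fun=> 0)) (fun g => Ce g /\ Tq_rel q f g) (Tq_exists cf)).
Qed.

Lemma Tq_unique (f g : V -> R) : Ce f -> Ce g -> Tq_rel q f g ->
  forall x, sphere x -> Tq q f x = g x.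
Proof.
move=> cf cg fg; have [cT fT] := TqP cf.
move/(Tq_relP cf cT): fT => fT; move/(Tq_relP cf cg): fg => fg.
by apply: (hr_unique c0 cn cT cg) => phi sphi; rewrite -fT// fg.
Qed.

Lemma posdef_Pos (h : V -> R) : Ce h -> posdef (hr h q) -> Pos (Tq q) h.
Proof.
move=> ch ph; split => // f cf Tf0.
have [k k0 hk] := polar dim_gt0 a0n.
have [kap kap0 hkap] := @ft_inversion R n.
have [] := TqP cf; move: (Tq q f) Tf0 => g Tf0 cg /(Tq_relP cf cg) fg.
have sh := schwartz_cutoff ch; have sg := schwartz_cutoff cg.
have sfh := schwartz_ft 0 sh; have sfg := schwartz_ft 0 sg.
have eg x : cutoff g (- x) = cutoff g x by exact: cutoff_even.
have eh x : cutoff h (- x) = cutoff h x by exact: cutoff_even.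
have g0 x : 0 <= cutoff g x.
  have [->|x0] := eqVneq x 0.
    by rewrite cutoff_eq0l// -sqr_enorm enorm0 expr0n ler01.
  by rewrite /cutoff mulr_ge0 ?chi_ge0//; apply: Tf0; exact: enorm_radproj.
have [_] := ph _ sg eg g0; rewrite qE (FT_reE c0 cn)//.
(* The pairing is symmetric in [g] and [h]: up to the common factor [1 / c_c], both sides equal the
   integral of [cutoff h] against the average, with exponent [a], of the transform of [cutoff g]. *)
have E1 : \int[mu n]_x (hr h (- c) x * ft 0 (cutoff g) x) =
    \int[mu n]_x (hr g (- c) x * ft 0 (cutoff h) x).
  have nh := schwartz_nice sh; have ng := schwartz_nice sg.
  have nfh := schwartz_nice sfh; have nfg := schwartz_nice sfg.
  rewrite (Rintegral_hrM c0 cn ch nfg) (Rintegral_hrM c0 cn cg nfh); congr (_ * _).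
  rewrite (scaleint_ft c0n ng nh nfg nfh) (scaleint_sym c0n nh nfg).
  by rewrite caE.
(* Testing the relation between [f] and [g] on the transform of [cutoff h] trades [g] for [f] and
   creates the double transform that inversion removes. *)
rewrite {}E1 -fg//.
have E2 : \int[mu n]_x (hr f (- a) x * ft 0 (ft 0 (cutoff h)) x) =
    kap * (k * sphere_int (fun x => f x * h x)).
  rewrite -hk; last exact: CeM.
  have iF := integrable_hrM a0 an cf (schwartz_nice sh).
  have -> : \int[mu n]_x (hr (fun x => f x * h x) (- a) x * chi (dotR x x)) =
      \int[mu n]_x (hr f (- a) x * cutoff h x).
    by apply: eq_Rintegral => x _; rewrite /hr /cutoff; ring.
  rewrite -RintegralZ; last by apply/measurable_EFinP; exact: measurable_int iF.
  by apply: eq_Rintegral => x _; rewrite hkap//; ring.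
by rewrite E2 mulrA pmulr_rge0// mulr_gt0.
Qed.

Lemma Pos_posdef (h : V -> R) : Pos (Tq q) h -> posdef (hr h q).
Proof.
move=> [ch Ph] phi sphi ephi phi0; rewrite qE (FT_im0 c0 cn)// (FT_reE c0 cn)//.
split => //.
have [k k0 hk] := polar dim_gt0 a0n.
have [kap kap0 hkap] := @ft_inversion R n.
have sh := schwartz_cutoff ch; have sfphi := schwartz_ft 0 sphi.
have nh := schwartz_nice sh; have nfphi := schwartz_nice sfphi.
have nphi := schwartz_nice sphi; have [mphi _ _] := nphi; have [mfphi _ _] := nfphi.
have efphi y : ft 0 phi (- y) = ft 0 phi y by exact: ft0_even.
pose f := scaleint a (ft 0 phi).
have cf : Ce f by exact: Ce_scaleint.
(* The transform of [f . r^(-a)] is an average of the double transform of [phi], which inversion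
   turns into [kap * phi]. *)
pose g x := kap * scaleint c phi x.
have cg : Ce g by apply: CeZ; exact: Ce_scaleint.
have fg : Tq_rel q f g.
  apply/(Tq_relP cf cg) => psi spsi.
  have npsi := schwartz_nice spsi; have nfpsi := schwartz_nice (schwartz_ft 0 spsi).
  have nffphi := schwartz_nice (schwartz_ft 0 sfphi).
  rewrite /f scaleint_hr ?gt_eqF// (scaleint_ft a0n nfphi npsi nffphi nfpsi).
  apply: eq_Rintegral => x _; congr (_ * _).
  rewrite /g hrZ scaleint_hr ?gt_eqF// /scaleint -RintegralZ; last exact:
    measurable_scaleint_integrand.
  by apply: eq_Rintegral => t _; rewrite hkap//; ring.
have Tf0 x : sphere x -> 0 <= Tq q f x.
  move=> sx; rewrite (Tq_unique cf cg fg)// mulr_ge0 ?(ltW kap0)//.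
  by apply: Rintegral_ge0 => t _; rewrite mulr_ge0 ?expR_ge0.
have S0 := Ph f cf Tf0.
rewrite (Rintegral_hrM c0 cn ch nfphi) (scaleint_sym c0n nh nfphi) caE -/f.
apply: mulr_ge0; first by rewrite invr_ge0 ltW// mellin_chi_gt0.
have -> : \int[mu n]_x (f x * cutoff h x) = k * sphere_int (fun x => f x * h x).
  rewrite -hk; last exact: CeM.
  have aN0 : a != 0 by rewrite gt_eqF.
  (* Only the first occurrence is rewritten: [f] off the sphere carries the power [|x|^(-a)], while
     [sphere_int] keeps [f] itself. *)
  have {1}-> : f = hr f (- a) by rewrite /f scaleint_hr.
  by apply: eq_Rintegral => x _; rewrite /hr /cutoff; ring.
by rewrite mulr_ge0// ltW.
Qed.

End operator.

Theorem theorem3 (R : realType) (n : nat) (q : R) :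
  - (n%:R) < q < 0 ->
  forall h : 'rV[R]_n -> R,
    Pos (Tq q) h <-> (Ce h /\ posdef (hr h q)).
Proof.
move=> nq h; split => [Ph|[ch ph]]; last exact: posdef_Pos.
by split; [case: Ph|exact: Pos_posdef].
Qed.
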